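(* Let $0\le k<1$, let $\varphi\in\mathbf\Sigma_k$, and let $0\le m\le M$. Suppose that $$m\le\fint_B\left|\frac{2n_\varphi}{\rho_*}(z)\right|^2\rho_*(z)\,|dz|^2\le M$$ for all sufficiently large boxes $B$ in the exterior unit disk. Then $$m\le\liminf_{|p|\to0}\frac{\beta_\varphi(p)}{|p|^2/4}\le\limsup_{|p|\to0}\frac{\beta_\varphi(p)}{|p|^2/4}\le M,$$ where $p$ ranges over nonzero complex numbers.
   Context: $\mathbb D^*=\{|z|>1\}$, with hyperbolic density $\rho_*(z)=2/(|z|^2-1)$. $\mathbf\Sigma_k$ is the collection of conformal maps $\varphi:\mathbb D^*\to\mathbb C$ with $\varphi(z)=z+\mathcal O(1/|z|)$ near infinity which admit a quasiconformal extension to the complex plane with dilatation $\mu=\overline\partial\varphi/\partial\varphi$ satisfying $\|\mu\|_\infty\le k$. The non-linearity is $n_\varphi=\varphi''/\varphi'$. The branch of $\log\varphi'$ vanishes at infinity, $\varphi'(z)^p=\exp(p\log\varphi'(z))$, and for $p\in\mathbb C$ $$\beta_\varphi(p)=\limsup_{r\to1^+}\frac{\log\int_{|z|=r}|\varphi'(z)^p|\,d\theta}{\log\frac1{r-1}}.$$ A box in $\mathbb D^*$ is an annular rectangle $B=\{z:r_1<|z|<r_2,\ \theta_1<\arg z<\theta_2\}$ with $1<r_1<r_2$ and $0<\theta_2-\theta_1\le2\pi$. The notation $\fint_B\dots\rho_*(z)|dz|^2$ denotes the average over $B$ with respect to the measure $\rho_*(z)|dz|^2$ ($|dz|^2$ is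 area measure). ''For all sufficiently large boxes'' means: there exist $n_0>1$ and $r_0>1$ such that the inequalities hold for every box with $r_2\le r_0$, $(r_2-1)/(r_1-1)\ge n_0$ and $\theta_2-\theta_1\ge r_2-1$ (i.e. boxes near the unit circle, of large hyperbolic height, whose angular width is at least the height of their top edge above the circle). *)

(* Defs.v *)
From HB Require Import structures.
From mathcomp Require Import all_boot all_order all_algebra.
From mathcomp Require Import all_classical all_reals all_analysis.
From mathcomp Require Import ess_sup_inf.
From mathcomp Require Export complex.

Set Implicit Arguments.
Unset Strict Implicit.
Unset Printing Implicit Defensive.

Import Order.TTheory GRing.Theory Num.Theory.
Import numFieldNormedType.Exports.

Local Open Scope ring_scope.
Local Open Scope complex_scope.
Local Open Scope classical_set_scope.

(* [R[i]] packed as a numeric field, so that its carrier has the topology of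
   the modulus and [derive1] on it is complex differentiation.  The norm [`|z|]
   takes values in [Cplx R] itself; [cmod] is the real-valued modulus.  *)
Definition Cplx (R : realType) : numFieldType := R[i].

Section ComplexPlane.
Context {R : realType}.
Local Notation C := (Cplx R).

Definition cmod (z : C) : R := Normc.normc z.

Definition cexp (z : C) : C :=
  (expR (complex.Re z) * cos (complex.Im z)) +i* (expR (complex.Re z) * sin (complex.Im z)).

Definition polar (r t : R) : C := (r * cos t) +i* (r * sin t).

Definition of_pair (w : R * R) : C := w.1 +i* w.2.

Local Notation area := (@lebesgue_measure R \x @lebesgue_measure R)%E.

Definition extdisk : set C := [set z | 1 < cmod z].

Definition hdensity (z : C) : R := 2 / (cmod z ^+ 2 - 1).

Definition holomorphic_on (D : set C) (f : C -> C) :=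
  forall z, D z -> derivable f z 1.

Definition conformal_on (D : set C) (f : C -> C) :=
  holomorphic_on D f /\ set_inj D f.

Definition abs_continuous (a b : R) (f : R -> C) :=
  forall e : R, 0 < e -> exists2 d : R, 0 < d &
    forall (n : nat) (u v : 'I_n -> R),
      (forall i, a <= u i /\ u i <= v i /\ v i <= b) ->
      trivIset setT (fun i => `]u i, v i[%classic) ->
      \sum_(i < n) (v i - u i) < d ->
      \sum_(i < n) cmod (f (v i) - f (u i)) < e.

(* Absolute continuity on almost every horizontal and vertical segment.  *)
Definition ACL (F : C -> C) :=
  forall a b c d : R, a < b -> c < d ->
    {ae @lebesgue_measure R, forall y, y \in `[c, d] ->
       abs_continuous a b (fun x => F (x +i* y))} /\
    {ae @lebesgue_measure R, forall x, x \in `[a, b] ->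
       abs_continuous c d (fun y => F (x +i* y))}.

Definition dx (F : C -> C) (z : C) : C :=
  (derive1 (fun t : R => complex.Re (F (t +i* complex.Im z))) (complex.Re z) : R) +i*
  (derive1 (fun t : R => complex.Im (F (t +i* complex.Im z))) (complex.Re z) : R).

Definition dy (F : C -> C) (z : C) : C :=
  (derive1 (fun t : R => complex.Re (F (complex.Re z +i* t))) (complex.Im z) : R) +i*
  (derive1 (fun t : R => complex.Im (F (complex.Re z +i* t))) (complex.Im z) : R).

Definition wirt (F : C -> C) (z : C) : C := (dx F z - (0 +i* 1) * dy F z) / 2.
Definition wirt_bar (F : C -> C) (z : C) : C := (dx F z + (0 +i* 1) * dy F z) / 2.

Definition homeomorphism (F : C -> C) :=
  continuous F /\ exists G : C -> C, [/\ continuous G, cancel F G & cancel G F].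

(* The analytic definition of Ahlfors; the last clause also fixes the
   orientation.  *)
Definition quasiconformal (F : C -> C) :=
  [/\ homeomorphism F, ACL F & exists2 k : R, 0 <= k < 1 &
    {ae area, forall w,
      cmod (wirt_bar F (of_pair w)) <= k * cmod (wirt F (of_pair w))}].

(* Division by zero returns 0 here; for quasiconformal [F], [wirt F] vanishes
   only where [wirt_bar F] does, up to a null set.  *)
Definition dilatation (F : C -> C) (z : C) : C := wirt_bar F z / wirt F z.

Definition dilatation_norm (F : C -> C) : \bar R :=
  ess_sup area (fun w => (cmod (dilatation F (of_pair w)))%:E).

Definition Sigma_ (k : R) (phi : C -> C) :=
  [/\ conformal_on extdisk phi,
      exists A r : R, forall z : C, r < cmod z -> cmod (phi z - z) <= A / cmod z
    & exists F : C -> C, [/\ {in extdisk, F =1 phi}, quasiconformal F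
        & (dilatation_norm F <= k%:E)%E]].

Definition nonlinearity (phi : C -> C) (z : C) : C :=
  derive1 (derive1 phi) z / derive1 phi z.

Definition is_log_derive (phi L : C -> C) :=
  [/\ holomorphic_on extdisk L,
      forall z, extdisk z -> cexp (L z) = derive1 phi z
    & forall e : R, 0 < e -> exists r : R,
        forall z : C, r < cmod z -> cmod (L z) < e].

(* The choice is unique on [extdisk]; values elsewhere are never used.  *)
Definition log_derive (phi : C -> C) : C -> C := get (is_log_derive phi).

Definition derive_pow (phi : C -> C) (p z : C) : C :=
  cexp (p * log_derive phi z).

Definition circle_mean (phi : C -> C) (p : C) (r : R) : R :=
  \int[@lebesgue_measure R]_(t in `[0, 2 * pi])
    cmod (derive_pow phi p (polar r t)).

Definition beta (phi : C -> C) (p : C) : \bar R :=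
  limf_esup (fun r : R => (ln (circle_mean phi p r) / ln ((r - 1)^-1))%:E) 1^'+.

(* Regions are sets of pairs of reals, to be measured by the product Lebesgue
   measure; the argument may be any determination lying in [`]t1, t2[].  *)
Definition box (r1 r2 t1 t2 : R) : set (R * R) :=
  [set w | exists r t, [/\ r1 < r < r2, t1 < t < t2 & of_pair w = polar r t]].

Definition haverage (B : set (R * R)) (g : C -> R) : R :=
  (\int[area]_(w in B) (g (of_pair w) * hdensity (of_pair w))) /
  (\int[area]_(w in B) hdensity (of_pair w)).

Definition large_boxes (P : set (R * R) -> Prop) :=
  exists n0 r0 : R, [/\ 1 < n0, 1 < r0 & forall r1 r2 t1 t2 : R,
    1 < r1 < r2 -> 0 < t2 - t1 <= 2 * pi ->
    r2 <= r0 -> n0 <= (r2 - 1) / (r1 - 1) -> r2 - 1 <= t2 - t1 ->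
    P (box r1 r2 t1 t2)].

End ComplexPlane.

(* Main.v *)
Require Import Defs.
From mathcomp Require Import all_boot all_order all_algebra.
From mathcomp Require Import all_classical all_reals all_analysis.
From mathcomp Require Import measurable_realfun ring lra.
Import Order.TTheory GRing.Theory Num.Theory.
Import numFieldNormedType.Exports.
Set Implicit Arguments.
Unset Strict Implicit.
Unset Printing Implicit Defensive.
Local Open Scope ring_scope.
Local Open Scope complex_scope.
Local Open Scope classical_set_scope.

(** Fix [p] and write [L] for the logarithm of [phi'], [n = L'] for the
    non-linearity, [N z = z * n z], [u = Re (p * L)] and
    [I r] for the integral of [exp u] over the circle of radius [r], which is
    the integral mean in the definition of [beta].

    Differentiating twice in [r], and using that the integral of an angular
    derivative over a circle vanishes, one finds Hardy's identity
    [(r I')' = (1 / r) * \int exp u * |p N|^2].  With [sg r = (r^2 - 1) / 2],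
    the inverse of the hyperbolic density, the quantity
    [flux r = r^2 I - sg * (r I')] satisfies
    [flux' = 2 r I - (sg / r) \int exp u |p N|^2] ([derive_flux]).  Hence, up to
    a small drift, [flux r1 - flux r2] is [|p|^2 / 4] times the integral over
    the annulus [r1 < |z| < r2] of [exp u] against the energy density
    [|2 n / rho|^2 rho |dz|^2], the one averaged in the hypothesis ([flux_diff]).

    That hypothesis also makes [L] a Bloch function, [|n z| (|z| - 1) <= c]
    ([bloch_bound]): by the mean value property [|n z|^2] is at most a multiple
    of the mean of [|n|^2] over a small annulus about [z], and this annulus lies
    in a box whose energy is bounded by [M].  Consequently [u] oscillates by at
    most [O(|p|)] on a box with radii [1 + s], [1 + n0 s] and angular width
    comparable to [n0 s].  Cutting the annulus into such boxes, [exp u] can be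
    taken out of each box integral at the cost of a factor [exp (O(|p|))], and
    what is left is between [m] and [M] times the hyperbolic measure of the box
    ([energy_bounds]).

    Since [flux] is [(1 + O(|p|)) * I] near the circle, one generation of boxes
    multiplies [flux] by a factor between [exp ((m - e) |p|^2 / 4 * ln n0)] and
    [exp ((M + e) |p|^2 / 4 * ln n0)] once [|p|] is small ([flux_step],
    [rate_lower], [rate_upper]).  Iterating, [I] grows like a power of
    [1 / (r - 1)] with exponent between [(m - e) |p|^2 / 4] and
    [(M + e) |p|^2 / 4] ([spectrum_bounds]), which is the theorem.

    Three preliminaries are developed on the way.  The elementary theory of
    holomorphic functions on a disc is derived from Goursat's theorem on
    rectangles.  The logarithm of [phi'] exists because an injective holomorphic
    function has a derivative without zeros ([inj_deriv_neq0]); near infinity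
    one works with [w |-> phi' (1 / w)] on the unit disc.  Area integrals over
    boxes are computed in polar coordinates ([aint_sector]). *)

(** * The modulus, complex derivatives and the exponential *)

Arguments cmod {R} z : simpl never.

Section ComplexBasics.
Context {R : realType}.
Local Notation C := (Cplx R).
Implicit Types (z w h l : C) (f g : C -> C).

Lemma cmodE z : cmod z = Num.sqrt (complex.Re z ^+ 2 + complex.Im z ^+ 2).
Proof. by case: z => a b; rewrite /cmod. Qed.

Lemma sqr_cmod z : cmod z ^+ 2 = complex.Re z ^+ 2 + complex.Im z ^+ 2.
Proof. by rewrite cmodE sqr_sqrtr // addr_ge0 ?sqr_ge0. Qed.

Lemma normCE z : `|z| = (cmod z)%:C :> C.
Proof. by case: z. Qed.

Lemma cmod_ge0 z : 0 <= cmod z.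
Proof. by rewrite cmodE sqrtr_ge0. Qed.

Lemma cmod0 : cmod (0 : C) = 0.
Proof. exact: Normc.normc0. Qed.

Lemma cmod_eq0 z : (cmod z == 0) = (z == 0).
Proof.
apply/eqP/eqP => [|->]; last exact: cmod0.
exact: (@Normc.eq0_normc R).
Qed.

Lemma cmod_gt0 z : (0 < cmod z) = (z != 0).
Proof. by rewrite lt_def cmod_eq0 cmod_ge0 andbT. Qed.

Lemma cmodM z w : cmod (z * w) = cmod z * cmod w.
Proof. exact: (@Normc.normcM R z w). Qed.

Lemma cmodN z : cmod (- z) = cmod z.
Proof. exact: (@normcN R z). Qed.

Lemma cmodD z w : cmod (z + w) <= cmod z + cmod w.
Proof. exact: (@le_normcD R z w). Qed.

Lemma cmodB z w : cmod (z - w) <= cmod z + cmod w.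
Proof. by rewrite (le_trans (cmodD _ _)) // cmodN. Qed.

Lemma cmodBC z w : cmod (z - w) = cmod (w - z).
Proof. by rewrite -cmodN opprB. Qed.

Lemma cmodV z : cmod z^-1 = (cmod z)^-1.
Proof. exact: (@Normc.normcV R z). Qed.

Lemma cmod_real (x : R) : cmod x%:C = `|x|.
Proof. by rewrite cmodE /= expr0n addr0 sqrtr_sqr. Qed.

Lemma cmod_Re z : `|complex.Re z| <= cmod z.
Proof.
rewrite -ler_sqr ?nnegrE ?cmod_ge0 // sqr_cmod real_normK ?num_real //.
by rewrite lerDl sqr_ge0.
Qed.

Lemma cmod_Im z : `|complex.Im z| <= cmod z.
Proof.
rewrite -ler_sqr ?nnegrE ?cmod_ge0 // sqr_cmod real_normK ?num_real //.
by rewrite lerDr sqr_ge0.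
Qed.

Lemma cmod_ReIm z : cmod z <= `|complex.Re z| + `|complex.Im z|.
Proof.
rewrite -ler_sqr ?nnegrE ?addr_ge0 ?cmod_ge0 // sqr_cmod.
rewrite sqrrD !real_normK ?num_real // -addrA lerD2l lerDr.
by rewrite mulrn_wge0 // mulr_ge0.
Qed.

Lemma cmod_dist z w : `|cmod z - cmod w| <= cmod (z - w).
Proof.
rewrite ler_norml; apply/andP; split.
  have := cmodD z (w - z); rewrite addrCA subrr addr0 -(cmodBC z); lra.
by have := cmodD w (z - w); rewrite addrCA subrr addr0; lra.
Qed.

Lemma cReD z w : complex.Re (z + w) = complex.Re z + complex.Re w.
Proof. by case: z w => ? ? [? ?]. Qed.
Lemma cImD z w : complex.Im (z + w) = complex.Im z + complex.Im w.
Proof. by case: z w => ? ? [? ?]. Qed.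
Lemma cReN z : complex.Re (- z) = - complex.Re z. Proof. by case: z. Qed.
Lemma cImN z : complex.Im (- z) = - complex.Im z. Proof. by case: z. Qed.
Lemma cReM z w : complex.Re (z * w) =
  complex.Re z * complex.Re w - complex.Im z * complex.Im w.
Proof. by case: z w => ? ? [? ?]. Qed.
Lemma cImM z w : complex.Im (z * w) =
  complex.Re z * complex.Im w + complex.Im z * complex.Re w.
Proof. by case: z w => ? ? [? ?]. Qed.
Lemma complexE z : z = complex.Re z +i* complex.Im z :> C.
Proof. by case: z. Qed.
Lemma complexP z w : complex.Re z = complex.Re w ->
  complex.Im z = complex.Im w -> z = w.
Proof. by case: z w => ? ? [? ?] /= -> ->. Qed.

Lemma Re_real (x : R) : complex.Re (x%:C : C) = x. Proof. by []. Qed.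
Lemma Im_real (x : R) : complex.Im (x%:C : C) = 0. Proof. by []. Qed.
Lemma Re1 : complex.Re (1 : C) = 1. Proof. by []. Qed.
Lemma Im1 : complex.Im (1 : C) = 0. Proof. by []. Qed.
Lemma Re0 : complex.Re (0 : C) = 0. Proof. by []. Qed.
Lemma Im0 : complex.Im (0 : C) = 0. Proof. by []. Qed.
Lemma Re_mk (x y : R) : complex.Re (x +i* y : C) = x. Proof. by []. Qed.
Lemma Im_mk (x y : R) : complex.Im (x +i* y : C) = y. Proof. by []. Qed.
(** Computes real and imaginary parts of ring expressions. *)
Definition ReImE := (Re_mk, Im_mk, cReD, cImD, cReN, cImN, cReM, cImM, Re_real, Im_real, Re1, Im1, Re0, Im0).

(** [l] is the complex derivative of [f] at [z], in epsilon-delta form and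
    with real [e], [d]; by [cderP] this is [is_derive z 1 f l]. *)
Definition cder f z l := forall e : R, 0 < e -> exists2 d : R, 0 < d &
  forall h, cmod h < d -> cmod (f (z + h) - f z - l * h) <= e * cmod h.

(** Neighbourhoods in the plane in terms of the real-valued modulus. *)
Lemma nbhs_cmod z (A : set C) : nbhs z A <-> exists2 d : R, 0 < d &
  forall h, cmod h < d -> A (z + h).
Proof.
split.
  move=> /nbhs_ballP[e /= e0 eA].
  have eR : e = (complex.Re e)%:C.
    by move: e0; rewrite ltcE /= => /andP[/eqP e1 _]; case: e e1 {eA} => a b /= ->.
  exists (complex.Re e); first by move: e0; rewrite {1}eR ltcR.
  move=> h hd; apply: eA; rewrite -ball_normE /ball_ /= opprD addNKr normrN.
  by rewrite normCE eR ltcR.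
move=> [d d0 dA]; apply/nbhs_ballP; exists d%:C => /=; first by rewrite ltcR.
move=> w; rewrite -ball_normE /ball_ /= normCE ltcR => wd.
by rewrite -(subrK z w) addrC; apply: dA; rewrite -cmodN opprB.
Qed.

Lemma cderP f z l : is_derive z 1 f l <-> cder f z l.
Proof.
have key : (fun h : C => h^-1 *: ((f \o shift z) (h *: 1) - f z)) @ 0^' --> l <->
    cder f z l.
  split.
    move=> /cvgrPdist_le fl e e0.
    have /fl : (0 : C) < e%:C by rewrite ltcR.
    rewrite /dnbhs /within /= => /nbhs_cmod[d d0 dP]; exists d => // h hd.
    have [->|h0] := eqVneq h 0; first by rewrite addr0 mulr0 subrr subr0 cmod0 mulr0.
    have := dP h hd; rewrite add0r => /(_ h0).
    rewrite normCE lecR /shift /= [h *: _]mulr1 => H.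
    have -> : f (z + h) - f z - l * h = h * - (l - h^-1 *: (f (h + z) - f z)).
      rewrite opprB mulrBr [_ *: _]/(_ * _) mulrA divff // mul1r (addrC h z).
      by rewrite (mulrC h l).
    by rewrite cmodM cmodN mulrC ler_wpM2r // cmod_ge0.
  move=> fl; apply/cvgrPdist_le => e e0.
  have eR : e = (complex.Re e)%:C.
    by move: e0; rewrite ltcE /= => /andP[/eqP e1 _]; case: e e1 => a b /= ->.
  have /fl[d d0 dP] : 0 < complex.Re e by move: e0; rewrite {1}eR ltcR.
  apply/nbhs_cmod; exists d => // h hd; rewrite add0r => h0.
  rewrite normCE eR lecR /shift /= [h *: _]mulr1.
  have -> : l - h^-1 *: (f (h + z) - f z) = - (h^-1 * (f (z + h) - f z - l * h)).
    rewrite [_ *: _]/(_ * _) mulrBr mulrCA mulVf // mulr1 opprB (addrC h z).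
    by [].
  rewrite cmodN cmodM cmodV mulrC ler_pdivrMr ?cmod_gt0 //.
  exact: dP.
split=> [[df dfE]|fl].
  by apply: key.1; rewrite -dfE; exact: df.
have c := (key.2 fl); split; last exact: (cvg_lim _ c).
by apply/cvg_ex; exists l.
Qed.

Lemma is_deriveP (f : R -> R) (t l : R) : is_derive t 1 f l <->
  forall e : R, 0 < e -> exists2 d : R, 0 < d &
  forall h : R, `|h| < d -> `|f (t + h) - f t - l * h| <= e * `|h|.
Proof.
have key : (fun h : R => h^-1 *: ((f \o shift t) (h *: 1) - f t)) @ 0^' --> l <->
  forall e : R, 0 < e -> exists2 d : R, 0 < d &
  forall h : R, `|h| < d -> `|f (t + h) - f t - l * h| <= e * `|h|.
  split.
    move=> /cvgrPdist_le fl e e0.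
    have /= := fl _ e0.
    rewrite /dnbhs /within /= => /nbhs_ballP[d /= d0 dP]; exists d => // h hd.
    have [->|h0] := eqVneq h 0; first by rewrite addr0 mulr0 subrr subr0 normr0 mulr0.
    have := dP h; rewrite -ball_normE /ball_ /= sub0r normrN => /(_ hd h0).
    rewrite [h *: _]mulr1 => H.
    have -> : f (t + h) - f t - l * h = h * - (l - h^-1 *: (f (h + t) - f t)).
      rewrite opprB mulrBr [_ *: _]/(_ * _) mulrA divff // mul1r (addrC h t).
      by rewrite (mulrC h l).
    by rewrite normrM normrN mulrC ler_wpM2r.
  move=> fl; apply/cvgrPdist_le => e e0.
  have [d d0 dP] := fl _ e0.
  apply/nbhs_ballP; exists d => // h; rewrite -ball_normE /ball_ /= sub0r normrN => hd h0.
  rewrite [h *: _]mulr1.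
  have -> : l - h^-1 *: (f (h + t) - f t) = - (h^-1 * (f (t + h) - f t - l * h)).
    by rewrite [_ *: _]/(_ * _) mulrBr mulrCA mulVf // mulr1 opprB (addrC h t).
  rewrite normrN normrM normfV mulrC ler_pdivrMr ?normr_gt0 //.
  exact: dP.
split=> [[df dfE]|fl].
  by apply: key.1; rewrite -dfE; exact: df.
have c := (key.2 fl); split; last exact: (cvg_lim _ c).
by apply/cvg_ex; exists l.
Qed.

(** Continuity in terms of the real-valued modulus. *)
Lemma contCP f z : {for z, continuous f} <-> forall e : R, 0 < e ->
  exists2 d : R, 0 < d & forall h, cmod h < d -> cmod (f (z + h) - f z) <= e.
Proof.
split=> [fc e e0|fc].
  have fc' : f @ z --> f z by exact: fc.
  have /cvgrPdist_le/(_ e%:C) := fc'; rewrite ltcR => /(_ e0) /nbhs_cmod[d d0 dP].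
  by exists d => // h /dP; rewrite normCE lecR cmodBC.
suff fc' : f @ z --> f z by exact: fc'.
apply/(@cvgrPdist_le _ _ _ (nbhs z) (@nbhs_filter C z)) => e e0.
have eR : e = (complex.Re e)%:C.
  by move: e0; rewrite ltcE /= => /andP[/eqP e1 _]; case: e e1 => a b /= ->.
have /fc[d d0 dP] : 0 < complex.Re e by move: e0; rewrite {1}eR ltcR.
apply/nbhs_cmod; exists d => // h /dP.
by rewrite normCE eR lecR cmodBC.
Qed.

Lemma cder_cont f z l : cder f z l -> {for z, continuous f}.
Proof. by move/cderP => [/derivable1_diffP /differentiable_continuous]. Qed.

Lemma continuous_Re : continuous (@complex.Re R : C -> R).
Proof.
move=> z; apply/(@cvgrPdist_le _ _ _ (nbhs z) (@nbhs_filter C z)) => e e0; apply/nbhs_cmod; exists e => // h he.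
by rewrite cReD opprD addNKr normrN (le_trans (cmod_Re _)) // ltW.
Qed.

Lemma continuous_Im : continuous (@complex.Im R : C -> R).
Proof.
move=> z; apply/(@cvgrPdist_le _ _ _ (nbhs z) (@nbhs_filter C z)) => e e0; apply/nbhs_cmod; exists e => // h he.
by rewrite cImD opprD addNKr normrN (le_trans (cmod_Im _)) // ltW.
Qed.

Lemma continuous_cmod : continuous (cmod : C -> R).
Proof.
move=> z; apply/(@cvgrPdist_le _ _ _ (nbhs z) (@nbhs_filter C z)) => e e0; apply/nbhs_cmod; exists e => // h he.
by rewrite (le_trans (cmod_dist _ _)) // opprD addNKr cmodN ltW.
Qed.

Lemma cvg_complex (T : Type) (F : set_system T) (FF : Filter F) (a b : T -> R)
    (x y : R) :
  a @ F --> x -> b @ F --> y -> (fun t => a t +i* b t : C) @ F --> (x +i* y : C).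
Proof.
move=> /cvgrPdist_le ax /cvgrPdist_le bY; apply/cvgrPdist_le => e e0.
have eR : e = (complex.Re e)%:C.
  by move: e0; rewrite ltcE /= => /andP[/eqP e1 _]; case: e e1 => u v /= ->.
have e2 : 0 < complex.Re e / 2 by rewrite divr_gt0 //; move: e0; rewrite {1}eR ltcR.
near=> t.
rewrite normCE eR lecR (le_trans (cmod_ReIm _)) //= (splitr (complex.Re e)).
by rewrite lerD //; near: t; [exact: ax|exact: bY].
Unshelve. all: by end_near. Qed.

Lemma cder_ext f g z l (d : R) : 0 < d ->
  (forall h, cmod h < d -> f (z + h) = g (z + h)) -> cder f z l -> cder g z l.
Proof.
move=> d0 fg fl e /fl[d1 d10 H]; exists (Num.min d d1); first by rewrite lt_min d0.
move=> h; rewrite lt_min => /andP[hd hd1].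
have <- : f z = g z by rewrite -(addr0 z) fg ?cmod0.
by rewrite -fg //; exact: H.
Qed.

Lemma cder_uniq f z l m : cder f z l -> cder f z m -> l = m.
Proof. by move=> /cderP[_ <-] /cderP[_ <-]. Qed.

Lemma cder_cst (c z : C) : cder (fun=> c) z 0.
Proof. by apply/cderP; exact: is_derive_cst. Qed.

Lemma cder_id z : cder id z 1.
Proof. by apply/cderP; exact: is_derive_id. Qed.

Lemma cderD f g z l m : cder f z l -> cder g z m ->
  cder (fun w => f w + g w) z (l + m).
Proof. by move=> /cderP fl /cderP gm; apply/cderP; exact: is_deriveD. Qed.

Lemma cderN f z l : cder f z l -> cder (fun w => - f w) z (- l).
Proof. by move=> /cderP fl; apply/cderP; exact: is_deriveN. Qed.

Lemma cderB f g z l m : cder f z l -> cder g z m ->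
  cder (fun w => f w - g w) z (l - m).
Proof. by move=> /cderP fl /cderP gm; apply/cderP; exact: is_deriveB. Qed.

Lemma cderM f g z l m : cder f z l -> cder g z m ->
  cder (fun w => f w * g w) z (l * g z + f z * m).
Proof.
move=> /cderP fl /cderP gm; apply/cderP; apply: is_derive_eq.
by rewrite addrC mulrC; congr (_ + _); rewrite /GRing.scale /= mulrC.
Qed.

Lemma cderV f z l : f z != 0 -> cder f z l ->
  cder (fun w => (f w)^-1) z (- l / f z ^+ 2).
Proof.
move=> f0 /cderP[df fl]; apply/cderP; split; first exact: derivableV.
rewrite deriveV // fl [_ *: _]/(_ * _).
by rewrite -[LHS]/(- f z ^- 2 * l) !mulNr mulrC.
Qed.

Lemma cder_comp f g z l m : cder g z m -> cder f (g z) l ->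
  cder (fun w => f (g w)) z (l * m).
Proof.
move=> gm fl e e0.
pose e1 := e / (2 * (cmod m + 1)).
pose e2 := Num.min 1 (e / (2 * (cmod l + 1))).
have l0 := cmod_ge0 l; have m0 := cmod_ge0 m.
have e10 : 0 < e1 by rewrite divr_gt0 // mulr_gt0 // ltr_wpDl.
have e20 : 0 < e2 by rewrite lt_min ltr01 divr_gt0 // mulr_gt0 // ltr_wpDl.
have [d1 d10 H1] := fl e1 e10; have [d2 d20 H2] := gm e2 e20.
exists (Num.min d2 (d1 / (cmod m + 1))).
  by rewrite lt_min d20 divr_gt0 // ltr_wpDl.
move=> h; rewrite lt_min ltr_pdivlMr ?ltr_wpDl // => /andP[hd2 hd1].
have h0 := cmod_ge0 h.
pose k := g (z + h) - g z.
have Hk : cmod (k - m * h) <= e2 * cmod h by exact: H2.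
have kle : cmod k <= (cmod m + 1) * cmod h.
  rewrite -(subrK (m * h) k) (le_trans (cmodD _ _)) // cmodM mulrDl mul1r addrC.
  by rewrite lerD2l (le_trans Hk) // ler_piMl // ge_min lexx.
have gE : g (z + h) = g z + k by rewrite /k [RHS]addrC subrK.
rewrite gE -mulrA.
have -> : f (g z + k) - f (g z) - l * (m * h) =
   (f (g z + k) - f (g z) - l * k) + l * (k - m * h) by ring.
rewrite (le_trans (cmodD _ _)) // cmodM.
have A1 : cmod (f (g z + k) - f (g z) - l * k) <= e / 2 * cmod h.
  apply: le_trans (H1 _ _) _; first by rewrite (le_lt_trans kle) // mulrC.
  apply: le_trans (ler_wpM2l (ltW e10) kle) _.
  have -> : e1 * ((cmod m + 1) * cmod h) = e / 2 * cmod h; last by [].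
  by rewrite /e1; field; rewrite gt_eqF // ltr_wpDl.
have A2 : cmod l * cmod (k - m * h) <= e / 2 * cmod h.
  apply: le_trans (ler_wpM2l l0 Hk) _.
  rewrite mulrA ler_wpM2r //.
  have e2le : e2 <= e / (2 * (cmod l + 1)) by rewrite ge_min lexx orbT.
  apply: le_trans (ler_wpM2l l0 e2le) _.
  rewrite mulrA ler_pdivrMr ?mulr_gt0 ?ltr_wpDl //.
  have := mulr_ge0 (ltW e0) l0; nra.
by apply: le_trans (lerD A1 A2) _; rewrite -mulrDl -splitr.
Qed.

Lemma cexpD z w : cexp (z + w) = cexp z * cexp w.
Proof.
case: z w => a b [c d]; apply: complexP => /=; rewrite expRD ?cosD ?sinD; ring.
Qed.

Lemma cexp0 : cexp (0 : C) = 1.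
Proof. by apply: complexP; rewrite /= expR0 ?cos0 ?sin0 ?mulr0 ?mulr1. Qed.

Lemma cmod_cexp z : cmod (cexp z) = expR (complex.Re z).
Proof.
rewrite cmodE /= !exprMn -mulrDr cos2Dsin2 mulr1 sqrtr_sqr ger0_norm // expR_ge0.
Qed.

Lemma cexp_neq0 z : cexp z != 0.
Proof. by rewrite -cmod_gt0 cmod_cexp expR_gt0. Qed.

Lemma cexpN z : cexp (- z) = (cexp z)^-1.
Proof.
apply: (mulfI (cexp_neq0 z)).
by rewrite -cexpD subrr cexp0 divff // cexp_neq0.
Qed.

Lemma cder_cexp z : cder cexp z (cexp z).
Proof.
have k0 : cder cexp 0 1.
  move=> e e0; pose e1 := Num.min 1 (e / 12).
  have e10 : 0 < e1 by rewrite lt_min ltr01 divr_gt0.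
  have e1_1 : e1 <= 1 by rewrite ge_min lexx.
  have e1_e : e1 <= e / 12 by rewrite ge_min lexx orbT.
  clearbody e1.
  have [d1 d10 H1] := (is_deriveP expR 0 (expR 0)).1 (is_derive_expR _) e1 e10.
  have [d2 d20 H2] := (is_deriveP sin 0 (cos 0)).1 (is_derive_sin _) e1 e10.
  have [d3 d30 H3] := (is_deriveP cos 0 (- sin 0)).1 (is_derive_cos _) e1 e10.
  exists (Num.min e1 (Num.min d1 (Num.min d2 d3))).
    by rewrite !lt_min e10 d10 d20 d30.
  move=> h; rewrite !lt_min => /and4P[he hd1 hd2 hd3].
  have h0 := cmod_ge0 h.
  have hR := cmod_Re h; have hI := cmod_Im h.
  set x := complex.Re h in hR *; set y := complex.Im h in hI *.
  have := H1 x (le_lt_trans hR hd1).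
  have := H2 y (le_lt_trans hI hd2).
  have := H3 y (le_lt_trans hI hd3).
  rewrite !add0r expR0 sin0 cos0 oppr0 mul0r !subr0 addr0 !mul1r => B3 B2 B1.
  have Ex : expR x <= 3.
    have := le_trans (ler_norm _) B1.
    have : e1 * `|x| <= 1 by rewrite mulr_ile1 // ?(ltW e10) // (le_trans hR) // ltW // (lt_le_trans he).
    have := ler_norm x; have : cmod h <= 1 by rewrite ltW // (lt_le_trans he).
    by lra.
  have Ex0 := expR_ge0 x.
  have x0 := normr_ge0 x; have y0 := normr_ge0 y.
  have e1h : forall u : R, `|u| <= cmod h -> e1 * `|u| <= e / 12 * cmod h.
    by move=> u uh; apply: ler_pM => //; exact: ltW.
  have -> : cexp h - cexp 0 - h =
    (expR x * cos y - 1 - x) +i* (expR x * sin y - y).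
    rewrite cexp0; apply: complexP.
      by rewrite !(cReD, cReN).
    by rewrite !(cImD, cImN) /= subr0.
  rewrite (le_trans (cmod_ReIm _)) //=.
  have R1 : `|expR x * cos y - 1 - x| <= e / 12 * cmod h + 3 * (e / 12 * cmod h).
    have -> : expR x * cos y - 1 - x = (expR x - 1 - x) + expR x * (cos y - 1) by ring.
    apply: le_trans (ler_normD _ _) _; apply: lerD; first by rewrite (le_trans B1) // e1h.
    by rewrite normrM (ger0_norm Ex0); apply: ler_pM => //; rewrite (le_trans B3) // e1h.
  have R2 : `|expR x * sin y - y| <= 3 * (e / 12 * cmod h) + 2 * (e / 12 * cmod h).
    have -> : expR x * sin y - y = expR x * (sin y - y) + (expR x - 1) * y by ring.
    apply: le_trans (ler_normD _ _) _; apply: lerD.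
      by rewrite normrM (ger0_norm Ex0); apply: ler_pM => //; rewrite (le_trans B2) // e1h.
    rewrite normrM.
    have E1 : `|expR x - 1| <= 2 * `|x|.
      rewrite -(subrK x (expR x - 1)) (le_trans (ler_normD _ _)) //.
      have : e1 * `|x| <= `|x| by rewrite ler_piMl.
      by lra.
    apply: le_trans (ler_wpM2r y0 E1) _.
    have : `|x| * `|y| <= e1 * `|y|.
      by rewrite ler_wpM2r // (le_trans hR) // ltW.
    have := e1h y hI; lra.
  have eh : 0 <= e * cmod h by rewrite mulr_ge0 // ltW.
  by have := lerD R1 R2; lra.
have : cder (fun w => cexp z * cexp (w - z)) z (0 * cexp (z - z) + cexp z * (1 * (1 - 0))).
  apply: cderM; first exact: cder_cst.
  apply: cder_comp; first by apply: cderB; [exact: cder_id|exact: cder_cst].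
  by rewrite subrr.
rewrite mul0r add0r subr0 !mulr1.
apply: (@cder_ext _ _ _ _ 1) => // h _.
by rewrite -cexpD addrC subrK.
Qed.

End ComplexBasics.

(** * Integrals of continuous functions over segments *)

Section IntervalIntegral.
Context {R : realType}.
Local Notation mu := (@lebesgue_measure R).
Implicit Types (a b c x t M : R) (f g : R -> R).

(** Pointwise continuity at every point of the closed segment [[a, b]].  The
    limits are two-sided, also at the end points. *)
Definition cont_on {T : topologicalType} (a b : R) (f : R -> T) :=
  forall t, a <= t <= b -> {for t, continuous f}.

(** The integral of a real function over the segment [[a, b]]. *)
Definition rint (a b : R) (f : R -> R) : R := \int[mu]_(x in `[a, b]) f x.

Lemma cont_on_within {T : topologicalType} a b (f : R -> T) :
  cont_on a b f -> {within `[a, b], continuous f}.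
Proof.
move=> cf; apply: continuous_in_subspaceT => t.
by rewrite inE /= in_itv => /cf.
Qed.

Lemma cont_on_integrable a b f : cont_on a b f ->
  mu.-integrable `[a, b] (EFin \o f).
Proof.
move=> /cont_on_within cf; apply: continuous_compact_integrable => //.
exact: segment_compact.
Qed.

Lemma eq_rint a b f g : (forall t, a <= t <= b -> f t = g t) ->
  rint a b f = rint a b g.
Proof. by move=> fg; apply: eq_Rintegral => t; rewrite inE /= in_itv => /fg. Qed.

Lemma rintD a b f g : cont_on a b f -> cont_on a b g ->
  rint a b (fun t => f t + g t) = rint a b f + rint a b g.
Proof. by move=> *; apply: RintegralD => //; exact: cont_on_integrable. Qed.

Lemma rintB a b f g : cont_on a b f -> cont_on a b g ->
  rint a b (fun t => f t - g t) = rint a b f - rint a b g.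
Proof. by move=> *; apply: RintegralB => //; exact: cont_on_integrable. Qed.

Lemma rintZ a b c f : cont_on a b f ->
  rint a b (fun t => c * f t) = c * rint a b f.
Proof. by move=> *; apply: RintegralZl => //; exact: cont_on_integrable. Qed.

Lemma rintN a b f : cont_on a b f -> rint a b (fun t => - f t) = - rint a b f.
Proof.
move=> cf; rewrite -mulN1r -rintZ //; apply: eq_rint => t _.
by rewrite mulN1r.
Qed.

Lemma rint_cst a b c : a <= b -> rint a b (fun=> c) = c * (b - a).
Proof.
move=> ab; rewrite /rint Rintegral_cst //= lebesgue_measure_itv /= lte_fin.
by case: ltgtP ab => // -> _; rewrite subrr.
Qed.

Lemma le_rint a b f g : cont_on a b f -> cont_on a b g ->
  (forall t, a <= t <= b -> f t <= g t) -> rint a b f <= rint a b g.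
Proof.
move=> cf cg fg; apply: le_Rintegral => //; exact: cont_on_integrable.
Qed.

Lemma rint_ge0 a b f : (forall t, a <= t <= b -> 0 <= f t) -> 0 <= rint a b f.
Proof. by move=> f0; apply: Rintegral_ge0 => t /=; rewrite in_itv => /f0. Qed.

Lemma cont_on_norm a b f : cont_on a b f -> cont_on a b (fun t => `|f t|).
Proof.
move=> cf t /cf ft.
by apply: (@continuous_comp _ _ _ f (fun x : R => `|x|)) => //; exact: norm_continuous.
Qed.

Lemma ler_norm_rint a b f : cont_on a b f ->
  `|rint a b f| <= rint a b (fun t => `|f t|).
Proof. by move=> cf; apply: le_normr_Rintegral => //; exact: cont_on_integrable. Qed.

Lemma cont_on_cst {T : topologicalType} a b (c : T) : cont_on a b (fun=> c).
Proof. by move=> t _; exact: cvg_cst. Qed.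

Lemma rint_split a b c f : a <= b -> b <= c -> cont_on a c f ->
  rint a c f = rint a b f + rint b c f.
Proof.
move=> ab bc cf; have := @Rintegral_itvB _ f (BLeft a) (BRight c) b.
move=> /(_ (cont_on_integrable cf)); rewrite !bnd_simp => /(_ ab bc).
rewrite Rintegral_itv_obnd_cbnd; first by rewrite /rint => <-; rewrite addrC subrK.
apply: integrableS (cont_on_integrable cf) => // t /=.
by rewrite !in_itv /= => /andP[/ltW bt ->]; rewrite (le_trans ab bt).
Qed.

Lemma rint_point a f : rint a a f = 0.
Proof. by rewrite /rint set_itv1 Rintegral_set1. Qed.

Lemma is_derive_cont f t l : is_derive t 1 f l -> {for t, continuous f}.
Proof. by move=> [/derivable1_diffP /differentiable_continuous]. Qed.

Lemma rint_FTC a b (F f : R -> R) : a <= b ->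
  (forall t, a <= t <= b -> is_derive t 1 F (f t)) -> cont_on a b f ->
  rint a b f = F b - F a.
Proof.
rewrite le_eqVlt => /predU1P[<-|ab] dF cf; first by rewrite rint_point subrr.
rewrite /rint /Rintegral (@continuous_FTC2 _ f F) //.
- exact: cont_on_within.
- have FC : cont_on a b F by move=> t /dF /is_derive_cont.
  split.
  + move=> t; rewrite in_itv /= => /andP[at_ tb].
    by have [] := dF t; rewrite ?(ltW at_) ?(ltW tb).
  + by apply: cvg_at_right_filter; apply: FC; rewrite lexx ltW.
  + by apply: cvg_at_left_filter; apply: FC; rewrite lexx ltW.
- move=> t; rewrite in_itv /= => /andP[at_ tb].
  have tab : a <= t <= b by rewrite (ltW at_) (ltW tb).
  by have [_ <-] := dF t tab; rewrite derive1E.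
Qed.

End IntervalIntegral.

(** * Differentiation and integration of curves in the plane *)

Section Curves.
Context {R : realType}.
Local Notation C := (Cplx R).
Implicit Types (g dg : R -> C) (a b t : R) (z w : C).

(** [w] is the derivative at [t] of the curve [g] in the plane. *)
Definition rder g t w := is_derive t 1 (fun s => complex.Re (g s)) (complex.Re w) /\
  is_derive t 1 (fun s => complex.Im (g s)) (complex.Im w).

Lemma rderP g t w : rder g t w <-> forall e : R, 0 < e -> exists2 d : R, 0 < d &
  forall h : R, `|h| < d -> cmod (g (t + h) - g t - h%:C * w) <= e * `|h|.
Proof.
have E h : g (t + h) - g t - h%:C * w =
  (complex.Re (g (t + h)) - complex.Re (g t) - complex.Re w * h) +i*
  (complex.Im (g (t + h)) - complex.Im (g t) - complex.Im w * h).
  apply: complexP; rewrite !ReImE; ring.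
split=> [[/is_deriveP d1 /is_deriveP d2] e e0|H].
  have e2 : 0 < e / 2 by rewrite divr_gt0.
  have [r1 r10 H1] := d1 _ e2; have [r2 r20 H2] := d2 _ e2.
  exists (Num.min r1 r2) => [|h]; first by rewrite lt_min r10.
  rewrite lt_min E => /andP[hr1 hr2]; rewrite (le_trans (cmod_ReIm _)) //=.
  by have := lerD (H1 _ hr1) (H2 _ hr2); rewrite -mulrDl -splitr.
split; apply/is_deriveP => e e0; have [d d0 dP] := H e e0; exists d => // h /dP.
  by rewrite E; apply: le_trans; exact: (cmod_Re (_ +i* _)).
by rewrite E; apply: le_trans; exact: (cmod_Im (_ +i* _)).
Qed.

Lemma rder_comp (f : C -> C) g t w l : cder f (g t) l -> rder g t w ->
  rder (fun s => f (g s)) t (l * w).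
Proof.
move=> fl /rderP gm; apply/rderP => e e0.
pose e1 := e / (2 * (cmod w + 1)).
pose e2 := Num.min 1 (e / (2 * (cmod l + 1))).
have l0 := cmod_ge0 l; have m0 := cmod_ge0 w.
have e10 : 0 < e1 by rewrite divr_gt0 // mulr_gt0 // ltr_wpDl.
have e20 : 0 < e2 by rewrite lt_min ltr01 divr_gt0 // mulr_gt0 // ltr_wpDl.
have [d1 d10 H1] := fl e1 e10; have [d2 d20 H2] := gm e2 e20.
exists (Num.min d2 (d1 / (cmod w + 1))).
  by rewrite lt_min d20 divr_gt0 // ltr_wpDl.
move=> h; rewrite lt_min ltr_pdivlMr ?ltr_wpDl // => /andP[hd2 hd1].
have h0 := normr_ge0 h.
pose k := g (t + h) - g t.
have Hk : cmod (k - h%:C * w) <= e2 * `|h| by exact: H2.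
have kle : cmod k <= (cmod w + 1) * `|h|.
  rewrite -(subrK (h%:C * w) k) (le_trans (cmodD _ _)) // cmodM cmod_real mulrDl mul1r addrC.
  by rewrite (mulrC `|h|) lerD2l (le_trans Hk) // ler_piMl // ge_min lexx.
have gE : g (t + h) = g t + k by rewrite /k [RHS]addrC subrK.
rewrite gE.
have -> : f (g t + k) - f (g t) - h%:C * (l * w) =
   (f (g t + k) - f (g t) - l * k) + l * (k - h%:C * w) by ring.
rewrite (le_trans (cmodD _ _)) // cmodM.
have A1 : cmod (f (g t + k) - f (g t) - l * k) <= e / 2 * `|h|.
  apply: le_trans (H1 _ _) _; first by rewrite (le_lt_trans kle) // mulrC.
  apply: le_trans (ler_wpM2l (ltW e10) kle) _.
  have -> : e1 * ((cmod w + 1) * `|h|) = e / 2 * `|h|; last by [].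
  by rewrite /e1; field; rewrite gt_eqF // ltr_wpDl.
have A2 : cmod l * cmod (k - h%:C * w) <= e / 2 * `|h|.
  apply: le_trans (ler_wpM2l l0 Hk) _.
  rewrite mulrA ler_wpM2r //.
  have e2le : e2 <= e / (2 * (cmod l + 1)) by rewrite ge_min lexx orbT.
  apply: le_trans (ler_wpM2l l0 e2le) _.
  rewrite mulrA ler_pdivrMr ?mulr_gt0 ?ltr_wpDl //.
  have := mulr_ge0 (ltW e0) l0; nra.
by apply: le_trans (lerD A1 A2) _; rewrite -mulrDl -splitr.
Qed.

Lemma rder_Re g t w : rder g t w -> is_derive t 1 (fun s => complex.Re (g s)) (complex.Re w).
Proof. by case. Qed.

Lemma rder_Im g t w : rder g t w -> is_derive t 1 (fun s => complex.Im (g s)) (complex.Im w).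
Proof. by case. Qed.

Lemma rder_cst z t : rder (fun=> z) t 0.
Proof. by split; exact: is_derive_cst. Qed.

Lemma rder_real t : rder (fun s => s%:C) t 1.
Proof. by split=> /=; [exact: is_derive_id|exact: is_derive_cst]. Qed.

Lemma rderD g1 g2 t w1 w2 : rder g1 t w1 -> rder g2 t w2 ->
  rder (fun s => g1 s + g2 s) t (w1 + w2).
Proof.
move=> [a1 b1] [a2 b2]; split.
  by under eq_fun do rewrite cReD; rewrite cReD; exact: is_deriveD.
by under eq_fun do rewrite cImD; rewrite cImD; exact: is_deriveD.
Qed.

Lemma rderN g t w : rder g t w -> rder (fun s => - g s) t (- w).
Proof.
move=> [a1 b1]; split.
  by under eq_fun do rewrite cReN; rewrite cReN; exact: is_deriveN.
by under eq_fun do rewrite cImN; rewrite cImN; exact: is_deriveN.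
Qed.

Lemma rderM g1 g2 t w1 w2 : rder g1 t w1 -> rder g2 t w2 ->
  rder (fun s => g1 s * g2 s) t (w1 * g2 t + g1 t * w2).
Proof.
move=> [a1 b1] [a2 b2]; split.
  under eq_fun do rewrite cReM.
  by apply: is_derive_eq; rewrite !(cReD, cReM) /GRing.scale /=; ring.
under eq_fun do rewrite cImM.
by apply: is_derive_eq; rewrite !(cImD, cImM) /GRing.scale /=; ring.
Qed.

Lemma rder_line z w t : rder (fun s => z + s%:C * w) t w.
Proof.
have h := rderD (rder_cst z t) (rderM (rder_real t) (rder_cst w t)).
by rewrite mul1r mulr0 addr0 add0r in h.
Qed.

Lemma rder_cont g t w : rder g t w -> {for t, continuous g}.
Proof.
move=> [/is_derive_cont c1 /is_derive_cont c2].
have : (fun s => complex.Re (g s) +i* complex.Im (g s) : C) @ t -->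
   (complex.Re (g t) +i* complex.Im (g t) : C) by exact: cvg_complex.
rewrite /continuous_at; under eq_fun do rewrite -complexE.
by rewrite -complexE.
Qed.

(** The factor 2 comes from treating real and imaginary parts separately. *)
Lemma rder_mvt g dg a b M : a <= b ->
  (forall t, a <= t <= b -> rder g t (dg t)) ->
  (forall t, a <= t <= b -> cmod (dg t) <= M) ->
  cmod (g b - g a) <= 2 * M * (b - a).
Proof.
move=> ab gd dM.
have ba : 0 <= b - a by rewrite subr_ge0.
rewrite (le_trans (cmod_ReIm _)) // !(cReD, cReN, cImD, cImN).
have half (f df : R -> R) : (forall t, a <= t <= b -> is_derive t 1 f (df t)) ->
    (forall t, a <= t <= b -> `|df t| <= M) -> `|f b - f a| <= M * (b - a).
  move=> fd dfM.
  have [||c cab ->] := @MVT_segment _ f df _ _ ab.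
  - by move=> x; rewrite in_itv /= => /andP[ax xb]; apply: fd; rewrite !ltW.
  - by apply: cont_on_within => t /fd /is_derive_cont.
  have {}cab : a <= c <= b by move: cab; rewrite in_itv.
  by rewrite normrM (ger0_norm ba) ler_wpM2r // dfM.
rewrite -mulrA mulrDl mul1r lerD //.
  apply: (half (fun t => complex.Re (g t)) (fun t => complex.Re (dg t))) => t tab.
    by have [] := gd t tab.
  by rewrite (le_trans (cmod_Re _)) ?dM.
apply: (half (fun t => complex.Im (g t)) (fun t => complex.Im (dg t))) => t tab.
  by have [] := gd t tab.
by rewrite (le_trans (cmod_Im _)) ?dM.
Qed.

(** The integral of a complex-valued function over a real segment, by real
    and imaginary parts. *)
Definition cint a b g : C := rint a b (fun t => complex.Re (g t)) +i*
  rint a b (fun t => complex.Im (g t)).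

Arguments cint : simpl never.

Lemma cont_onRe a b g : cont_on a b g -> cont_on a b (fun t => complex.Re (g t)).
Proof.
move=> cg t /cg gt; apply: (@continuous_comp _ _ _ g (@complex.Re R)) => //.
exact: continuous_Re.
Qed.

Lemma cont_onIm a b g : cont_on a b g -> cont_on a b (fun t => complex.Im (g t)).
Proof.
move=> cg t /cg gt; apply: (@continuous_comp _ _ _ g (@complex.Im R)) => //.
exact: continuous_Im.
Qed.

Lemma cont_on_cmod a b g : cont_on a b g -> cont_on a b (fun t => cmod (g t)).
Proof.
move=> cg t /cg gt; apply: (@continuous_comp _ _ _ g (@cmod R)) => //.
exact: continuous_cmod.
Qed.

Lemma eq_cint a b g1 g2 : (forall t, a <= t <= b -> g1 t = g2 t) ->
  cint a b g1 = cint a b g2.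
Proof. by move=> E; congr (_ +i* _); apply: eq_rint => t /E ->. Qed.

Lemma cintD a b g1 g2 : cont_on a b g1 -> cont_on a b g2 ->
  cint a b (fun t => g1 t + g2 t) = cint a b g1 + cint a b g2.
Proof.
move=> c1 c2; apply: complexP.
  rewrite cReD /= -rintD; try exact: cont_onRe.
  by apply: eq_rint => t _; rewrite cReD.
rewrite cImD /= -rintD; try exact: cont_onIm.
by apply: eq_rint => t _; rewrite cImD.
Qed.

Lemma cintZ a b z g : cont_on a b g ->
  cint a b (fun t => z * g t) = z * cint a b g.
Proof.
move=> cg; have cR := cont_onRe cg; have cI := cont_onIm cg.
have cZ (f : R -> R) (c : R) : cont_on a b f -> cont_on a b (fun t => c * f t).
  by move=> cf t /cf ft; apply: cvgM => //; exact: cvg_cst.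
apply: complexP.
  rewrite cReM /= -!rintZ // -rintB; try exact: cZ.
  by apply: eq_rint => t _; rewrite cReM.
rewrite cImM /= -!rintZ // -rintD; try exact: cZ.
by apply: eq_rint => t _; rewrite cImM.
Qed.

Lemma cintB a b g1 g2 : cont_on a b g1 -> cont_on a b g2 ->
  cint a b (fun t => g1 t - g2 t) = cint a b g1 - cint a b g2.
Proof.
move=> c1 c2; apply: complexP.
  rewrite cReD cReN /= -rintB; try exact: cont_onRe.
  by apply: eq_rint => t _; rewrite cReD cReN.
rewrite cImD cImN /= -rintB; try exact: cont_onIm.
by apply: eq_rint => t _; rewrite cImD cImN.
Qed.

Lemma cint_cst a b z : a <= b -> cint a b (fun=> z) = (b - a)%:C * z.
Proof.
move=> ab; rewrite /cint !rint_cst //.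
by apply: complexP; rewrite !ReImE; ring.
Qed.

(** The factor 2 comes from treating real and imaginary parts separately. *)
Lemma cmod_cint_int a b g : cont_on a b g ->
  cmod (cint a b g) <= 2 * rint a b (fun t => cmod (g t)).
Proof.
move=> cg; rewrite (le_trans (cmod_ReIm _)) //= mulrDl mul1r lerD //.
  rewrite (le_trans (ler_norm_rint (cont_onRe cg))) // le_rint //.
  - exact/cont_on_norm/cont_onRe.
  - exact: cont_on_cmod.
  - by move=> t _; exact: cmod_Re.
rewrite (le_trans (ler_norm_rint (cont_onIm cg))) // le_rint //.
- exact/cont_on_norm/cont_onIm.
- exact: cont_on_cmod.
- by move=> t _; exact: cmod_Im.
Qed.

Lemma cmod_cint a b g M : a <= b -> cont_on a b g ->
  (forall t, a <= t <= b -> cmod (g t) <= M) -> cmod (cint a b g) <= 2 * M * (b - a).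
Proof.
move=> ab cg gM; rewrite (le_trans (cmod_cint_int cg)) // -mulrA ler_wpM2l //.
rewrite -(rint_cst M ab) le_rint //; first exact: cont_on_cmod.
exact: cont_on_cst.
Qed.

Lemma cint_split a b c g : a <= b -> b <= c -> cont_on a c g ->
  cint a c g = cint a b g + cint b c g.
Proof.
move=> ab bc cg; apply: complexP.
  by rewrite cReD /=; apply: rint_split => //; exact: cont_onRe.
by rewrite cImD /=; apply: rint_split => //; exact: cont_onIm.
Qed.

Lemma cint_FTC a b g dg : a <= b ->
  (forall t, a <= t <= b -> rder g t (dg t)) -> cont_on a b dg ->
  cint a b dg = g b - g a.
Proof.
move=> ab gd cd; apply: complexP.
  rewrite cReD cReN /=; apply: (rint_FTC (F := fun t => complex.Re (g t))) => //; last exact: cont_onRe.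
  by move=> t /gd[].
rewrite cImD cImN /=; apply: (rint_FTC (F := fun t => complex.Im (g t))) => //; last exact: cont_onIm.
by move=> t /gd[].
Qed.

End Curves.

Arguments cint {R} a b g : simpl never.
Arguments rint {R} a b f : simpl never.

(** * Bisection of rectangles *)

Section Bisection.
Context {R : realType}.
Implicit Types (I J : R * R) (x y : R).

(** The interval [J] is the left or the right half of [I]. *)
Definition half I J := J = (I.1, (I.1 + I.2) / 2) \/ J = ((I.1 + I.2) / 2, I.2).

Lemma half_sub (u v : R) I J : half I J -> u <= I.1 -> I.1 <= I.2 -> I.2 <= v ->
  [/\ u <= J.1, J.1 <= J.2 & J.2 <= v].
Proof. by case: I => ? ? [->|->] /= ? ? ?; split; lra. Qed.

Lemma nested_halves (I : nat -> R * R) : (I 0%N).1 <= (I 0%N).2 ->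
  (forall n, half (I n) (I n.+1)) ->
  (forall n, (I 0%N).1 <= (I n).1 /\ (I n).1 <= (I n).2 /\ (I n).2 <= (I 0%N).2 /\
     (I n).2 - (I n).1 = ((I 0%N).2 - (I 0%N).1) / 2 ^+ n) /\
  exists x, forall n, (I n).1 <= x <= (I n).2.
Proof.
move=> I0 hI.
have le_ n : (I n).1 <= (I n).2.
  by elim: n => // n IH; have [->|->] /= := hI n; lra.
have up n : (I n).1 <= (I n.+1).1 by have := le_ n; have [->|->] /= := hI n; lra.
have dn n : (I n.+1).2 <= (I n).2 by have := le_ n; have [->|->] /= := hI n; lra.
have upm n k : (I n).1 <= (I (n + k)%N).1.
  by elim: k => [|k IH]; rewrite ?addn0 // addnS (le_trans IH).
have dnm n k : (I (n + k)%N).2 <= (I n).2.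
  by elim: k => [|k IH]; rewrite ?addn0 // addnS (le_trans _ IH).
split.
  move=> n; split; first by have := upm 0%N n.
  split=> //; split; first by have := dnm 0%N n.
  elim: n => [|n IH]; first by rewrite expr0 divr1.
  rewrite exprS invfM mulrCA -IH.
  by have [->|->] /= := hI n; lra.
pose A := range (fun n => (I n).1).
have Aub m : ubound A (I m).2.
  move=> _ [n _ <-]; have [/subnKC <-|/ltnW/subnKC <-] := leqP n m.
    exact: le_trans (upm _ _) (le_ _).
  exact: le_trans (le_ _) (dnm _ _).
exists (sup A) => n; apply/andP; split.
  by apply: ub_le_sup; [exists (I 0%N).2; exact: Aub|exists n].
by apply: ge_sup; [exists (I 0%N).1, 0%N|exact: Aub].
Qed.

(** Bisection induction on closed rectangles: a property that passes from the
    four quarters of a rectangle to the rectangle, and that holds for all small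
    rectangles containing a given point, holds for the whole rectangle. *)
Lemma rect_induction (P : R * R -> R * R -> Prop) (I0 J0 : R * R) :
  I0.1 <= I0.2 -> J0.1 <= J0.2 ->
  (forall I J, I0.1 <= I.1 -> I.1 <= I.2 -> I.2 <= I0.2 ->
     J0.1 <= J.1 -> J.1 <= J.2 -> J.2 <= J0.2 ->
     (forall I' J', half I I' -> half J J' -> P I' J') -> P I J) ->
  (forall x y, I0.1 <= x <= I0.2 -> J0.1 <= y <= J0.2 ->
     exists2 d : R, 0 < d & forall I J, I0.1 <= I.1 -> I.1 <= x <= I.2 -> I.2 <= I0.2 ->
     J0.1 <= J.1 -> J.1 <= y <= J.2 -> J.2 <= J0.2 ->
     I.2 - I.1 < d -> J.2 - J.1 < d -> P I J) ->
  P I0 J0.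
Proof.
move=> hI0 hJ0 split_ local_; apply: contrapT => nP.
pose next (q : (R * R) * (R * R)) := get [set q' : (R * R) * (R * R) |
  half q.1 q'.1 /\ half q.2 q'.2 /\ ~ P q'.1 q'.2].
pose q n := iter n next (I0, J0).
pose ok (q : (R * R) * (R * R)) := [/\ I0.1 <= q.1.1, q.1.1 <= q.1.2, q.1.2 <= I0.2 &
  [/\ J0.1 <= q.2.1, q.2.1 <= q.2.2 & q.2.2 <= J0.2]] /\ ~ P q.1 q.2.
have nextP p : ok p -> half p.1 (next p).1 /\ half p.2 (next p).2 /\ ~ P (next p).1 (next p).2.
  move=> [[h1 h2 h3 [h4 h5 h6]] nPp]; apply: (@getPex _ [set q' : (R * R) * (R * R) |
    half p.1 q'.1 /\ half p.2 q'.2 /\ ~ P q'.1 q'.2]).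
  apply: contrapT => H; apply: nPp; apply: split_ => // I' J' hI' hJ'.
  by apply: contrapT => nP'; apply: H; exists (I', J').
have okn n : ok (q n).
  elim: n => [|n IH]; first by split=> //; split.
  have [h1 [h2 nPn]] := nextP _ IH; split=> //.
  move: IH => [[k1 k2 k3 [k4 k5 k6]] _]; rewrite -/(q n) in h1 h2.
  rewrite /q iterS -/(q n).
  have [l1 l2 l3] := half_sub h1 k1 k2 k3.
  by have [l4 l5 l6] := half_sub h2 k4 k5 k6.
have hq n : half (q n).1 (q n.+1).1 /\ half (q n).2 (q n.+1).2.
  by have [h1 [h2 _]] := nextP _ (okn n).
have [A1 [x xI]] := @nested_halves (fun n => (q n).1) hI0 (fun n => (hq n).1).
have [A2 [y yJ]] := @nested_halves (fun n => (q n).2) hJ0 (fun n => (hq n).2).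
have [d d0 dP] := local_ x y (xI 0%N) (yJ 0%N).
have small u : exists N : nat, forall n, (N <= n)%N -> u / 2 ^+ n < d.
  exists (Num.bound (u / d)) => n /upper_nthrootP.
  by rewrite ltr_pdivrMr // mulrC -ltr_pdivrMr ?exprn_gt0.
have [N1 H1] := small (I0.2 - I0.1); have [N2 H2] := small (J0.2 - J0.1).
pose n := maxn N1 N2.
have [[k1 k2 k3 [k4 k5 k6]]] := okn n; apply.
apply: dP => //.
  by have [_ [_ [_ ->]]] := A1 n; apply: H1; rewrite leq_maxl.
by have [_ [_ [_ ->]]] := A2 n; apply: H2; rewrite leq_maxr.
Qed.

End Bisection.

(** * Goursat's theorem *)

Section Goursat.
Context {R : realType}.
Local Notation C := (Cplx R).
Local Notation ii := (0 +i* 1 : C).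
Implicit Types (F G : C -> C) (a b c d x y : R).

Lemma rder_h y x : rder (fun s => s +i* y : C) x 1.
Proof. by split=> /=; [exact: is_derive_id|exact: is_derive_cst]. Qed.

Lemma rder_v x y : rder (fun s => x +i* s : C) y ii.
Proof. by split=> /=; [exact: is_derive_cst|exact: is_derive_id]. Qed.

(** Continuity at every point of a closed rectangle. *)
Definition rect_on a b c d F := forall x y, a <= x <= b -> c <= y <= d ->
  {for (x +i* y : C), continuous F}.

(** The integral of [F] along the boundary of the rectangle
    [[a, b] x [c, d]], counterclockwise. *)
Definition oint a b c d F : C :=
  cint a b (fun x => F (x +i* c)) - cint a b (fun x => F (x +i* d)) +
  ii * (cint c d (fun y => F (b +i* y)) - cint c d (fun y => F (a +i* y))).

Arguments oint : simpl never.

Lemma cont_h a b c d F y : rect_on a b c d F -> c <= y <= d ->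
  cont_on a b (fun x => F (x +i* y)).
Proof.
move=> cF cyd x axb; apply: (@continuous_comp _ _ _ (fun x => x +i* y : C) F); last exact: cF.
exact: rder_cont (rder_h _ _).
Qed.

Lemma cont_v a b c d F x : rect_on a b c d F -> a <= x <= b ->
  cont_on c d (fun y => F (x +i* y)).
Proof.
move=> cF axb y cyd; apply: (@continuous_comp _ _ _ (fun y => x +i* y : C) F); last exact: cF.
exact: rder_cont (rder_v _ _).
Qed.

Lemma rect_onS a b c d a' b' c' d' F : a <= a' -> b' <= b -> c <= c' -> d' <= d ->
  rect_on a b c d F -> rect_on a' b' c' d' F.
Proof. by move=> h1 h2 h3 h4 cF x y /andP[? ?] /andP[? ?]; apply: cF; lra. Qed.

Lemma ointB a b c d F G : a <= b -> c <= d -> rect_on a b c d F -> rect_on a b c d G ->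
  oint a b c d (fun z => F z - G z) = oint a b c d F - oint a b c d G.
Proof.
move=> ab cd cF cG; have [cc dd] : (c <= c <= d) /\ (c <= d <= d) by rewrite !lexx cd.
have [aa bb] : (a <= a <= b) /\ (a <= b <= b) by rewrite !lexx ab.
rewrite /oint !cintB; [ring|exact: cont_v cF aa|exact: cont_v cG aa|exact: cont_v cF bb
  |exact: cont_v cG bb|exact: cont_h cF dd|exact: cont_h cG dd|exact: cont_h cF cc|exact: cont_h cG cc].
Qed.

Lemma oint_primitive a b c d F G : a <= b -> c <= d -> rect_on a b c d F ->
  (forall x y, a <= x <= b -> c <= y <= d -> cder G (x +i* y) (F (x +i* y))) ->
  oint a b c d F = 0.
Proof.
move=> ab cd cF dG.
have Hh y : c <= y <= d -> cint a b (fun x => F (x +i* y)) = G (b +i* y) - G (a +i* y).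
  move=> cyd; rewrite -(cint_FTC (g := fun x => G (x +i* y)) ab _ (cont_h cF cyd)) //.
  move=> x axb; rewrite -[F _]mulr1; apply: (rder_comp (g := fun x => x +i* y : C)).
    exact: dG.
  exact: rder_h.
have Hv x : a <= x <= b -> ii * cint c d (fun y => F (x +i* y)) = G (x +i* d) - G (x +i* c).
  move=> axb; rewrite -cintZ; last exact: (cont_v cF axb).
  have cc : cont_on c d (fun t => ii * F (x +i* t)).
    move=> t td; apply: (@cvgM _ _ _ _ (fun=> ii)); first exact: cvg_cst.
    exact: (cont_v cF axb).
  rewrite -(cint_FTC (g := fun y => G (x +i* y)) cd _ cc) //.
  move=> y cyd; rewrite mulrC; apply: (rder_comp (g := fun y => x +i* y : C)).
    exact: dG.
  exact: rder_v.
rewrite /oint mulrBr !Hh ?Hv ?lexx ?ab ?cd //.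
ring.
Qed.

Lemma oint_le a b c d F M : a <= b -> c <= d -> rect_on a b c d F ->
  (forall x y, a <= x <= b -> c <= y <= d -> cmod (F (x +i* y)) <= M) ->
  cmod (oint a b c d F) <= 4 * M * ((b - a) + (d - c)).
Proof.
move=> ab cd cF FM.
have ii1 : cmod ii = 1 by rewrite cmodE /= expr0n expr1n add0r sqrtr1.
have Hh y : c <= y <= d -> cmod (cint a b (fun x => F (x +i* y))) <= 2 * M * (b - a).
  by move=> cyd; apply: cmod_cint => //; [exact: cont_h cF cyd|move=> t tab; exact: FM].
have Hv x : a <= x <= b -> cmod (cint c d (fun y => F (x +i* y))) <= 2 * M * (d - c).
  by move=> axb; apply: cmod_cint => //; [exact: cont_v cF axb|move=> t tab; exact: FM].
rewrite (le_trans (cmodD _ _)) // cmodM ii1 mul1r.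
have cc : c <= c <= d by lra. have dd : c <= d <= d by lra.
have aa : a <= a <= b by lra. have bb : a <= b <= b by lra.
have := cmodB (cint a b (fun x => F (x +i* c))) (cint a b (fun x => F (x +i* d))).
have := cmodB (cint c d (fun x => F (b +i* x))) (cint c d (fun x => F (a +i* x))).
have := Hh _ cc; have := Hh _ dd; have := Hv _ aa; have := Hv _ bb.
move: (cmod _) (cmod _) (cmod _) (cmod _) (cmod (_ - _)) (cmod (_ - _)) => *; lra.
Qed.

Lemma oint_split a b c d m n F : a <= m <= b -> c <= n <= d -> rect_on a b c d F ->
  oint a b c d F = oint a m c n F + oint m b c n F + oint a m n d F + oint m b n d F.
Proof.
move=> /andP[am mb] /andP[cn nd] cF; rewrite /oint.
have cc : c <= c <= d by lra. have dd : c <= d <= d by lra.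
have aa : a <= a <= b by lra. have bb : a <= b <= b by lra.
have nn : c <= n <= d by lra. have mm : a <= m <= b by lra.
rewrite (cint_split am mb (cont_h cF cc)) (cint_split am mb (cont_h cF dd)).
rewrite (cint_split cn nd (cont_v cF aa)) (cint_split cn nd (cont_v cF bb)).
ring.
Qed.

Theorem goursat a b c d F : a <= b -> c <= d ->
  (forall x y, a <= x <= b -> c <= y <= d -> exists l, cder F (x +i* y) l) ->
  oint a b c d F = 0.
Proof.
move=> ab cd dF.
have cF : rect_on a b c d F by move=> x y hx hy; have [l /cder_cont] := dF x y hx hy.
suff H e : 0 < e -> cmod (oint a b c d F) <= e * ((b - a) + (d - c)) ^+ 2.
  apply/eqP; rewrite -cmod_eq0; apply/eqP/le_anti; rewrite cmod_ge0 andbT.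
  apply/ler_addgt0Pl => e e0; rewrite addr0.
  pose S := ((b - a) + (d - c)) ^+ 2; have S0 : 0 <= S by rewrite sqr_ge0.
  apply: le_trans (H (e / (S + 1)) _) _; first by rewrite divr_gt0 // ltr_wpDl.
  rewrite -/S mulrAC ler_pdivrMr ?ltr_wpDl // ler_pM2l //; lra.
move=> e0.
apply: (@rect_induction _ (fun I J => cmod (oint I.1 I.2 J.1 J.2 F) <=
   e * ((I.2 - I.1) + (J.2 - J.1)) ^+ 2) (a, b) (c, d)) => //=.
  move=> [a' b'] [c' d'] /= h1 h2 h3 h4 h5 h6 H.
  have cF' : rect_on a' b' c' d' F by apply: rect_onS cF.
  have m1 : a' <= (a' + b') / 2 <= b' by lra.
  have m2 : c' <= (c' + d') / 2 <= d' by lra.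
  rewrite (oint_split m1 m2 cF').
  have E1 := H _ _ (or_introl erefl) (or_introl erefl).
  have E2 := H _ _ (or_intror erefl) (or_introl erefl).
  have E3 := H _ _ (or_introl erefl) (or_intror erefl).
  have E4 := H _ _ (or_intror erefl) (or_intror erefl).
  rewrite /= in E1 E2 E3 E4.
  apply: le_trans (cmodD _ _) _; apply: le_trans (lerD (cmodD _ _) (lexx _)) _.
  apply: le_trans (lerD (lerD (cmodD _ _) (lexx _)) (lexx _)) _.
  (* Each quarter has half the size, so a quarter of the bound. *)
  set S := (b' - a' + (d' - c')).
  have Q u : u = S / 2 -> e * u ^+ 2 = e * S ^+ 2 / 4 by move=> ->; field.
  rewrite Q in E1; last by rewrite /S; field.
  rewrite Q in E2; last by rewrite /S; field.
  rewrite Q in E3; last by rewrite /S; field.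
  rewrite Q in E4; last by rewrite /S; field.
  have sum4 (u v w x q : R) : u <= q / 4 -> v <= q / 4 -> w <= q / 4 -> x <= q / 4 ->
    u + v + w + x <= q by clear; lra.
  exact: sum4.
move=> x y hx hy; have [l Fl] := dF x y hx hy.
have e4 : 0 < e / 4 by rewrite divr_gt0.
have [r r0 rP] := Fl _ e4.
exists (r / 2); first by rewrite divr_gt0.
move=> [a' b'] [c' d'] /= h1 /andP[h2 h2'] h3 h4 /andP[h5 h5'] h6 sab scd.
have cF' : rect_on a' b' c' d' F by apply: rect_onS cF.
pose z0 : C := x +i* y.
(* The affine part of F at z0 has a primitive, hence no boundary integral; the
   remainder is at most e / 4 times the half perimeter S. *)
pose A z : C := F z0 + l * (z - z0).
pose G z : C := F z0 * z + l / 2 * ((z - z0) * (z - z0)).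
have dG z : cder G z (A z).
  have -> : A z = (0 * z + F z0 * 1) + (0 * ((z - z0) * (z - z0)) +
      l / 2 * ((1 - 0) * (z - z0) + (z - z0) * (1 - 0))) by rewrite /A; field.
  apply: cderD; first by apply: cderM; [exact: cder_cst|exact: cder_id].
  apply: cderM; first exact: cder_cst.
  by apply: cderM; apply: cderB; [exact: cder_id|exact: cder_cst|exact: cder_id|exact: cder_cst].
have dA z : cder A z l.
  have -> : l = 0 + (0 * (z - z0) + l * (1 - 0)) by ring.
  apply: cderD; first exact: cder_cst.
  by apply: cderM; [exact: cder_cst|apply: cderB; [exact: cder_id|exact: cder_cst]].
have cA : rect_on a' b' c' d' A by move=> u v _ _; exact: cder_cont (dA _).
have ab' : a' <= b' by lra. have cd' : c' <= d' by lra.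
have JA : oint a' b' c' d' A = 0 by apply: (oint_primitive (G := G)).
rewrite -[oint _ _ _ _ F]subr0 -JA -ointB //.
set S := (b' - a' + (d' - c')).
have S0 : 0 <= S by rewrite /S; lra.
have cFA : rect_on a' b' c' d' (fun z => F z - A z).
  by move=> u v hu hv; apply: continuousB; [exact: cF'|exact: cA].
apply: le_trans (oint_le (M := e / 4 * S) ab' cd' cFA _) _; last first.
  by rewrite -/S; lra.
move=> u v /andP[hu hu'] /andP[hv hv'].
have uv : cmod ((u +i* v : C) - z0) <= S.
  apply: le_trans (cmod_ReIm _) _; rewrite /z0 !ReImE /S; apply: lerD; rewrite ler_norml; lra.
have -> : F (u +i* v) - A (u +i* v) =
  F (z0 + ((u +i* v) - z0)) - F z0 - l * ((u +i* v) - z0).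
  by rewrite /A [z0 + _]addrC subrK; ring.
apply: le_trans (rP _ _) _; first by rewrite (le_lt_trans uv) // /S; lra.
by rewrite ler_wpM2l // divr_ge0 // ltW.
Qed.

End Goursat.

Arguments oint {R} a b c d F : simpl never.

(** * Integrals over circles and Cauchy's estimates *)

Arguments polar : simpl never.
Arguments cexp : simpl never.

Section Circles.
Context {R : realType}.
Local Notation C := (Cplx R).
Local Notation ii := (0 +i* 1 : C).
Implicit Types (f df : C -> C) (a z w h l : C) (r s t al : R).

Lemma Re_polar r t : complex.Re (polar r t : C) = r * cos t. Proof. by []. Qed.
Lemma Im_polar r t : complex.Im (polar r t : C) = r * sin t. Proof. by []. Qed.

(** Computes real and imaginary parts of expressions with polar points. *)
Definition polarE := (Re_polar, Im_polar, (@ReImE R)).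

Lemma cmod_polar r t : cmod (polar r t) = `|r|.
Proof.
by rewrite cmodE Re_polar Im_polar !exprMn -mulrDr cos2Dsin2 mulr1 sqrtr_sqr.
Qed.

Lemma polarM r s t u : polar r t * polar s u = polar (r * s) (t + u) :> C.
Proof.
apply: complexP; rewrite !polarE ?cosD ?sinD; ring.
Qed.

Lemma polar10 : polar 1 0 = 1 :> C.
Proof. by apply: complexP; rewrite ?Re_polar ?Im_polar ?cos0 ?sin0 ?mulr0 ?mulr1. Qed.

Lemma polarV r t : r != 0 -> (polar r t)^-1 = polar r^-1 (- t) :> C.
Proof.
move=> r0; have p0 : polar r t != 0 :> C by rewrite -cmod_gt0 cmod_polar normr_gt0.
by apply: (mulfI p0); rewrite divff // polarM divff // subrr polar10.
Qed.

Lemma cexpE (x y : R) : cexp (x +i* y) = polar (expR x) y. Proof. by []. Qed.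

Lemma polar_periodic r t : polar r (t + 2 * pi) = polar r t :> C.
Proof.
by rewrite mulr_natl; apply: complexP; rewrite ?Re_polar ?Im_polar ?cosD2pi ?sinD2pi.
Qed.

Lemma rder_polar_arg r t : rder (fun t => polar r t) t (ii * polar r t).
Proof.
split; rewrite !polarE.
  by apply: is_derive_eq; rewrite /GRing.scale /=; ring.
by apply: is_derive_eq; rewrite /GRing.scale /=; ring.
Qed.

Lemma rder_polar_rad r t : rder (fun r => polar r t) r (polar 1 t).
Proof.
split; rewrite !(Re_polar, Im_polar).
  by apply: is_derive_eq; rewrite /GRing.scale /=; ring.
by apply: is_derive_eq; rewrite /GRing.scale /=; ring.
Qed.

Lemma continuous_polar r : continuous (polar r : R -> C).
Proof. by move=> t; exact: rder_cont (rder_polar_arg r t). Qed.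

Lemma cont_circle f a r al be : (forall t, {for a + polar r t, continuous f}) ->
  cont_on al be (fun t => f (a + polar r t)).
Proof.
move=> cf t _; apply: (@continuous_comp _ _ _ (fun t => a + polar r t) f) => //.
by apply: continuousD; [exact: cvg_cst|exact: continuous_polar].
Qed.

Lemma cont_onM al be (f g : R -> C) : cont_on al be f -> cont_on al be g ->
  cont_on al be (fun t => f t * g t).
Proof. by move=> cf cg t tab; apply: continuousM; [exact: cf|exact: cg]. Qed.

Lemma cont_onB al be (f g : R -> C) : cont_on al be f -> cont_on al be g ->
  cont_on al be (fun t => f t - g t).
Proof. by move=> cf cg t tab; apply: continuousB; [exact: cf|exact: cg]. Qed.

Lemma cont_onD al be (f g : R -> C) : cont_on al be f -> cont_on al be g ->
  cont_on al be (fun t => f t + g t).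
Proof. by move=> cf cg t tab; apply: continuousD; [exact: cf|exact: cg]. Qed.

Lemma pi2_gt0 : 0 < 2 * pi :> R. Proof. by rewrite mulr_gt0 // pi_gt0. Qed.

(** Goursat's theorem for [f (a + cexp w)] on a rectangle of height [2 pi]: the
    contributions of the horizontal sides cancel by periodicity. *)
Lemma circle_const f a r0 r1 r2 al :
  (forall z, 0 < cmod (z - a) < r0 -> exists l, cder f z l) ->
  0 < r1 -> r1 <= r2 -> r2 < r0 ->
  cint al (al + 2 * pi) (fun t => f (a + polar r1 t)) =
  cint al (al + 2 * pi) (fun t => f (a + polar r2 t)).
Proof.
move=> df r10 r12 r20.
pose F (w : C) : C := f (a + cexp w).
have r20' : 0 < r2 by rewrite (lt_le_trans r10).
have al2 : al <= al + 2 * pi by rewrite lerDl ltW // pi2_gt0.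
have l12 : ln r1 <= ln r2 by rewrite ler_ln.
have dF x y : ln r1 <= x <= ln r2 -> al <= y <= al + 2 * pi ->
    exists l, cder F (x +i* y) l.
  move=> /andP[x1 x2] _.
  have [|l fl] := df (a + cexp (x +i* y)).
    rewrite addrC addKr cmod_cexp /= expR_gt0 /=.
    by rewrite (le_lt_trans _ r20) // -(lnK r20') ler_expR.
  exists (l * (0 + cexp (x +i* y))); apply: (cder_comp (g := fun w => a + cexp w)) => //.
  by apply: cderD; [exact: cder_cst|exact: cder_cexp].
have := goursat l12 al2 dF; rewrite /oint.
rewrite (@eq_cint _ _ _ (fun x => F (x +i* (al + 2 * pi))) (fun x => F (x +i* al))); last first.
  by move=> x _; rewrite /F !cexpE polar_periodic.
rewrite subrr add0r => /eqP; rewrite mulf_eq0 => /orP[/eqP/(congr1 (@complex.Im R))/eqP|].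
  by rewrite /= oner_eq0.
by rewrite subr_eq0 /F => /eqP; rewrite /cexp /= !lnK // => ->.
Qed.

(** Mean value property; a singularity at the center is allowed as long as
    the function is continuous there. *)
Lemma mean_value f a r0 r al :
  (forall z, 0 < cmod (z - a) < r0 -> exists l, cder f z l) ->
  {for a, continuous f} -> 0 < r -> r < r0 ->
  cint al (al + 2 * pi) (fun t => f (a + polar r t)) = (2 * pi)%:C * f a.
Proof.
move=> df cf r_gt0 rr0; apply/eqP; rewrite -subr_eq0 -cmod_eq0.
apply/eqP/le_anti; rewrite cmod_ge0 andbT; apply/ler_addgt0Pl => e e0; rewrite addr0.
have p2 := pi2_gt0.
have e2 : 0 < e / (2 * (2 * pi)) by rewrite divr_gt0 // mulr_gt0.
have [d d0 H] := (contCP f a).1 cf _ e2.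
pose s := Num.min r (d / 2).
have s0 : 0 < s by rewrite lt_min r_gt0 divr_gt0.
have sr : s <= r by rewrite ge_min lexx.
have sd : s < d by rewrite gt_min; apply/orP; right; lra.
rewrite -(circle_const _ df s0 sr rr0).
have al2 : al <= al + 2 * pi by rewrite lerDl ltW.
have -> : (2 * pi)%:C * f a = cint al (al + 2 * pi) (fun=> f a).
  by rewrite cint_cst // addrC addKr.
have cc : cont_on al (al + 2 * pi) (fun t => f (a + polar s t)).
  apply: cont_circle => t.
  have [|l] := df (a + polar s t); last exact: cder_cont.
  by rewrite addrC addKr cmod_polar gtr0_norm // s0 (le_lt_trans sr).
rewrite -(cintB cc (@cont_on_cst _ _ _ _ (f a))).
apply: le_trans (cmod_cint (M := e / (2 * (2 * pi))) al2 _ _) _.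
- exact: cont_onB cc (@cont_on_cst _ _ _ _ (f a)).
- by move=> t _; apply: H; rewrite cmod_polar gtr0_norm.
- rewrite addrAC subrr add0r le_eqVlt; apply/orP; left; apply/eqP.
  by move: (2 * pi) p2 => P p2; field; rewrite gt_eqF.
Qed.

(** The closed segment between two points of a disc stays in the disc. *)
Lemma disc_convex a z w r t : cmod (z - a) < r -> cmod (w - a) < r -> 0 <= t <= 1 ->
  cmod (z + t%:C * (w - z) - a) < r.
Proof.
move=> zr wr /andP[t0 t1].
have -> : z + t%:C * (w - z) - a = (1 - t)%:C * (z - a) + t%:C * (w - a).
  by apply: complexP; rewrite !polarE; ring.
apply: le_lt_trans (cmodD _ _) _; rewrite !cmodM !cmod_real !ger0_norm ?subr_ge0 //.
have [->|tn0] := eqVneq t 0; first by rewrite mul0r addr0 subr0 mul1r.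
have tp : 0 < t by rewrite lt_def tn0.
have : t * cmod (w - a) < t * r by rewrite ltr_pM2l.
have : (1 - t) * cmod (z - a) <= (1 - t) * r by rewrite ler_wpM2l ?subr_ge0 // ltW.
by lra.
Qed.

Lemma disc_lipschitz f df a r M z w :
  (forall v, cmod (v - a) < r -> cder f v (df v)) ->
  (forall v, cmod (v - a) < r -> cmod (df v) <= M) ->
  cmod (z - a) < r -> cmod (w - a) < r -> cmod (f w - f z) <= 2 * M * cmod (w - z).
Proof.
move=> hf hM zr wr.
have -> : f w - f z = f (z + 1%:C * (w - z)) - f (z + 0%:C * (w - z)).
  by rewrite mul1r mul0r addr0 [z + _]addrC subrK.
have -> : 2 * M * cmod (w - z) = 2 * (M * cmod (w - z)) * (1 - 0) by ring.
apply: (rder_mvt (g := fun t => f (z + t%:C * (w - z)))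
   (dg := fun t => df (z + t%:C * (w - z)) * (w - z))) => // t t01.
  by apply: rder_comp (rder_line _ _ _); apply: hf; exact: disc_convex.
by rewrite cmodM ler_wpM2r ?cmod_ge0 // hM // disc_convex.
Qed.

(** First order Taylor estimate when the derivative is Lipschitz. *)
Lemma disc_taylor1 f df a r M z w :
  (forall v, cmod (v - a) < r -> cder f v (df v)) ->
  (forall v u, cmod (v - a) < r -> cmod (u - a) < r -> cmod (df u - df v) <= M * cmod (u - v)) ->
  0 <= M ->
  cmod (z - a) < r -> cmod (w - a) < r ->
  cmod (f w - f z - df z * (w - z)) <= 2 * M * cmod (w - z) ^+ 2.
Proof.
move=> hf hM M0 zr wr.
pose g t := f (z + t%:C * (w - z)) - t%:C * (df z * (w - z)).
have -> : f w - f z - df z * (w - z) = g 1 - g 0.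
  by rewrite /g !mul1r !mul0r addr0 [z + _]addrC subrK; ring.
have -> : 2 * M * cmod (w - z) ^+ 2 = 2 * (M * cmod (w - z) ^+ 2) * (1 - 0) by ring.
apply: (rder_mvt (dg := fun t => (df (z + t%:C * (w - z)) - df z) * (w - z))) => // t t01.
  rewrite mulrBl; apply: rderD.
    by apply: rder_comp (rder_line _ _ _); apply: hf; exact: disc_convex.
  apply: rderN.
  by have := rderM (rder_real t) (rder_cst (df z * (w - z)) t); rewrite mul1r mulr0 addr0.
rewrite cmodM expr2 mulrA ler_wpM2r ?cmod_ge0 //.
apply: le_trans (hM _ _ zr (disc_convex zr wr t01)) _.
rewrite ler_wpM2l // addrC addKr cmodM cmod_real.
by rewrite ler_piMl ?cmod_ge0 //; move: t01 => /andP[? ?]; rewrite ger0_norm.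
Qed.

Lemma circle_ball a z r t u : 0 <= r -> cmod (z - a) < u ->
  cmod (z + polar r t - a) < u + r.
Proof.
move=> r0 zu; rewrite addrAC (le_lt_trans (cmodD _ _)) // cmod_polar ger0_norm //.
by rewrite ltrD2r.
Qed.

Lemma circle_sub a r t : a + polar r t - a = polar r t :> C.
Proof. by rewrite addrC addKr. Qed.

(** Cauchy's formula for the derivative at the center. *)
Lemma cauchy_deriv f a l r0 r al :
  (forall z, cmod (z - a) < r0 -> exists l, cder f z l) -> cder f a l ->
  0 < r -> r < r0 ->
  cint al (al + 2 * pi) (fun t => (f (a + polar r t) - f a) * polar r^-1 (- t)) =
  (2 * pi)%:C * l.
Proof.
move=> hf fl r_gt0 rr0.
(* The difference quotient, completed by l at a: division by 0 gives 0. *)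
pose h z := (f z - f a) / (z - a) + (if z == a then l else 0).
have ha : h a = l by rewrite /h eqxx subrr mul0r add0r.
have hz z : z != a -> h z = (f z - f a) / (z - a) by rewrite /h => /negbTE ->; rewrite addr0.
rewrite -ha -(mean_value (r0 := r0) al _ _ r_gt0 rr0).
- apply: eq_cint => t _.
  have pa : a + polar r t != a.
    by rewrite -subr_eq0 circle_sub -cmod_gt0 cmod_polar normr_gt0 gt_eqF.
  by rewrite (hz _ pa) circle_sub polarV // gt_eqF.
- move=> z /andP[z0 zr]; have [m fm] := hf z zr.
  have za : z - a != 0 by rewrite -cmod_gt0.
  have D1 := cderB fm (cder_cst (f a) z).
  have D2 := @cderV _ (fun w => w - a) z _ za (cderB (cder_id z) (cder_cst a z)).
  have D3 := cderM D1 D2.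
  eexists; apply: cder_ext z0 _ D3 => k kz.
  rewrite hz // -subr_eq0 addrAC -cmod_gt0.
  have := cmod_dist (z - a) (- k); rewrite opprK cmodN.
  by have := ler_norm (cmod (z - a) - cmod k); lra.
- apply/contCP => e e0; have [d d0 dP] := fl e e0; exists d => // k kd.
  rewrite ha; have [->|k0] := eqVneq k 0; first by rewrite addr0 ha subrr cmod0 ltW.
  rewrite hz; last by rewrite -subr_eq0 addrC addKr.
  rewrite addrC [a + k - a]addrC addKr.
  have -> : - l + (f (a + k) - f a) / k = (f (a + k) - f a - l * k) / k by field.
  by rewrite cmodM cmodV ler_pdivrMr ?cmod_gt0 //; exact: dP.
Qed.

Lemma cont_disc f df a r : (forall z, cmod (z - a) < r -> cder f z (df z)) ->
  forall z, cmod (z - a) < r -> {for z, continuous f}.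
Proof. by move=> hf z /hf/cder_cont. Qed.

Lemma cont_inv_circle r al be : cont_on al be (fun t => polar r^-1 (- t) : C).
Proof.
move=> t _; apply: (@continuous_comp _ _ _ (fun t : R => - t) (polar r^-1)).
  exact: opp_continuous.
exact: continuous_polar.
Qed.

Lemma cauchy_est f df a r0 r B :
  (forall z, cmod (z - a) < r0 -> cder f z (df z)) -> 0 < r -> r < r0 ->
  (forall z, cmod (z - a) <= r -> cmod (f z) <= B) -> cmod (df a) <= 4 * B / r.
Proof.
move=> hf r_gt0 rr0 fB.
have r00 : 0 < r0 by lra.
have hfe z : cmod (z - a) < r0 -> exists l, cder f z l by move=> /hf; exists (df z).
have fa : cder f a (df a) by apply: hf; rewrite subrr cmod0.
have E := cauchy_deriv 0 hfe fa r_gt0 rr0.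
have p2 := pi2_gt0.
have cc : cont_on 0 (0 + 2 * pi) (fun t => (f (a + polar r t) - f a) * polar r^-1 (- t)).
  apply: cont_onM; last exact: cont_inv_circle.
  apply: cont_onB; last exact: cont_on_cst.
  apply: cont_circle => t; apply: cont_disc hf _ _.
  by rewrite circle_sub cmod_polar gtr0_norm.
have := @cmod_cint _ 0 (0 + 2 * pi) _ (2 * B / r) _ cc.
rewrite E add0r subr0 cmodM cmod_real gtr0_norm // => /(_ (ltW p2)) H.
have {}H : 2 * pi * cmod (df a) <= 2 * (2 * B / r) * (2 * pi).
  apply: H => t _; rewrite cmodM cmod_polar normfV gtr0_norm //.
  rewrite ler_pM2r ?invr_gt0 // (le_trans (cmodB _ _)) //.
  have : cmod (f (a + polar r t)) <= B by apply: fB; rewrite circle_sub cmod_polar gtr0_norm.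
  by have : cmod (f a) <= B by [apply: fB; rewrite subrr cmod0 ltW]; lra.
rewrite -(ler_pM2l p2) (le_trans H) // le_eqVlt; apply/orP; left; apply/eqP; ring.
Qed.

(** The derivative of a holomorphic function is locally Lipschitz: Cauchy's
    formula expresses it through values of the function on a circle. *)
Lemma deriv_lipschitz f df a r0 rho B :
  (forall z, cmod (z - a) < r0 -> cder f z (df z)) -> 0 < rho -> 4 * rho <= r0 ->
  (forall z, cmod (z - a) < 4 * rho -> cmod (f z) <= B) ->
  forall z w, cmod (z - a) < rho -> cmod (w - a) < rho ->
  cmod (df w - df z) <= 64 * B / rho ^+ 2 * cmod (w - z).
Proof.
move=> hf rho0 rho4 fB.
have near z u v : cmod (z - a) < u -> cmod (v - z) < rho -> cmod (v - a) < u + rho.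
  move=> zu vz; have := cmodD (v - z) (z - a); rewrite addrA subrK; lra.
have B1 z : cmod (z - a) < 3 * rho -> cmod (df z) <= 8 * B / rho.
  move=> z3.
  have h1 v : cmod (v - z) < rho -> cder f v (df v).
    by move=> vz; apply: hf; have := near z _ v z3 vz; lra.
  have h2 v : cmod (v - z) <= rho / 2 -> cmod (f v) <= B.
    by move=> vz; apply: fB; have := near z _ v z3; lra.
  have := cauchy_est h1 (r := rho / 2) _ _ h2; rewrite invf_div => H.
  have -> : 8 * B / rho = 4 * B * (2 / rho) by field; rewrite gt_eqF.
  by apply: H; lra.
have hf3 z : cmod (z - a) < 3 * rho -> cder f z (df z) by move=> ?; apply: hf; lra.
have Lip := disc_lipschitz hf3 B1.
have p2 := pi2_gt0.
move=> z w za wa.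
have cv v : cmod (v - a) < rho ->
   cont_on 0 (0 + 2 * pi) (fun t => (f (v + polar rho t) - f v) * polar rho^-1 (- t)).
  move=> va; apply: cont_onM; last exact: cont_inv_circle.
  apply: cont_onB; last exact: cont_on_cst.
  apply: cont_circle => t; apply: cont_disc hf3 _ _.
  by have := circle_ball t (ltW rho0) va; lra.
have Ev v : cmod (v - a) < rho ->
   cint 0 (0 + 2 * pi) (fun t => (f (v + polar rho t) - f v) * polar rho^-1 (- t)) =
   (2 * pi)%:C * df v.
  move=> va; apply: (cauchy_deriv (r0 := 2 * rho)) => //; try lra.
    move=> u uv; exists (df u); apply: hf3.
    by have := cmodD (u - v) (v - a); rewrite addrA subrK; lra.
  by apply: hf3; lra.
rewrite -(ler_pM2l p2) -{1}[2 * pi]gtr0_norm // -cmod_real -cmodM mulrBr -!Ev //.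
rewrite -cintB; [|exact: cv|exact: cv].
apply: le_trans (cmod_cint (M := 32 * B / rho ^+ 2 * cmod (w - z)) _ _ _) _.
- by rewrite add0r ltW.
- by apply: cont_onB; exact: cv.
- move=> t _; rewrite -mulrBl cmodM cmod_polar normfV gtr0_norm //.
  rewrite ler_pdivrMr //.
  have -> : 32 * B / rho ^+ 2 * cmod (w - z) * rho =
    2 * (8 * B / rho) * cmod (w - z) + 2 * (8 * B / rho) * cmod (w - z).
    by field; rewrite gt_eqF.
  have -> : f (w + polar rho t) - f w - (f (z + polar rho t) - f z) =
    (f (w + polar rho t) - f (z + polar rho t)) - (f w - f z) by ring.
  apply: le_trans (cmodB _ _) _; apply: lerD; last by apply: Lip; lra.
  have -> : w - z = (w + polar rho t) - (z + polar rho t) by ring.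
  by apply: Lip; [have := circle_ball t (ltW rho0) za|have := circle_ball t (ltW rho0) wa]; lra.
- rewrite add0r subr0 le_eqVlt; apply/orP; left; apply/eqP.
  by move: (2 * pi) => P; field; rewrite gt_eqF.
Qed.

(** The candidate second derivative is the circle integral of
    [(df z - df a) / (z - a)], suggested by differentiating Cauchy's formula for
    [df] under the integral sign; Taylor estimates with the Lipschitz bound on
    [df] show that it is the derivative. *)
Theorem deriv_holomorphic f df a r0 : 0 < r0 ->
  (forall z, cmod (z - a) < r0 -> cder f z (df z)) -> exists l, cder df a l.
Proof.
move=> r00 hf.
have ca : {for a, continuous f} by apply: cont_disc hf _ _; rewrite subrr cmod0.
have [d d0 dP] := (contCP f a).1 ca 1 ltr01.
pose rho := Num.min (d / 8) (r0 / 8).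
have rho0 : 0 < rho by rewrite lt_min !divr_gt0.
have rd : rho <= d / 8 by rewrite ge_min lexx.
have rr : rho <= r0 / 8 by rewrite ge_min lexx orbT.
clearbody rho.
have r4 : 4 * rho <= r0 by lra.
have fB z : cmod (z - a) < 4 * rho -> cmod (f z) <= cmod (f a) + 1.
  move=> z4; have -> : f z = f a + (f (a + (z - a)) - f a).
    by rewrite [a + _]addrC subrK [RHS]addrC subrK.
  by rewrite (le_trans (cmodD _ _)) // lerD2l dP //; lra.
have Lip := deriv_lipschitz hf rho0 r4 fB.
set M := 64 * _ / _ in Lip.
have M0 : 0 <= M by rewrite /M divr_ge0 ?sqr_ge0 // mulr_ge0 // addr_ge0 ?cmod_ge0.
clearbody M.
have hf1 z : cmod (z - a) < rho -> cder f z (df z) by move=> ?; apply: hf; lra.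
have T1 := disc_taylor1 hf1 (fun v u hv hu => Lip v u hv hu) M0.
pose r := rho / 2; have r_gt0 : 0 < r by rewrite divr_gt0.
have p2 := pi2_gt0.
have pC : (2 * pi)%:C != 0 :> C by rewrite -cmod_gt0 cmod_real gtr0_norm.
have cdf z : cmod (z - a) < rho -> {for z, continuous df}.
  move=> za; apply/contCP => e e0.
  exists (Num.min (rho - cmod (z - a)) (e / (M + 1))).
    by rewrite lt_min subr_gt0 za divr_gt0 // ltr_wpDl.
  move=> k; rewrite lt_min => /andP[k1 k2].
  apply: le_trans (Lip _ _ za _) _.
    by have := cmodD k (z - a); rewrite addrA [k + z]addrC; lra.
  rewrite [z + k - z]addrC addKr.
  move: k2; rewrite ltr_pdivlMr ?ltr_wpDl //; have := cmod_ge0 k; nra.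
pose g t := (df (a + polar r t) - df a) * polar r^-1 (- t).
have in1 t : cmod (a + polar r t - a) < rho.
  by rewrite circle_sub cmod_polar gtr0_norm // /r; lra.
have a1 : cmod (a - a) < rho by rewrite subrr cmod0.
have cg : cont_on 0 (0 + 2 * pi) g.
  apply: cont_onM; last exact: cont_inv_circle.
  apply: cont_onB; last exact: cont_on_cst.
  by apply: cont_circle => t; exact: cdf.
pose l := (2 * pi)%:C^-1 * cint 0 (0 + 2 * pi) g.
exists l => e e0.
pose K := 4 * (2 * M) / r.
have K0 : 0 <= K by rewrite divr_ge0 ?(ltW r_gt0) // !mulr_ge0.
have KC : 4 * (2 * M) = K * r by rewrite /K divfK // gt_eqF.
clearbody K.
exists (Num.min (rho / 4) (e / (K + 1))).
  by rewrite lt_min !divr_gt0 // ltr_wpDl.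
move=> k; rewrite lt_min => /andP[k1]; rewrite ltr_pdivlMr ?ltr_wpDl // => k2.
have k0 := cmod_ge0 k.
have hfe z : cmod (z - a) < rho -> exists l, cder f z l by move=> /hf1; exists (df z).
have ak : cmod (a + k - a) < rho by rewrite [a + k - a]addrC addKr; lra.
have E0 := cauchy_deriv 0 hfe (hf1 _ a1) r_gt0 (_ : r < rho).
have {}E0 := E0 ltac:(rewrite /r; lra).
have hfk z : cmod (z - (a + k)) < 3 / 4 * rho -> exists l, cder f z l.
  move=> zk; apply: hfe; have -> : z - a = (z - (a + k)) + k by ring.
  by apply: le_lt_trans (cmodD _ _) _; lra.
have Ek := cauchy_deriv 0 hfk (hf1 _ ak) r_gt0 (_ : r < 3 / 4 * rho).
have {}Ek := Ek ltac:(rewrite /r; lra).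
have in2 t : cmod (a + k + polar r t - a) < rho.
  have -> : a + k + polar r t - a = k + polar r t by ring.
  by rewrite (le_lt_trans (cmodD _ _)) // cmod_polar gtr0_norm // /r; lra.
have c0 : cont_on 0 (0 + 2 * pi) (fun t => (f (a + polar r t) - f a) * polar r^-1 (- t)).
  apply: cont_onM; last exact: cont_inv_circle.
  apply: cont_onB; last exact: cont_on_cst.
  by apply: cont_circle => t; exact: cont_disc hf1 _ _.
have ck : cont_on 0 (0 + 2 * pi) (fun t => (f (a + k + polar r t) - f (a + k)) * polar r^-1 (- t)).
  apply: cont_onM; last exact: cont_inv_circle.
  apply: cont_onB; last exact: cont_on_cst.
  by apply: cont_circle => t; exact: cont_disc hf1 _ _.
have ckg : cont_on 0 (0 + 2 * pi) (fun t => k * g t).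
  exact: cont_onM (@cont_on_cst _ _ _ _ k) cg.
rewrite -(ler_pM2l p2) -{1}[2 * pi]gtr0_norm // -cmod_real -cmodM.
have -> : (2 * pi)%:C * (df (a + k) - df a - l * k) =
   (2 * pi)%:C * df (a + k) - (2 * pi)%:C * df a - k * cint 0 (0 + 2 * pi) g.
  by rewrite /l; move: (2 * pi)%:C pC (cint _ _ _) => P P0 I; field.
rewrite -E0 -Ek -(cintZ _ cg) -(cintB ck c0) -(cintB (cont_onB ck c0) ckg).
apply: le_trans (cmod_cint (M := K / 2 * cmod k ^+ 2) _ _ _) _.
- by rewrite add0r ltW.
- exact: cont_onB (cont_onB ck c0) ckg.
- move=> t _.
  have -> : (f (a + k + polar r t) - f (a + k)) * polar r^-1 (- t) -
      (f (a + polar r t) - f a) * polar r^-1 (- t) - k * g t =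
     ((f (a + k + polar r t) - f (a + polar r t) -
        df (a + polar r t) * ((a + k + polar r t) - (a + polar r t))) -
      (f (a + k) - f a - df a * (a + k - a))) * polar r^-1 (- t) by rewrite /g; ring.
  rewrite cmodM cmod_polar normfV gtr0_norm // ler_pdivrMr //.
  apply: le_trans (cmodB _ _) _.
  have := T1 _ _ (in1 t) (in2 t); have := T1 _ _ a1 ak.
  have -> : a + k - a = k by ring.
  have -> : a + k + polar r t - (a + polar r t) = k by ring.
  have -> : K / 2 * cmod k ^+ 2 * r = (K * r) / 2 * cmod k ^+ 2 by ring.
  rewrite -KC; move: (cmod (_ - _)) (cmod (_ - _)) => u v; lra.
- rewrite add0r subr0 mulrC -mulrA ler_pM2l // expr2.
  have := ler_wpM2r k0 (ltW k2); move: p2; clear -k0 K0; nra.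
Qed.

End Circles.

(** * Primitives and logarithms on a disc *)

Section Holomorphic.
Context {R : realType}.
Local Notation C := (Cplx R).
Local Notation ii := (0 +i* 1 : C).
Implicit Types (f df g : C -> C) (a z w h l : C) (r s t al : R).

Lemma derivable_cder f z : derivable f z 1 -> cder f z (derive1 f z).
Proof. by move=> /derivableP; rewrite -derive1E => /cderP. Qed.

Lemma cder_derivable f z l : cder f z l -> derivable f z 1.
Proof. by move=> /cderP[]. Qed.

Lemma cder_derive1 f z l : cder f z l -> derive1 f z = l.
Proof. by move=> /cderP[_]; rewrite -derive1E. Qed.

Lemma disc_deriv f df a r : (forall z, cmod (z - a) < r -> cder f z (df z)) ->
  forall z, cmod (z - a) < r -> exists l, cder df z l.
Proof.
move=> hf z za; apply: (@deriv_holomorphic _ f df z (r - cmod (z - a))).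
  by rewrite subr_gt0.
move=> w wz; apply: hf; have -> : w - a = (w - z) + (z - a) by ring.
by apply: le_lt_trans (cmodD _ _) _; lra.
Qed.

Lemma exists_polar z : exists2 t : R, 0 <= t <= 2 * pi & z = polar (cmod z) t.
Proof.
have p0 := @pi_ge0 R.
have [->|z0] := eqVneq z 0.
  exists 0; first by rewrite lexx mulr_ge0.
  by apply: complexP; rewrite !polarE cmod0 mul0r.
have c0 : 0 < cmod z by rewrite cmod_gt0.
pose x := complex.Re z / cmod z.
have x1 : -1 <= x <= 1.
  by rewrite -ler_norml normrM normfV (ger0_norm (cmod_ge0 _)) ler_pdivrMr // mul1r cmod_Re.
have sx : Num.sqrt (1 - x ^+ 2) = `|complex.Im z| / cmod z.
  have -> : 1 - x ^+ 2 = (complex.Im z / cmod z) ^+ 2.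
    rewrite /x !exprMn !exprVn.
    have -> : (complex.Im z) ^+ 2 = cmod z ^+ 2 - complex.Re z ^+ 2.
      by rewrite sqr_cmod addrAC subrr add0r.
    by field; rewrite gt_eqF.
  by rewrite sqrtr_sqr normrM normfV (ger0_norm (cmod_ge0 _)).
have Rz : complex.Re z = cmod z * x by rewrite /x mulrC divfK // gt_eqF.
have [I0|I0] := leP 0 (complex.Im z).
  exists (acos x); first by rewrite acos_ge0 //= (le_trans (acos_lepi x1)) //; lra.
  apply: complexP; rewrite !polarE; first by rewrite acosK.
  by rewrite sin_acos // sx ger0_norm // mulrC divfK // gt_eqF.
exists (2 * pi - acos x).
  by have := acos_ge0 x1; have := acos_lepi x1; move=> ? ?; apply/andP; split; lra.
rewrite addrC polar_periodic.
apply: complexP; rewrite !polarE ?cosN ?sinN; first by rewrite acosK.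
by rewrite sin_acos // sx ltr0_norm // mulNr opprK mulrC divfK // gt_eqF.
Qed.

Lemma polar_lip r s t u : cmod (polar s u - polar r t : C) <= `|s - r| + 2 * `|r| * `|u - t|.
Proof.
have -> : polar s u - polar r t = polar (s - r) u + (polar r u - polar r t) :> C.
  by apply: complexP; rewrite !polarE; ring.
apply: le_trans (cmodD _ _) _; rewrite cmod_polar lerD2l.
have ii1 : cmod ii = 1 by rewrite cmodE /= expr0n expr1n add0r sqrtr1.
have H (v w : R) : v <= w -> cmod (polar r w - polar r v : C) <= 2 * `|r| * (w - v).
  move=> vw; apply: (rder_mvt vw (fun t _ => rder_polar_arg r t)) => x _.
  by rewrite cmodM ii1 mul1r cmod_polar.
have [tu|ut] := leP t u; first by rewrite (@ger0_norm _ (u - t)) ?subr_ge0 // H.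
by rewrite cmodBC distrC (@ger0_norm _ (t - u)) ?subr_ge0 ?H // ltW.
Qed.

Lemma rect_bounded (g : R -> R -> C) (a1 b1 c1 d1 : R) : a1 <= b1 -> c1 <= d1 ->
  (forall x y, a1 <= x <= b1 -> c1 <= y <= d1 -> exists d B : R, 0 < d /\
    forall x' y', a1 <= x' <= b1 -> c1 <= y' <= d1 -> `|x' - x| < d -> `|y' - y| < d ->
     cmod (g x' y') <= B) ->
  exists B : R, forall x y, a1 <= x <= b1 -> c1 <= y <= d1 -> cmod (g x y) <= B.
Proof.
move=> ab cd H.
apply: (@rect_induction _ (fun I J => exists B : R, forall x y, I.1 <= x <= I.2 ->
   J.1 <= y <= J.2 -> cmod (g x y) <= B) (a1, b1) (c1, d1)) => //=.
  move=> [a2 b2] [c2 d2] /= h1 h2 h3 h4 h5 h6 K.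
  have [B1 K1] := K _ _ (or_introl erefl) (or_introl erefl).
  have [B2 K2] := K _ _ (or_intror erefl) (or_introl erefl).
  have [B3 K3] := K _ _ (or_introl erefl) (or_intror erefl).
  have [B4 K4] := K _ _ (or_intror erefl) (or_intror erefl).
  exists (Num.max (Num.max B1 B2) (Num.max B3 B4)) => x y /andP[x1 x2] /andP[y1 y2].
  rewrite !le_max; rewrite /= in K1 K2 K3 K4.
  have [xm|xm] := leP x ((a2 + b2) / 2); have [ym|ym] := leP y ((c2 + d2) / 2).
  - by rewrite K1 // ?x1 ?y1.
  - by rewrite [X in _ || (X || _)]K3 ?orbT // ?x1 // (ltW ym).
  - by rewrite [X in (_ || X) || _]K2 ?orbT // ?(ltW xm) // ?y1.
  - by rewrite [X in _ || (_ || X)]K4 ?orbT // ?(ltW xm) // ?(ltW ym).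
move=> x y hx hy; have [d [B [d0 dP]]] := H x y hx hy; exists d => //.
move=> [a2 b2] [c2 d2] /= h1 /andP[h2 h2'] h3 h4 /andP[h5 h5'] h6 s1 s2.
exists B => x' y' /andP[u1 u2] /andP[v1 v2]; apply: dP; try lra.
  by rewrite ltr_norml; lra.
by rewrite ltr_norml; lra.
Qed.

Lemma polar_bounded f a r1 r2 t1 t2 : 0 <= r1 -> r1 <= r2 -> t1 <= t2 ->
  (forall r t, r1 <= r <= r2 -> t1 <= t <= t2 -> {for a + polar r t, continuous f}) ->
  exists B : R, forall r t, r1 <= r <= r2 -> t1 <= t <= t2 -> cmod (f (a + polar r t)) <= B.
Proof.
move=> r10 r12 t12 cf; apply: rect_bounded => // r t hr ht.
have [d d0 dP] := (contCP f _).1 (cf r t hr ht) 1 ltr01.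
exists (d / (2 * (1 + 2 * `|r|))), (cmod (f (a + polar r t)) + 1).
have den : 0 < 2 * (1 + 2 * `|r|) by rewrite mulr_gt0 // addr_gt0 ?ltr_wpDr // mulr_ge0.
split; first by rewrite divr_gt0.
move=> r' t' _ _; rewrite !ltr_pdivlMr // => hr' ht'.
have -> : f (a + polar r' t') = f (a + polar r t) +
    (f (a + polar r t + (polar r' t' - polar r t)) - f (a + polar r t)).
  rewrite [X in f X - _](_ : _ = a + polar r' t'); last by ring.
  by rewrite [RHS]addrC subrK.
apply: le_trans (cmodD _ _) _; rewrite lerD2l; apply: dP.
apply: le_lt_trans (polar_lip _ _ _ _) _.
have := normr_ge0 r; have := normr_ge0 (r' - r); have := normr_ge0 (t' - t).
move: (`|r|) (`|r' - r|) (`|t' - t|) den hr' ht' => x y z; nra.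
Qed.

Lemma disc_bounded f a r : 0 <= r ->
  (forall z, cmod (z - a) <= r -> {for z, continuous f}) ->
  exists B : R, forall z, cmod (z - a) <= r -> cmod (f z) <= B.
Proof.
move=> r0 cf.
have [|r' t' /andP[r1 r2] _|B H] := @polar_bounded f a 0 r 0 (2 * pi) (lexx _) r0.
- by rewrite ltW // pi2_gt0.
- by apply: cf; rewrite circle_sub cmod_polar ger0_norm.
exists B => z za; have [t t2 E] := exists_polar (z - a).
have -> : z = a + polar (cmod (z - a)) t by rewrite -E addrC subrK.
by apply: H => //; rewrite cmod_ge0.
Qed.

Lemma cont_segment f z w (r1 r2 : R) :
  (forall t, r1 <= t <= r2 -> {for z + t%:C * w, continuous f}) ->
  cont_on r1 r2 (fun t => f (z + t%:C * w)).
Proof.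
move=> cf t /cf ft; apply: (@continuous_comp _ _ _ (fun t : R => z + t%:C * w) f); last exact: ft.
exact: rder_cont (rder_line _ _ _).
Qed.

Lemma cmod_scale t z : 0 <= t <= 1 -> cmod (t%:C * z) <= cmod z.
Proof.
move=> /andP[t0 t1]; rewrite cmodM cmod_real ger0_norm //.
by rewrite ler_piMl ?cmod_ge0.
Qed.

(** The primitive is the integral along the segment from the center.  At [w],
    its difference quotient is compared with the integral over [[0, 1]] of the
    derivative of [t * f (a + t (w - a))], which is [f w]. *)
Lemma disc_primitive f df a r0 : (forall z, cmod (z - a) < r0 -> cder f z (df z)) ->
  exists P : C -> C, P a = 0 /\ forall z, cmod (z - a) < r0 -> cder P z (f z).
Proof.
move=> hf; pose P w := (w - a) * cint 0 1 (fun t => f (a + t%:C * (w - a))).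
exists P; split; first by rewrite /P subrr mul0r.
move=> w wr.
(* Room around w for the derivative estimates. *)
pose d := (r0 - cmod (w - a)) / 3.
pose r1 := cmod (w - a) + d; pose r2 := cmod (w - a) + 2 * d; pose rho := d / 4.
have d0 : 0 < d by rewrite divr_gt0 // subr_gt0.
have r2r0 : r2 + d = r0 by rewrite /r2 /d; field.
have r2E : r2 = r1 + 4 * rho by rewrite /r2 /r1 /rho; field.
have wr1 : cmod (w - a) + 4 * rho = r1 by rewrite /r1 /rho; field.
have rho0 : 0 < rho by rewrite divr_gt0.
have wa0 := cmod_ge0 (w - a).
clearbody r1 r2 rho.
have [|z za|B hB] := @disc_bounded f a r2; first by lra.
  by apply: cont_disc hf _ _; lra.
have B0 : 0 <= B by apply: le_trans (cmod_ge0 (f a)) (hB _ _); rewrite subrr cmod0; lra.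
have tri z v : cmod (v - a) <= cmod (v - z) + cmod (z - a).
  by have := cmodD (v - z) (z - a); rewrite addrA subrK.
have hfz z : cmod (z - a) < r1 -> forall v, cmod (v - z) < 4 * rho -> cder f v (df v).
  by move=> za v vz; apply: hf; have := tri z v; lra.
have hBz z : cmod (z - a) < r1 -> forall v, cmod (v - z) < 4 * rho -> cmod (f v) <= B.
  by move=> za v vz; apply: hB; have := tri z v; lra.
pose M := 64 * B / rho ^+ 2.
have M0 : 0 <= M by rewrite divr_ge0 ?sqr_ge0 // mulr_ge0.
have T z v : cmod (z - a) < r1 -> cmod (v - z) < rho ->
    cmod (f v - f z - df z * (v - z)) <= 2 * M * cmod (v - z) ^+ 2.
  move=> za vz; apply: (disc_taylor1 (a := z) (r := rho)) => //.
  - by move=> u uz; apply: (hfz z) => //; lra.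
  - by apply: deriv_lipschitz (hfz z za) _ _ (hBz z za).
  - by rewrite subrr cmod0.
pose D := 4 * B / rho.
have D0 : 0 <= D by rewrite divr_ge0 ?(ltW rho0) // mulr_ge0.
have hD z : cmod (z - a) < r1 -> cmod (df z) <= D.
  move=> za; apply: cauchy_est (hfz z za) _ _ _ => //; first by lra.
  by move=> v vz; apply: (hBz z) => //; lra.
clearbody M D.
have seg t v : 0 <= t <= 1 -> cmod (a + t%:C * v - a) <= cmod v.
  by move=> t01; rewrite addrC addKr cmod_scale.
have cdf z : cmod (z - a) < r0 -> {for z, continuous df}.
  by move=> /(disc_deriv hf)[l /cder_cont].
have cseg v : cmod v < r0 -> cont_on 0 1 (fun t => f (a + t%:C * v)).
  move=> vr; apply: cont_segment => t t01; apply: cont_disc hf _ _.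
  exact: le_lt_trans (seg t v t01) vr.
have cdseg v : cmod v < r0 -> cont_on 0 1 (fun t => df (a + t%:C * v)).
  move=> vr; apply: cont_segment => t t01; apply: cdf.
  exact: le_lt_trans (seg t v t01) vr.
have cre : cont_on 0 1 (fun t : R => t%:C : C) by move=> t _; exact: rder_cont (rder_real t).
pose dg t := 1 * f (a + t%:C * (w - a)) + t%:C * (df (a + t%:C * (w - a)) * (w - a)).
have cg : cont_on 0 1 dg.
  apply: cont_onD; first exact: cont_onM (@cont_on_cst _ _ _ _ (1 : C)) (cseg _ wr).
  apply: cont_onM cre _; exact: cont_onM (cdseg _ wr) (@cont_on_cst _ _ _ _ (w - a)).
have I : cint 0 1 dg = f w.
  rewrite (cint_FTC (g := fun t => t%:C * f (a + t%:C * (w - a))) ler01 _ cg).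
    by rewrite mul0r subr0 !mul1r [a + _]addrC subrK.
  move=> t t01; apply: rderM (rder_real t) _.
  apply: rder_comp (rder_line _ _ _); apply: hf.
  exact: le_lt_trans (seg t _ t01) wr.
pose K := r0 * (2 * M) + D.
have K0 : 0 <= K by rewrite addr_ge0 // mulr_ge0 ?mulr_ge0 //; lra.
move=> e e0; exists (Num.min rho (e / (2 * K + 1))).
  by rewrite lt_min rho0 divr_gt0 // ltr_wpDl // mulr_ge0.
move=> h; rewrite lt_min => /andP[h1].
rewrite ltr_pdivlMr ?ltr_wpDl ?mulr_ge0 // => h2.
have h0 := cmod_ge0 h.
have whr : cmod (w + h - a) < r0.
  have -> : w + h - a = (w - a) + h by ring.
  by apply: le_lt_trans (cmodD _ _) _; lra.
have c1 : cont_on 0 1 (fun t => (w + h - a) * f (a + t%:C * (w + h - a))).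
  exact: cont_onM (@cont_on_cst _ _ _ _ (w + h - a)) (cseg _ whr).
have c2 : cont_on 0 1 (fun t => (w - a) * f (a + t%:C * (w - a))).
  exact: cont_onM (@cont_on_cst _ _ _ _ (w - a)) (cseg _ wr).
have c3 : cont_on 0 1 (fun t => h * dg t).
  exact: cont_onM (@cont_on_cst _ _ _ _ h) cg.
have -> : P (w + h) - P w - f w * h =
   cint 0 1 (fun t => (w + h - a) * f (a + t%:C * (w + h - a)) -
     (w - a) * f (a + t%:C * (w - a)) - h * dg t).
  rewrite (cintB (cont_onB c1 c2) c3) (cintB c1 c2).
  rewrite (cintZ _ cg) (cintZ _ (cseg _ whr)) (cintZ _ (cseg _ wr)) I.
  by rewrite (mulrC (f w)).
apply: le_trans (cmod_cint (M := K * cmod h ^+ 2) ler01 (cont_onB (cont_onB c1 c2) c3) _) _.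
  move=> t t01; pose z := a + t%:C * (w - a).
  have za : cmod (z - a) < r1 by apply: le_lt_trans (seg t _ t01) _; lra.
  have th := cmod_scale h t01.
  have vz : z + t%:C * h - z = t%:C * h by ring.
  have Tz := T z (z + t%:C * h) za ltac:(rewrite vz; lra).
  rewrite vz in Tz.
  have -> : a + t%:C * (w + h - a) = z + t%:C * h by rewrite /z; ring.
  have -> : (w + h - a) * f (z + t%:C * h) - (w - a) * f (a + t%:C * (w - a)) - h * dg t =
     (w + h - a) * (f (z + t%:C * h) - f z - df z * (t%:C * h)) + h * (df z * (t%:C * h)).
    by rewrite /dg -/z; ring.
  have -> : K * cmod h ^+ 2 = r0 * (2 * M) * cmod h ^+ 2 + D * cmod h ^+ 2 by rewrite /K; ring.
  apply: le_trans (cmodD _ _) _; apply: lerD.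
    rewrite cmodM -mulrA ler_pM ?cmod_ge0 ?(ltW whr) //.
    apply: le_trans Tz _; rewrite ler_wpM2l ?mulr_ge0 //.
    by rewrite ler_sqr ?nnegrE ?cmod_ge0.
  rewrite cmodM cmodM expr2 mulrCA ler_pM ?mulr_ge0 ?cmod_ge0 ?hD //.
  by rewrite ler_wpM2l.
rewrite subr0 mulr1; move: h2 h0 K0; move: (cmod h) => x; nra.
Qed.

Lemma disc_const f a r0 : (forall z, cmod (z - a) < r0 -> cder f z 0) ->
  forall z, cmod (z - a) < r0 -> f z = f a.
Proof.
move=> hf z za; apply/eqP; rewrite -subr_eq0 -cmod_eq0; apply/eqP/le_anti.
rewrite cmod_ge0 andbT.
have aa : cmod (a - a) < r0 by rewrite subrr cmod0 (le_lt_trans _ za) // cmod_ge0.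
have := @disc_lipschitz _ f (fun=> 0) a r0 0 a z hf _ aa za.
by rewrite mulr0 mul0r; apply => v _; rewrite cmod0.
Qed.

Lemma exists_cexp z : z != 0 -> exists c : C, cexp c = z.
Proof.
move=> z0; have [t _ zE] := exists_polar z; exists (ln (cmod z) +i* t).
by rewrite cexpE lnK // posrE cmod_gt0.
Qed.

(** A zero-free holomorphic function on a disc has a holomorphic logarithm. *)
Lemma disc_log g dg a r0 c : (forall z, cmod (z - a) < r0 -> cder g z (dg z)) ->
  (forall z, cmod (z - a) < r0 -> g z != 0) -> cexp c = g a ->
  exists l : C -> C, l a = c /\ forall z, cmod (z - a) < r0 ->
    cder l z (dg z / g z) /\ cexp (l z) = g z.
Proof.
move=> hg g0 gc.
have hF z : cmod (z - a) < r0 -> exists l, cder (fun z => dg z * (g z)^-1) z l.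
  move=> za; have [l dl] := disc_deriv hg za.
  by eexists; apply: cderM dl (cderV (g0 z za) (hg z za)).
pose dF z := get [set l | cder (fun z => dg z * (g z)^-1) z l].
have {}hF z : cmod (z - a) < r0 -> cder (fun z => dg z * (g z)^-1) z (dF z).
  by move=> /hF; apply: getPex.
have [P [Pa hP]] := disc_primitive hF.
exists (fun z => c + P z); split; first by rewrite Pa addr0.
move=> z za; split.
  by rewrite -[X in cder _ _ X]add0r; apply: cderD; [exact: cder_cst|exact: hP].
have E : g z * cexp (- P z) = g a * cexp (- P a).
  apply: (disc_const (f := fun z => g z * cexp (- P z)) (r0 := r0)) za => w wa.
  have D1 := cder_comp (cderN (hP w wa)) (cder_cexp (- P w)).
  have := cderM (hg w wa) D1.
  have -> // : dg w * cexp (- P w) + g w * (cexp (- P w) * - (dg w * (g w)^-1)) = 0.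
  by field; exact: g0.
rewrite Pa oppr0 cexp0 mulr1 cexpN in E.
by rewrite cexpD gc -E divfK // cexp_neq0.
Qed.

End Holomorphic.

(** * Harnack's inequality and the derivative of an injective function *)

Section Hurwitz.
Context {R : realType}.
Local Notation C := (Cplx R).
Implicit Types (f df g : C -> C) (a b z w h : C) (r s t al K : R).

(** Complex conjugation. *)
Definition cj z : C := complex.Re z +i* - complex.Im z.

Lemma cint_cj (u v : R) (g : R -> C) : cont_on u v g ->
  cint u v (fun t => cj (g t)) = cj (cint u v g).
Proof.
move=> cg; apply: complexP => //=.
by rewrite -rintN //; exact: cont_onIm.
Qed.

(** Borel-Caratheodory estimate at the center of a disc: the derivative of
    [l] is controlled by an upper bound [K] for [Re l].  It holds because
    [l - l z] may be replaced by twice its real part in Cauchy's formula. *)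
Lemma re_gradient (l dl : C -> C) z r0 r K :
  (forall w, cmod (w - z) < r0 -> cder l w (dl w)) -> 0 < r -> r < r0 ->
  (forall w, cmod (w - z) < r0 -> complex.Re (l w) <= K) ->
  cmod (dl z) <= 8 * (K - complex.Re (l z)) / r.
Proof.
move=> hl r_gt0 rr0 lK.
have zz : cmod (z - z) < r0 by rewrite subrr cmod0; lra.
have p2 := @pi2_gt0 R.
pose q t := l (z + polar r t) - l z.
have inD t : cmod (z + polar r t - z) < r0.
  by rewrite circle_sub cmod_polar gtr0_norm.
have cl : cont_on 0 (0 + 2 * pi) (fun t => l (z + polar r t)).
  by apply: cont_circle => t; exact: cont_disc hl _ (inD t).
have cq : cont_on 0 (0 + 2 * pi) q.
  exact: cont_onB cl (@cont_on_cst _ _ _ _ (l z)).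
have cp : cont_on 0 (0 + 2 * pi) (polar r : R -> C).
  by move=> t _; exact: continuous_polar.
have ci := @cont_inv_circle R r 0 (0 + 2 * pi).
have hle w : cmod (w - z) < r0 -> exists m, cder l w m by move=> /hl; exists (dl w).
have E1 := cauchy_deriv 0 hle (hl z zz) r_gt0 rr0.
have E2 : cint 0 (0 + 2 * pi) (fun t => q t * polar r t) = 0.
  have D w : cmod (w - z) < r0 -> exists m, cder (fun w => (l w - l z) * (w - z)) w m.
    move=> wz; eexists; apply: cderM (cderB (hl w wz) (cder_cst _ _)) _.
    by apply: cderB; [exact: cder_id|exact: cder_cst].
  have := @mean_value _ (fun w => (l w - l z) * (w - z)) z r0 r 0 _ _ r_gt0 rr0.
  rewrite subrr mul0r mulr0 => <-.
  - by apply: eq_cint => t _; rewrite circle_sub.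
  - by move=> w /andP[_ /D].
  - by have [m /cder_cont] := D z zz.
(* On the circle, 1 / (r e^(it)) is the conjugate of r e^(it) / r^2, so E3 is the
   conjugate of E2. *)
have E3 : cint 0 (0 + 2 * pi) (fun t => cj (q t) * polar r^-1 (- t)) = 0.
  have -> : 0 = ((r ^+ 2)^-1)%:C * cj (cint 0 (0 + 2 * pi) (fun t => q t * polar r t)) :> C.
    by rewrite E2; apply: complexP; rewrite !ReImE; ring.
  rewrite -(cint_cj (cont_onM cq cp)) -cintZ.
    apply: eq_cint => t _; apply: complexP; rewrite !polarE cosN sinN; field; by rewrite gt_eqF.
  move=> t tt; have cc := cont_onM cq cp.
  have c1 := cont_onRe cc tt; have c2 := cont_onIm cc tt.
  apply: (@cvg_complex R R (nbhs t)); first exact: c1.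
  by apply: cvgN; exact: c2.
have ccj : cont_on 0 (0 + 2 * pi) (fun t => cj (q t)).
  move=> t tt; have c1 := cont_onRe cq tt; have c2 := cont_onIm cq tt.
  apply: (@cvg_complex R R (nbhs t)); first exact: c1.
  by apply: cvgN; exact: c2.
have E4 : (2 * pi)%:C * dl z =
    cint 0 (0 + 2 * pi) (fun t => (2 * complex.Re (q t))%:C * polar r^-1 (- t)).
  rewrite -E1 -[LHS]addr0 -E3 -(cintD (cont_onM cq ci) (cont_onM ccj ci)).
  apply: eq_cint => t _; rewrite -mulrDl; congr (_ * _).
  by apply: complexP; rewrite !ReImE; ring.
(* v is nonnegative and harmonic, so its circle mean is v z. *)
pose v w := K - complex.Re (l w).
have v0 w : cmod (w - z) < r0 -> 0 <= v w by move=> /lK; rewrite subr_ge0.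
have cRe := cont_onRe cl.
have cv : cont_on 0 (0 + 2 * pi) (fun t => v (z + polar r t)).
  by move=> t tt; apply: continuousB; [exact: cvg_cst|exact: cRe].
have Iv : rint 0 (0 + 2 * pi) (fun t => v z + v (z + polar r t)) = 2 * (2 * pi) * v z.
  have pp : 0 <= 0 + 2 * pi :> R by rewrite add0r ltW.
  rewrite (rintD (@cont_on_cst _ _ _ _ (v z)) cv) rint_cst //.
  rewrite (rintB (@cont_on_cst _ _ _ _ K) cRe) rint_cst //.
  have := @mean_value _ l z r0 r 0 _ (cder_cont (hl z zz)) r_gt0 rr0.
  move=> /(_ _)/(congr1 (@complex.Re R)).
  rewrite !ReImE mul0r subr0 => ->; last by move=> w /andP[_ /hle].
  by rewrite /v add0r subr0; ring.
rewrite -(ler_pM2l p2) -{1}[2 * pi]gtr0_norm // -cmod_real -cmodM E4.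
have cc : cont_on 0 (0 + 2 * pi) (fun t => (2 * complex.Re (q t))%:C * polar r^-1 (- t) : C).
  apply: cont_onM ci => t tt; apply: (@cvg_complex R R (nbhs t)); last exact: cvg_cst.
  by apply: cvgM; [exact: cvg_cst|exact: (cont_onRe cq tt)].
apply: le_trans (cmod_cint_int cc) _.
have -> : 2 * pi * (8 * (K - complex.Re (l z)) / r) =
  2 * ((2 / r) * rint 0 (0 + 2 * pi) (fun t => v z + v (z + polar r t))).
  by rewrite Iv /v; move: (2 * pi) => P; field; rewrite gt_eqF.
have cvv : cont_on 0 (0 + 2 * pi) (fun t => v z + v (z + polar r t)).
  by move=> t tt; apply: continuousD; [exact: cvg_cst|exact: cv].
rewrite ler_pM2l // -(rintZ _ cvv); apply: le_rint.
- exact: cont_on_cmod.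
- by move=> t tt; apply: continuousM; [exact: cvg_cst|exact: cvv].
move=> t _; rewrite cmodM cmod_polar cmod_real normrM normfV (@gtr0_norm _ r) // (@ger0_norm _ 2) //.
have -> : complex.Re (q t) = v z - v (z + polar r t) by rewrite /q /v !ReImE; ring.
rewrite mulrAC ler_pM2l ?divr_gt0 //.
apply: le_trans (ler_normB _ _) _; rewrite !ger0_norm ?v0 //.
Qed.

(** Harnack's inequality for the nonnegative harmonic function [K - Re l]. *)
Lemma re_harnack (l dl : C -> C) a b r0 K :
  (forall w, cmod (w - b) < r0 -> cder l w (dl w)) -> 0 < r0 ->
  (forall w, cmod (w - b) < r0 -> complex.Re (l w) <= K) ->
  cmod (a - b) <= r0 / 2 ->
  K - complex.Re (l a) <= expR 16 * (K - complex.Re (l b)).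
Proof.
move=> hl r00 lK ab.
pose z t := b + t%:C * (a - b).
have zb t : 0 <= t <= 1 -> cmod (z t - b) <= r0 / 2.
  by move=> t01; rewrite /z addrC addKr (le_trans (cmod_scale _ t01)).
(* By re_gradient, K - Re l increases along the segment at most like exp (16 t). *)
pose V t := (K - complex.Re (l (z t))) * expR (- 16 * t).
pose dV t := (- complex.Re (dl (z t) * (a - b))) * expR (- 16 * t) +
   (K - complex.Re (l (z t))) * (- 16 * expR (- 16 * t)).
have D t : 0 <= t <= 1 -> is_derive t 1 V (dV t).
  move=> t01; have hz : cmod (z t - b) < r0 by have := zb t t01; lra.
  have D1 := rder_Re (rder_comp (hl _ hz) (rder_line b (a - b) t)).
  have D2 : is_derive t 1 (fun t => expR (- 16 * t)) (- 16 * expR (- 16 * t)).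
    by apply: is_derive_eq; rewrite /GRing.scale /= mulr1 mulrC.
  by apply: is_derive_eq; rewrite /dV /GRing.scale /=; ring.
have dV0 t : 0 <= t <= 1 -> dV t <= 0.
  move=> t01; have hz := zb t t01.
  have G := @re_gradient l dl (z t) (r0 / 2) (r0 / 4) K.
  have {}G : cmod (dl (z t)) <= 8 * (K - complex.Re (l (z t))) / (r0 / 4).
    have tri w : cmod (w - z t) < r0 / 2 -> cmod (w - b) < r0.
      move=> wz; have -> : w - b = (w - z t) + (z t - b) by ring.
      by apply: le_lt_trans (cmodD _ _) _; lra.
    by apply: G => [w /tri/hl|||w /tri/lK] //; lra.
  have e0 := expR_gt0 (- 16 * t).
  rewrite /dV mulrCA mulrA -mulrDl pmulr_lle0 //.
  have := cmod_Re (dl (z t) * (a - b)); rewrite ler_norml => /andP[+ _].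
  rewrite cmodM; have := ler_pM (cmod_ge0 _) (cmod_ge0 _) G ab.
  have -> : 8 * (K - complex.Re (l (z t))) / (r0 / 4) * (r0 / 2) =
     16 * (K - complex.Re (l (z t))) by field; rewrite gt_eqF.
  by lra.
have [||c c01 E] := @MVT_segment _ V dV 0 1 ler01.
- by move=> x; rewrite in_itv /= => /andP[x0 x1]; apply: D; rewrite !ltW.
- by apply: cont_on_within => t /D /is_derive_cont.
have : V 1 <= V 0.
  by rewrite -subr_le0 E subr0 mulr1; apply: dV0; move: c01; rewrite in_itv.
rewrite /V /z mul1r mul0r addr0 mulr0 mulr1 expR0 mulr1 [b + _]addrC subrK.
by rewrite expRN ler_pdivrMr ?expR_gt0 // mulrC.
Qed.

(** An injective holomorphic function has a non-vanishing derivative.  Its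
    difference quotients with a fixed small step have no zeros, and Harnack's
    inequality for the logarithm of their moduli prevents them from being
    much smaller at [a] than at a nearby point [b] where [df b != 0]. *)
Theorem inj_deriv_neq0 f df a r0 : 0 < r0 ->
  (forall z, cmod (z - a) < r0 -> cder f z (df z)) ->
  (forall z w, cmod (z - a) < r0 -> cmod (w - a) < r0 -> f z = f w -> z = w) ->
  df a != 0.
Proof.
move=> r00 hf inj; apply/negP => /eqP dfa.
pose r1 := r0 / 8; have r10 : 0 < r1 by rewrite divr_gt0.
have r01 : r0 = 8 * r1 by rewrite /r1; field.
clearbody r1; subst r0.
(* Otherwise f would be constant near a. *)
have [b [ba dfb]] : exists b, cmod (b - a) < r1 /\ df b != 0.
  apply: contrapT => H.
  have Z z : cmod (z - a) < r1 -> cder f z 0.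
    move=> za; have <- : df z = 0; last by apply: hf; lra.
    by apply: contrapT => /eqP dz; apply: H; exists z.
  have ar : cmod (a + (r1 / 2)%:C - a) = r1 / 2.
    by rewrite addrC addKr cmod_real gtr0_norm // divr_gt0.
  have E := disc_const Z (z := a + (r1 / 2)%:C) ltac:(rewrite ar; lra).
  have := inj _ _ _ _ E; rewrite ar subrr cmod0.
  move=> /(_ ltac:(lra) ltac:(lra))/(congr1 (fun x => cmod (x - a))).
  by rewrite ar subrr cmod0; lra.
have [|z za|B hB] := @disc_bounded _ df a (4 * r1); first by lra.
  have [|l /cder_cont //] := disc_deriv hf (z := z); lra.
have B0 : 0 <= B by apply: le_trans (cmod_ge0 (df a)) (hB a _); rewrite subrr cmod0; lra.
have hf4 z : cmod (z - a) < 4 * r1 -> cder f z (df z) by move=> za; apply: hf; lra.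
have hB4 z : cmod (z - a) < 4 * r1 -> cmod (df z) <= B by move=> za; apply: hB; lra.
have Lip := disc_lipschitz hf4 hB4.
have tri z : cmod (z - b) < 2 * r1 -> cmod (z - a) < 3 * r1.
  move=> zb; have -> : z - a = (z - b) + (b - a) by ring.
  by apply: le_lt_trans (cmodD _ _) _; lra.
pose K := ln (2 * B).
have db0 : 0 < cmod (df b) by rewrite cmod_gt0.
(* If df a = 0, the quotient q with small step h is so small at a that
   Harnack's inequality between a and b fails. *)
pose L := K - expR 16 * (K - ln (cmod (df b) / 2)).
have e0 : 0 < expR (L - 1) by exact: expR_gt0.
have aa : cmod (a - a) < 8 * r1 by rewrite subrr cmod0; lra.
have hb : cmod (b - a) < 8 * r1 by lra.
have [d1 d10 H1] := hf a aa _ e0.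
have d20 : 0 < cmod (df b) / 2 by rewrite divr_gt0.
have [d2 d20' H2] := hf b hb _ d20.
pose d := Num.min (r1 / 2) (Num.min (d1 / 2) (d2 / 2)).
have d0 : 0 < d by rewrite !lt_min !divr_gt0.
have dr1 : d < r1 by apply: (@le_lt_trans _ _ (r1 / 2)); [rewrite ge_min lexx|lra].
have dd1 : d < d1.
  by apply: (@le_lt_trans _ _ (d1 / 2)); [rewrite !ge_min lexx orbT|lra].
have dd2 : d < d2.
  by apply: (@le_lt_trans _ _ (d2 / 2)); [rewrite !ge_min lexx !orbT|lra].
clearbody d.
pose h : C := d%:C.
have hE : cmod h = d by rewrite cmod_real gtr0_norm.
have h0 : h != 0 by rewrite -cmod_gt0 hE.
pose q z := (f (z + h) - f z) * h^-1.
pose dq z := (df (z + h) - df z) * h^-1.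
have zh z : cmod (z - b) < 2 * r1 -> cmod (z + h - a) < 4 * r1.
  move=> /tri za; have -> : z + h - a = (z - a) + h by ring.
  by apply: le_lt_trans (cmodD _ _) _; lra.
have hq z : cmod (z - b) < 2 * r1 -> cder q z (dq z).
  move=> zb; have za := tri z zb; have zha := zh z zb.
  have Da : cder (fun z => z + h) z 1.
    by rewrite -[X in cder _ _ X]addr0; apply: cderD; [exact: cder_id|exact: cder_cst].
  have D1 := cder_comp Da (hf4 _ zha).
  have D2 := cderM (cderB D1 (hf4 z ltac:(lra))) (cder_cst h^-1 z).
  by rewrite mulr1 mulr0 addr0 in D2.
have q0 z : cmod (z - b) < 2 * r1 -> q z != 0.
  move=> zb; rewrite mulf_neq0 ?invr_eq0 // subr_eq0; apply/eqP => E.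
  have := inj _ _ _ _ E; have := tri z zb; have := zh z zb => u1 u2.
  move=> /(_ ltac:(lra) ltac:(lra))/eqP; rewrite -subr_eq0 addrAC subrr add0r.
  by rewrite (negbTE h0).
have qB z : cmod (z - b) < 2 * r1 -> cmod (q z) <= 2 * B.
  move=> zb; rewrite cmodM cmodV ler_pdivrMr ?cmod_gt0 //.
  have za := tri z zb; have zha := zh z zb.
  have := Lip z (z + h) ltac:(lra) ltac:(lra).
  by rewrite [z + h - z]addrC addKr.
have bb : cmod (b - b) < 2 * r1 by rewrite subrr cmod0; lra.
have ab : cmod (a - b) < 2 * r1 by rewrite cmodBC; lra.
have [c cE] := exists_cexp (q0 b bb).
have [l [_ hl]] := disc_log hq q0 cE.
have lnq z : cmod (z - b) < 2 * r1 -> complex.Re (l z) = ln (cmod (q z)).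
  by move=> /hl[_ <-]; rewrite cmod_cexp expRK.
have BB : 0 < 2 * B by apply: lt_le_trans (qB b bb); rewrite cmod_gt0 q0.
have lK z : cmod (z - b) < 2 * r1 -> complex.Re (l z) <= K.
  by move=> zb; rewrite lnq // ler_ln ?posrE ?cmod_gt0 ?q0 ?qB.
have := @re_harnack l (fun z => dq z / q z) a b (2 * r1) K _ _ lK _.
move=> /(_ _ ltac:(lra) ltac:(rewrite cmodBC; lra)) H.
have {}H := H (fun z zb => (hl z zb).1).
rewrite !lnq // in H.
have Qa : cmod (q a) <= expR (L - 1).
  rewrite cmodM cmodV ler_pdivrMr ?cmod_gt0 // hE.
  by have := H1 h; rewrite hE dfa mul0r subr0; exact.
have Qb : cmod (df b) / 2 <= cmod (q b).
  rewrite cmodM cmodV ler_pdivlMr ?cmod_gt0 //.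
  have := H2 h; rewrite hE => /(_ dd2).
  have := cmodB (f (b + h) - f b) (f (b + h) - f b - df b * h).
  rewrite opprB [X in cmod X]addrC subrK cmodM hE; lra.
have La : ln (cmod (q a)) <= L - 1.
  by rewrite -[L - 1]expRK ler_ln ?posrE ?cmod_gt0 ?q0 // expR_gt0.
have Lb : ln (cmod (df b) / 2) <= ln (cmod (q b)).
  by rewrite ler_ln ?posrE ?cmod_gt0 ?q0.
have : expR 16 * (K - ln (cmod (q b))) <= expR 16 * (K - ln (cmod (df b) / 2)).
  by rewrite ler_pM2l ?expR_gt0 //; lra.
by move: La H; rewrite /L; lra.
Qed.

End Hurwitz.

(** * The logarithm of the derivative of a conformal map *)

Section LogDerivative.
Context {R : realType}.
Local Notation C := (Cplx R).
Implicit Types (phi L : C -> C) (z w : C).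

Lemma extdisk_disc z w : extdisk z -> cmod (w - z) < cmod z - 1 -> extdisk w.
Proof.
rewrite /extdisk /= => z1 wz; have := cmodD (z - w) w; rewrite subrK.
by rewrite (cmodBC z w); lra.
Qed.

Lemma conformal_deriv phi z : conformal_on extdisk phi -> extdisk z ->
  [/\ cder phi z (derive1 phi z), derive1 phi z != 0 &
      cder (derive1 phi) z (derive1 (derive1 phi) z)].
Proof.
move=> [hol inj] z1.
have hz w : extdisk w -> cder phi w (derive1 phi w) by move=> /hol/derivable_cder.
have hd w : cmod (w - z) < cmod z - 1 -> cder phi w (derive1 phi w).
  by move=> /(extdisk_disc z1)/hz.
have r0 : 0 < cmod z - 1 by rewrite subr_gt0.
split; first exact: hz.
  apply: (inj_deriv_neq0 r0 hd) => u v /(extdisk_disc z1) u1 /(extdisk_disc z1) v1.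
  by apply: inj; rewrite inE.
have [l dl] := deriv_holomorphic r0 hd.
by rewrite (cder_derive1 dl).
Qed.

(** Cauchy's estimate for [phi z - z] on the disc of radius [|z| / 4]. *)
Lemma deriv_at_infinity phi (A r : R) : conformal_on extdisk phi ->
  (forall z, r < cmod z -> cmod (phi z - z) <= A / cmod z) ->
  forall z, 2 * Num.max 1 r < cmod z ->
  cmod (derive1 phi z - 1) <= 32 * `|A| / cmod z ^+ 2.
Proof.
move=> cphi hA z zr.
have m1 : 1 <= Num.max 1 r by rewrite le_max lexx.
have mr : r <= Num.max 1 r by rewrite le_max lexx orbT.
move: (Num.max 1 r) m1 mr zr => m m1 mr zr.
have z0 : 0 < cmod z by lra.
have far w : cmod (w - z) < cmod z / 2 -> m < cmod w /\ cmod z / 2 <= cmod w.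
  move=> wz; have := cmodD (z - w) w; rewrite subrK (cmodBC z w); lra.
have hd w : cmod (w - z) < cmod z / 2 -> cder (fun w => phi w - w) w (derive1 phi w - 1).
  move=> /far[wm _]; apply: cderB (cder_id w).
  have w1 : extdisk w by exact: le_lt_trans m1 wm.
  by have [] := conformal_deriv cphi w1.
have hB w : cmod (w - z) <= cmod z / 4 -> cmod (phi w - w) <= 2 * `|A| / cmod z.
  move=> wz; have [wm wz2] := far w ltac:(lra).
  apply: le_trans (hA w _) _; first lra.
  have w0 : 0 < cmod w by lra.
  rewrite ler_pdivrMr // mulrAC ler_pdivlMr //.
  by have := ler_norm A; have := normr_ge0 A; nra.
have := cauchy_est hd (r := cmod z / 4) _ _ hB.
have -> : 4 * (2 * `|A| / cmod z) / (cmod z / 4) = 32 * `|A| / cmod z ^+ 2.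
  by field; rewrite gt_eqF.
by apply; lra.
Qed.

(** The function [phi' (1 / w)] extends holomorphically to the unit disc with
    value 1 at 0 and has no zero there; its logarithm on the disc is
    transported back by [z |-> 1 / z]. *)
Lemma exists_log_derive k phi : Sigma_ k phi -> exists L, is_log_derive phi L.
Proof.
move=> [cphi [A [r hA]] _].
have dinf := deriv_at_infinity cphi hA.
pose m := 2 * Num.max 1 r.
have m0 : 0 < m by rewrite mulr_gt0 // lt_max ltr01.
pose g (w : C) : C := if w == 0 then 1 else derive1 phi w^-1.
have ext w : w != 0 -> cmod w < 1 -> extdisk w^-1.
  by move=> w0 w1; rewrite /extdisk /= cmodV invf_gt1 // cmod_gt0.
pose dg (w : C) : C := if w == 0 then 0 else derive1 (derive1 phi) w^-1 * (- 1 / w ^+ 2).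
have hg w : cmod (w - 0) < 1 -> cder g w (dg w).
  rewrite subr0 /dg; have [-> _|w0 w1] := eqVneq w 0.
    move=> e e0.
    exists (Num.min m^-1 (e / (32 * `|A| + 1))).
      by rewrite lt_min invr_gt0 m0 divr_gt0 // ltr_wpDl // mulr_ge0.
    move=> h; rewrite lt_min ltr_pdivlMr ?ltr_wpDl ?mulr_ge0 // => /andP[h1 h2].
    rewrite mul0r subr0 add0r /g eqxx; have [->|h0] := eqVneq h 0.
      by rewrite subrr cmod0 mulr0.
    have hp : 0 < cmod h by rewrite cmod_gt0.
    have := dinf h^-1; rewrite cmodV -/m => /(_ _).
    rewrite -[X in X < _ -> _]invrK ltf_pV2 ?posrE ?invr_gt0 // => /(_ h1) H.
    apply: le_trans H _; rewrite exprVn invrK expr2 mulrA ler_wpM2r ?(ltW hp) //.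
    by rewrite mulrC; move: h2; rewrite mulrDr; lra.
  have [_ _ d2] := conformal_deriv cphi (ext w w0 w1).
  have D1 := cder_comp (cderV w0 (cder_id w)) d2.
  apply: cder_ext D1; first by rewrite -cmod_gt0 in w0; exact: w0.
  move=> h hw; rewrite /g ifN //; apply/eqP => E.
  by move: hw; rewrite -(addKr w h) E addr0 cmodN ltxx.
have g0 w : cmod (w - 0) < 1 -> g w != 0.
  rewrite subr0 /g; have [_ _|w0 w1] := eqVneq w 0; first exact: oner_neq0.
  by have [] := conformal_deriv cphi (ext w w0 w1).
have c1 : cexp (0 : C) = g 0 by rewrite cexp0 /g eqxx.
have [l [l0 hl]] := disc_log hg g0 c1.
have inv z : extdisk z -> z != 0 /\ cmod (z^-1 - 0) < 1.
  rewrite /extdisk /= => z1; have z0 : z != 0 by rewrite -cmod_gt0 (lt_trans ltr01).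
  by split=> //; rewrite subr0 cmodV invf_lt1 // cmod_gt0.
exists (fun z => l z^-1); split.
- move=> z z1; have [z0 zi] := inv z z1.
  apply: cder_derivable; apply: cder_comp (cderV z0 (cder_id z)) _.
  exact: (hl _ zi).1.
- move=> z z1; have [z0 zi] := inv z z1.
  by rewrite (hl _ zi).2 /g invr_eq0 (negbTE z0) invrK.
- move=> e e0; have z1 : cmod (0 - 0 : C) < 1 by rewrite subr0 cmod0.
  have e2 : 0 < e / 2 by rewrite divr_gt0.
  have [d d0 dP] := (contCP l 0).1 (cder_cont (hl 0 z1).1) _ e2.
  exists d^-1 => z zd; have := dP z^-1; rewrite add0r l0 subr0 cmodV => H.
  have zp : 0 < cmod z by apply: lt_trans zd; rewrite invr_gt0.
  apply: le_lt_trans (H _) _; last by lra.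
  by rewrite -[X in _ < X]invrK ltf_pV2 ?posrE ?invr_gt0.
Qed.

Lemma log_deriveP k phi : Sigma_ k phi -> is_log_derive phi (log_derive phi).
Proof. by move=> /exists_log_derive/getPex. Qed.

Lemma cder_log_derive k phi z : Sigma_ k phi -> extdisk z ->
  cder (log_derive phi) z (nonlinearity phi z) /\
  exists l, cder (nonlinearity phi) z l.
Proof.
move=> S; have [holL expL _] := log_deriveP S.
have [cphi _ _] := S.
have key w : extdisk w -> cder (log_derive phi) w (nonlinearity phi w).
  move=> w1; have dL := derivable_cder (holL w w1).
  have [_ n0 d2] := conformal_deriv cphi w1.
  have D := cder_comp dL (cder_cexp _).
  have r0 : 0 < cmod w - 1 by rewrite subr_gt0.
  have D' : cder (derive1 phi) w (cexp (log_derive phi w) * derive1 (log_derive phi) w).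
    apply: cder_ext r0 _ D => h hw; apply: expL; apply: (extdisk_disc w1).
    by rewrite addrC addKr.
  have E := cder_uniq D' d2.
  by rewrite /nonlinearity -E expL // mulrAC divff // mul1r.
move=> z1; split; first exact: key.
apply: (@deriv_holomorphic _ (log_derive phi) _ _ (cmod z - 1)).
  by rewrite subr_gt0.
by move=> w /(extdisk_disc z1); exact: key.
Qed.

End LogDerivative.

(** * Area integrals in polar coordinates *)

Section PlaneMeasure.
Context {R : realType}.
Local Notation C := (Cplx R).
Local Notation mu := (@lebesgue_measure R).
Local Notation area := (@lebesgue_measure R \x @lebesgue_measure R)%E.

Lemma open_measurable_prod (U : set (R * R)) : open U -> measurable U.
Proof.
move=> oU.
pose rect (q : (rat * rat) * (rat * rat)) : set (R * R) :=
  `]ratr q.1.1, ratr q.1.2[%classic `*` `]ratr q.2.1, ratr q.2.2[%classic.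
pose F q := if pselect (rect q `<=` U) then rect q else set0.
have -> : U = \bigcup_q F q.
  apply/seteqP; split => [[x y] Uxy|z [q _]]; last first.
    by rewrite /F; case: pselect => // h; exact: h.
  have rat_around (u e : R) : 0 < e -> exists a b : rat,
      [/\ u - e < ratr a, ratr a < u, u < ratr b & ratr b < u + e].
    move=> e0; have h1 : u - e < u by lra.
    have h2 : u < u + e by lra.
    have [a] := rat_in_itvoo h1; rewrite in_itv /= => /andP[a1 a2].
    have [b] := rat_in_itvoo h2; rewrite in_itv /= => /andP[b1 b2].
    by exists a, b.
  have := oU; rewrite openE => /(_ _ Uxy); rewrite /interior => -[[A B] [/= nA nB] AB].
  move: nA nB => /nbhs_ballP[e1 /= e10 eA] /nbhs_ballP[e2 /= e20 eB].
  have [a1 [b1 [h1 h2 h3 h4]]] := rat_around x e1 e10.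
  have [a2 [b2 [k1 k2 k3 k4]]] := rat_around y e2 e20.
  exists ((a1, b1), (a2, b2)) => //; rewrite /F; case: pselect => [sub|].
    by split; rewrite /= in_itv /= ?h2 ?k2.
  apply; move=> [u v] [/=]; rewrite !in_itv /= => /andP[u1 u2] /andP[v1 v2].
  apply: AB; split => /=; [apply: eA|apply: eB]; rewrite /ball /= ltr_distlC.
    by rewrite (lt_trans h1 u1) (lt_trans u2 h4).
  by rewrite (lt_trans k1 v1) (lt_trans v2 k4).
apply: countable_bigcupT_measurable; first exact: countableP.
move=> q; rewrite /F; case: pselect => [sub|nsub] /=; last exact: measurable0.
by apply: measurableX; exact: measurable_itv.
Qed.

Lemma open_cont_measurable_prod (D : set (R * R)) (f : R * R -> R) : open D ->
  (forall w, D w -> {for w, continuous f}) -> measurable_fun D f.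
Proof.
move=> oD cf; apply: (measurability _ (RGenOpens.measurableE R)).
move=> _ [_ [a [b ->] <-]]; apply: open_measurable_prod.
rewrite openE => w [Dw fw]; rewrite /interior; apply: filterI.
  by move: oD; rewrite openE => /(_ _ Dw).
have := cf w Dw; rewrite /continuous_at => cfw; apply: cfw.
by apply: open_nbhs_nbhs; split => //; exact: interval_open.
Qed.

(** Both sides are integrals against measures that agree on intervals. *)
Lemma affine_substitution (a c : R) (G : R -> \bar R) : c != 0 ->
  measurable_fun [set: R] G -> (forall x, 0 <= G x)%E ->
  (\int[mu]_x G x = `|c|%:E * \int[mu]_x G (a + c * x)%R)%E.
Proof.
move=> c0 mG G0.
pose phi (x : measurableTypeR R) : measurableTypeR R := a + c * x.
have mphi : measurable_fun [set: measurableTypeR R] phi.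
  apply: continuous_measurable_fun => x.
  by apply: cvgD; [exact: cvg_cst|apply: cvgM; [exact: cvg_cst|exact: cvg_id]].
have c0' : 0 <= `|c| by [].
pose nu := mscale (NngNum c0') (measure_function_pushforward__canonical__measure_function_Measure mu mphi).
have E A : measurable A -> mu A = nu A.
  apply: lebesgue_measure_unique => _ [[u v]] _ <-.
  suff : (mu `]u, v] = `|c|%:E * mu (phi @^-1` `]u, v]))%E by [].
  have [c_gt0|c_lt0|c_eq0] := ltgtP 0 c; last by rewrite -c_eq0 eqxx in c0.
    have -> : phi @^-1` `]u, v] = `](u - a) / c, (v - a) / c]%classic.
      apply/seteqP; split => x /=; rewrite !in_itv /= /phi ltr_pdivrMr // ler_pdivlMr //;
        by move=> /andP[? ?]; apply/andP; split; lra.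
    rewrite !lebesgue_measure_itv /= !lte_fin ltr_pM2r ?invr_gt0 // ltrD2r.
    case: ifPn => _; last by rewrite mule0.
    by rewrite -EFinM; congr EFin; rewrite gtr0_norm //; field; rewrite gt_eqF.
  have -> : phi @^-1` `]u, v] = `[(v - a) / c, (u - a) / c[%classic.
    apply/seteqP; split => x /=; rewrite !in_itv /= /phi ltr_ndivlMr // ler_ndivrMr //;
      by move=> /andP[? ?]; apply/andP; split; lra.
  rewrite !lebesgue_measure_itv /= !lte_fin ltr_nM2r ?invr_lt0 // ltrD2r.
  case: ifPn => _; last by rewrite mule0.
  by rewrite -EFinM; congr EFin; rewrite ltr0_norm //; field; rewrite lt_eqF.
transitivity (\int[nu]_x G x)%E.
  by apply: eq_measure_integral => A mA _; exact: E.
rewrite /nu ge0_integral_mscale //=.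
by rewrite ge0_integral_pushforward.
Qed.

(** Area integral of a nonnegative function of a complex variable. *)
Definition aint (G : C -> \bar R) : \bar R := (\int[area]_w G (of_pair w))%E.

(** Measurability of a function of a complex variable, read on pairs of reals. *)
Definition cmeas (G : C -> \bar R) := measurable_fun [set: R * R] (fun w => G (of_pair w)).

Lemma aint_Fubini (G : C -> \bar R) : cmeas G -> (forall z, 0 <= G z)%E ->
  aint G = (\int[mu]_x \int[mu]_y G (x +i* y))%E /\
  aint G = (\int[mu]_y \int[mu]_x G (x +i* y))%E.
Proof.
move=> mG G0; split; rewrite /aint.
  by rewrite fubini_tonelli1.
by rewrite fubini_tonelli2.
Qed.

Lemma measurable_affine2 (a b c : R) : measurable_fun [set: R * R]
   (fun w : R * R => a + b * w.1 + c * w.2).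
Proof.
apply: (open_cont_measurable_prod (D := setT)); first exact: openT.
move=> w _; apply: cvgD; first apply: cvgD; first exact: cvg_cst.
  by apply: cvgM; [exact: cvg_cst|exact: cvg_fst].
by apply: cvgM; [exact: cvg_cst|exact: cvg_snd].
Qed.

Lemma cmeas_affine (G : C -> \bar R) (a b c a' b' c' : R) : cmeas G ->
  cmeas (fun z => G ((a + b * complex.Re z + c * complex.Im z) +i*
                     (a' + b' * complex.Re z + c' * complex.Im z))).
Proof.
move=> mG.
apply: (@measurableT_comp _ _ _ _ _ _ (fun w => G (of_pair w)) _
  (fun w : R * R => (a + b * w.1 + c * w.2, a' + b' * w.1 + c' * w.2))) => //.
by apply: measurable_fun_pair; exact: measurable_affine2.
Qed.

Lemma eq_cmeas (G1 G2 : C -> \bar R) : G1 =1 G2 -> cmeas G1 -> cmeas G2.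
Proof. by move=> /funext ->. Qed.

Lemma cmeas_x (G : C -> \bar R) (y : R) : cmeas G ->
  measurable_fun [set: R] (fun x => G (x +i* y)).
Proof. by move=> mG; exact: (measurable_fun_pair1 y mG). Qed.

Lemma aint_affx (G : C -> \bar R) (a b c : R) : b != 0 -> cmeas G -> (forall z, 0 <= G z)%E ->
  aint G = (`|b|%:E * aint (fun z => G ((a + b * complex.Re z + c * complex.Im z)%R +i* complex.Im z)))%E.
Proof.
move=> b0 mG G0.
pose G1 z := G ((a + b * complex.Re z + c * complex.Im z) +i* complex.Im z).
have mG1 : cmeas G1.
  by apply: eq_cmeas (cmeas_affine a b c 0 0 1 mG) => z; rewrite /= ?/G1; congr G; apply: complexP; rewrite !ReImE; ring.
rewrite (aint_Fubini mG G0).2 (aint_Fubini mG1 (fun z => G0 _)).2.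
rewrite -ge0_integralZl //=.
- apply: eq_integral => y _.
  rewrite (@affine_substitution (a + c * y) b (fun x => G (x +i* y)) b0 (cmeas_x y mG)) //.
  by congr (_ * _)%E; apply: eq_integral => x _; rewrite /G1 /= (addrAC a).
- apply: (measurable_fun_fubini_tonelli_G (m1 := mu) (fun w => G1 (of_pair w)) mG1).
  by move=> w; exact: G0.
- by move=> y _; apply: integral_ge0 => x _; exact: G0.
Qed.

Lemma cmeas_y (G : C -> \bar R) (x : R) : cmeas G ->
  measurable_fun [set: R] (fun y => G (x +i* y)).
Proof. by move=> mG; exact: (measurable_fun_pair2 x mG). Qed.

Lemma aint_affy (G : C -> \bar R) (a b c : R) : c != 0 -> cmeas G -> (forall z, 0 <= G z)%E ->
  aint G = (`|c|%:E * aint (fun z => G (complex.Re z +i* (a + b * complex.Re z + c * complex.Im z)%R)))%E.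
Proof.
move=> c0 mG G0.
pose G1 z := G (complex.Re z +i* (a + b * complex.Re z + c * complex.Im z)).
have mG1 : cmeas G1.
  by apply: eq_cmeas (cmeas_affine 0 1 0 a b c mG) => z; rewrite /= ?/G1; congr G; apply: complexP; rewrite !ReImE; ring.
rewrite (aint_Fubini mG G0).1 (aint_Fubini mG1 (fun z => G0 _)).1.
rewrite -ge0_integralZl //=.
- apply: eq_integral => x _.
  by rewrite (@affine_substitution (a + b * x) c (fun y => G (x +i* y)) c0 (cmeas_y x mG)).
- apply: (measurable_fun_fubini_tonelli_F (m2 := mu) (fun w => G1 (of_pair w)) mG1).
  by move=> w; exact: G0.
- by move=> y _; apply: integral_ge0 => x _; exact: G0.
Qed.

Lemma cmeas_lin (G : C -> \bar R) (z0 z1 : C) : cmeas G -> cmeas (fun z => G (z0 + z1 * z)).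
Proof.
move=> mG; have := cmeas_affine (complex.Re z0) (complex.Re z1) (- complex.Im z1)
   (complex.Im z0) (complex.Im z1) (complex.Re z1) mG.
rewrite /cmeas; congr (measurable_fun _ _); apply/funext => w; congr G.
by apply: complexP; rewrite !ReImE; ring.
Qed.

(** A rotation is the composite of a vertical and a horizontal shear with
    scaling, each of which is handled by Fubini and an affine substitution on
    lines. *)
Lemma aint_rotation0 (G : C -> \bar R) (t : R) : cos t != 0 -> cmeas G ->
  (forall z, 0 <= G z)%E -> aint G = aint (fun z => G (polar 1 t * z)).
Proof.
move=> c0 mG G0.
have ci : (cos t)^-1 != 0 by rewrite invr_eq0.
rewrite (@aint_affy G 0 (sin t / cos t) (cos t)^-1 ci mG G0).
set G1 := fun z => _.
have mG1 : cmeas G1.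
  by apply: eq_cmeas (cmeas_affine 0 1 0 0 (sin t / cos t) (cos t)^-1 mG) => z; rewrite /= ?/G1; congr G; apply: complexP; rewrite !ReImE; ring.
rewrite (@aint_affx G1 0 (cos t) (- sin t) c0 mG1 (fun z => G0 _)) muleA -EFinM.
rewrite -normrM mulVf // normr1 mul1e; congr aint; apply/funext => z.
congr G; apply: complexP; rewrite !polarE; first by ring.
have -> : sin t / cos t * (0 + cos t * complex.Re z + - sin t * complex.Im z) =
  sin t * complex.Re z - sin t ^+ 2 / cos t * complex.Im z by field.
by rewrite sin2cos2; field.
Qed.

(** The area measure is invariant under [z |-> z0 + polar 1 t * z].  When
    [cos t = 0], the rotation is split into two rotations by other angles. *)
Lemma aint_isometry (G : C -> \bar R) (z0 : C) (t : R) : cmeas G ->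
  (forall z, 0 <= G z)%E -> aint G = aint (fun z => G (z0 + polar 1 t * z)).
Proof.
move=> mG G0.
have -> : aint G = aint (fun z => G (z0 + z)).
  rewrite (@aint_affx G (complex.Re z0) 1 0 (oner_neq0 _) mG G0) normr1 mul1e.
  set G1 := fun z => _.
  have mG1 : cmeas G1.
    by apply: eq_cmeas (cmeas_affine (complex.Re z0) 1 0 0 0 1 mG) => z; rewrite /= ?/G1; congr G; apply: complexP; rewrite !ReImE; ring.
  rewrite (@aint_affy G1 (complex.Im z0) 0 1 (oner_neq0 _) mG1 (fun z => G0 _)) normr1 mul1e.
  congr aint; apply/funext => z; congr G; apply: complexP; rewrite !ReImE; ring.
have mG1 : cmeas (fun z => G (z0 + z)).
  by apply: eq_cmeas (cmeas_lin z0 1 mG) => z; rewrite mul1r.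
have [c0|c0] := eqVneq (cos t) 0; last first.
  by rewrite (aint_rotation0 c0 mG1 (fun z => G0 _)).
have d0 : cos (atan 1) != 0 :> R by rewrite cos_atan invr_eq0 gt_eqF // sqrtr_gt0 expr1n addr_gt0.
have e0 : cos (t - atan 1) != 0.
  rewrite cosB c0 mul0r add0r mulf_neq0 //.
    apply/negP => /eqP s0; have := cos2Dsin2 t; rewrite c0 s0 expr0n addr0.
    by move=> /esym/eqP; rewrite oner_eq0.
  have := atanK (1 : R); rewrite /tan => /(congr1 (fun x => x * cos (atan 1))).
  by rewrite divfK // mul1r => ->.
rewrite (aint_rotation0 e0 mG1 (fun z => G0 _)).
have mG2 : cmeas (fun z => G (z0 + polar 1 (t - atan 1) * z)) by exact: cmeas_lin.
rewrite (aint_rotation0 d0 mG2 (fun z => G0 _)).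
congr aint; apply/funext => z; congr G.
by rewrite mulrA polarM mulr1 subrK.
Qed.

Lemma itv_ball (x0 d x : R) : (x \in `]x0 - d, x0 + d[%R) = (`|x - x0| < d).
Proof. by rewrite in_itv /= -ltr_distlC distrC. Qed.

(** Continuity of an integral depending on a parameter. *)
Lemma cont_rint_param (h : R -> R -> R) (a b x0 d B : R) : 0 < d ->
  (forall x, `|x - x0| < d -> cont_on a b (h x)) ->
  (forall x y, `|x - x0| < d -> a <= y <= b -> `|h x y| <= B) ->
  (forall x y, `|x - x0| < d -> a <= y <= b -> {for x, continuous (fun x => h x y)}) ->
  {for x0, continuous (fun x => rint a b (h x))}.
Proof.
move=> d0 ch hB cx.
have x0I : x0 \in (`]x0 - d, x0 + d[%classic : set R).
  by rewrite inE /= itv_ball subrr normr0.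
have bI x : `]x0 - d, x0 + d[%classic x -> `|x - x0| < d by rewrite /= itv_ball.
have mab : measurable (`[a, b]%classic : set (measurableTypeR R)) by [].
have H1 x : `]x0 - d, x0 + d[%classic x -> mu.-integrable `[a, b] (EFin \o h x).
  by move=> /bI/ch; exact: cont_on_integrable.
have H2 : {ae mu, forall y, `[a, b]%classic y ->
    {in (`]x0 - d, x0 + d[%classic : set R), continuous (h^~ y)}}.
  apply: aeW => y; rewrite /= in_itv /= => yab x; rewrite inE => /bI xd.
  exact: cx.
have H3 : mu.-integrable `[a, b] (EFin \o (fun=> B)).
  by apply: cont_on_integrable; exact: cont_on_cst.
have H4 x : `]x0 - d, x0 + d[%classic x ->
    {ae mu, forall y, `[a, b]%classic y -> `|h x y| <= B}.
  by move=> /bI xd; apply: aeW => y; rewrite /= in_itv /= => yab; exact: hB.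
exact: (continuity_under_integral mab H1 H2 H3 H4 x0I).
Qed.

(** Differentiation under the integral sign. *)
Lemma derive_rint_param (h dh : R -> R -> R) (a b x0 d B : R) : 0 < d ->
  (forall x, `|x - x0| < d -> cont_on a b (h x)) ->
  (forall x y, `|x - x0| < d -> a <= y <= b -> `|dh x y| <= B) ->
  (forall x y, `|x - x0| < d -> a <= y <= b -> is_derive x 1 (fun x => h x y) (dh x y)) ->
  is_derive x0 1 (fun x => rint a b (h x)) (rint a b (dh x0)).
Proof.
move=> d0 ch hB dx.
have x0I : (`]x0 - d, x0 + d[%classic : set R) x0.
  by rewrite /= itv_ball subrr normr0.
have bI x : `]x0 - d, x0 + d[%classic x -> `|x - x0| < d by rewrite /= itv_ball.
have E x y : `|x - x0| < d -> a <= y <= b -> partial1of2 h x y = dh x y.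
  by move=> xd yab; have [_ <-] := dx x y xd yab; rewrite partial1of2E.
have B0 y : 0 <= `|B| :> R by [].
have H1 x : `]x0 - d, x0 + d[%classic x -> mu.-integrable `[a, b] (EFin \o h x).
  by move=> /bI/ch; exact: cont_on_integrable.
have H2 x y : `]x0 - d, x0 + d[%classic x -> `[a, b]%classic y -> derivable (h^~ y) x 1.
  by rewrite /= [y \in _]in_itv /= => /bI xd yab; have [] := dx x y xd yab.
have H3 : mu.-integrable `[a, b] (EFin \o (fun=> `|B|)).
  by apply: cont_on_integrable; exact: cont_on_cst.
have H4 x y : `]x0 - d, x0 + d[%classic x -> `[a, b]%classic y -> `|partial1of2 h x y| <= `|B|.
  rewrite /= [y \in _]in_itv /= => /bI xd yab; rewrite E //.
  by apply: le_trans (hB x y xd yab) _; exact: ler_norm.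
have mab : measurable (`[a, b]%classic : set (measurableTypeR R)) by [].
split.
  have D := derivable_under_integral mab x0I H1 H2 (fun y => B0 _ y) H3 H4.
  refine D.
have := differentiation_under_integral mab x0I H1 H2 (fun y => B0 _ y) H3 H4.
rewrite derive1E => ->; apply: eq_rint => y yab.
by apply: E => //; rewrite subrr normr0.
Qed.

Lemma cont_real (f : C -> R) (z : C) : {for z, continuous f} ->
  {for z, continuous (fun z => (f z)%:C : C)}.
Proof.
by move=> cf; apply: (@cvg_complex R C (nbhs z)); [exact: cf|exact: cvg_cst].
Qed.

Lemma polar_bounded_real (f : C -> R) (z0 : C) (r1 r2 t1 t2 : R) :
  0 <= r1 -> r1 <= r2 -> t1 <= t2 ->
  (forall r t, r1 <= r <= r2 -> {for z0 + polar r t, continuous f}) ->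
  exists B : R, forall r t, r1 <= r <= r2 -> t1 <= t <= t2 -> `|f (z0 + polar r t)| <= B.
Proof.
move=> r10 r12 t12 cf.
have [r t hr _|B HB] := @polar_bounded R (fun z => (f z)%:C) z0 r1 r2 t1 t2 r10 r12 t12.
  exact: cont_real (cf r t hr).
by exists B => r t hr ht; rewrite -cmod_real; exact: HB.
Qed.

Lemma cont_polar_arg (f : C -> R) (z0 : C) (r t : R) :
  {for z0 + polar r t, continuous f} -> {for t, continuous (fun t => f (z0 + polar r t))}.
Proof.
move=> cf; apply: (@continuous_comp _ _ _ (fun t => z0 + polar r t) f); last exact: cf.
by apply: continuousD; [exact: cvg_cst|exact: continuous_polar].
Qed.

Lemma cont_polar_rad (f : C -> R) (z0 : C) (r t : R) :
  {for z0 + polar r t, continuous f} -> {for r, continuous (fun r => f (z0 + polar r t))}.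
Proof.
move=> cf; apply: (@continuous_comp _ _ _ (fun r => z0 + polar r t) f); last exact: cf.
by apply: continuousD; [exact: cvg_cst|exact: rder_cont (rder_polar_rad r t)].
Qed.

Lemma cont_rint_polar (g : C -> R) (z0 : C) (r1 r2 t : R) : 0 <= r1 -> r1 <= r2 ->
  (forall r t, r1 <= r <= r2 -> {for z0 + polar r t, continuous g}) ->
  {for t, continuous (fun t => rint r1 r2 (fun r => r * g (z0 + polar r t)))}.
Proof.
move=> r10 r12 cg.
have [|B HB] := @polar_bounded_real g z0 r1 r2 (t - 1) (t + 1) r10 r12 _ cg; first lra.
apply: (@cont_rint_param (fun t r => r * g (z0 + polar r t)) _ _ t 1 (r2 * B)) => // s.
- move=> _ r hr; apply: continuousM; first exact: cvg_id.
  exact: cont_polar_rad (cg r s hr).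
- move=> r sd /andP[h1 h2]; have r0 : 0 <= r by lra.
  rewrite normrM (ger0_norm r0) ler_pM // HB ?h1 //.
  by move: sd; rewrite ltr_norml => /andP[? ?]; apply/andP; split; lra.
- move=> r _ hr; apply: continuousM; first exact: cvg_cst.
  exact: cont_polar_arg (cg r s hr).
Qed.

Lemma integral_oo_rint (a b : R) (f : R -> R) : cont_on a b f ->
  (\int[mu]_(x in `]a, b[) (f x)%:E = (rint a b f)%:E)%E.
Proof.
move=> cf; have If := cont_on_integrable cf.
have mf : measurable_fun `[a, b] (EFin \o f) by have [] := integrableP _ _ _ If.
have sub1 : `]a, b[%classic `<=` (`[a, b]%classic : set R).
  by move=> x /=; rewrite !in_itv /= => /andP[/ltW -> /ltW ->].
have sub2 : `[a, b[%classic `<=` (`[a, b]%classic : set R).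
  by move=> x /=; rewrite !in_itv /= => /andP[-> /ltW ->].
rewrite integral_itv_obnd_cbnd; last by apply: measurable_funS mf.
rewrite integral_itv_bndo_bndc; last by apply: measurable_funS mf.
by rewrite /rint /Rintegral fineK //; exact: integrable_fin_num.
Qed.

(** The part of the annulus [r1 < |z| < r2] that lies in the right half plane
    between the lines of slopes [T1] and [T2]. *)
Definition cone (r1 r2 T1 T2 : R) : set C := [set z |
  [/\ 0 < complex.Re z, T1 * complex.Re z < complex.Im z,
      complex.Im z < T2 * complex.Re z & r1 < cmod z < r2]].

Lemma cos_atan_gt0 (u : R) : 0 < cos (atan u).
Proof. by rewrite cos_atan invr_gt0 sqrtr_gt0 ltr_wpDr ?sqr_ge0. Qed.

Lemma sin_atanE (u : R) : sin (atan u) = u * cos (atan u).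
Proof.
by rewrite -{2}[u]atanK /tan divfK // gt_eqF // cos_atan_gt0.
Qed.

Lemma cone_polar (r1 r2 T1 T2 r u : R) : 0 < r1 ->
  (cone r1 r2 T1 T2 (polar r (atan u)) <-> r1 < r < r2 /\ T1 < u < T2).
Proof.
move=> r10; have k0 := cos_atan_gt0 u.
rewrite /cone /mkset !polarE cmod_polar sin_atanE; split.
  move=> [h0 h1 h2 h3].
  have r0 : 0 < r by move: h0; rewrite pmulr_lgt0.
  have rk : 0 < r * cos (atan u) by rewrite mulr_gt0.
  move: h1 h2; rewrite (mulrCA r u) !ltr_pM2r // => -> ->.
  by rewrite gtr0_norm in h3.
move=> [/andP[h1 h2] /andP[h3 h4]].
have r0 : 0 < r by lra.
have rk : 0 < r * cos (atan u) by rewrite mulr_gt0.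
by rewrite (mulrCA r u) !ltr_pM2r // gtr0_norm // h1 h2.
Qed.

Lemma open_gt0_preim (f : R * R -> R) : continuous f -> open [set w | 0 < f w].
Proof.
move=> cf; have -> : [set w | 0 < f w] = f @^-1` [set x | 0 < x] by [].
by apply: open_comp; [move=> w _; exact: cf|exact: open_gt].
Qed.

Lemma open_cone (r1 r2 T1 T2 : R) : open [set w : R * R | cone r1 r2 T1 T2 (of_pair w)].
Proof.
have c1 : continuous (fun w : R * R => w.1) by move=> w; exact: cvg_fst.
have c2 : continuous (fun w : R * R => w.2) by move=> w; exact: cvg_snd.
have cs (c : R) : continuous (fun w : R * R => c) by move=> w; exact: cvg_cst.
have cof : continuous (fun w : R * R => cmod (of_pair w)).
  move=> w; apply: (@continuous_comp _ _ _ (fun w : R * R => of_pair w) (@cmod R)).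
    by apply: (@cvg_complex R (R * R)%type (nbhs w)); [exact: cvg_fst|exact: cvg_snd].
  exact: continuous_cmod.
have -> : [set w : R * R | cone r1 r2 T1 T2 (of_pair w)] =
  [set w | 0 < w.1] `&` [set w | 0 < w.2 - T1 * w.1] `&` [set w | 0 < T2 * w.1 - w.2] `&`
  [set w | 0 < cmod (of_pair w) - r1] `&` [set w | 0 < r2 - cmod (of_pair w)].
  apply/seteqP; split => w; rewrite /cone /= !subr_gt0.
    by move=> [h1 h2 h3 /andP[h4 h5]].
  by move=> [[[[h1 h2] h3] h4] h5]; split => //; rewrite h4.
apply: openI; last first.
  by apply: open_gt0_preim => w; apply: (@cvgB R R (R * R)%type (nbhs w)); [exact: cs|exact: cof].
apply: openI; last first.
  by apply: open_gt0_preim => w; apply: (@cvgB R R (R * R)%type (nbhs w)); [exact: cof|exact: cs].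
apply: openI; last first.
  apply: open_gt0_preim => w; apply: (@cvgB R R (R * R)%type (nbhs w)); last exact: c2.
  by apply: (@cvgM R (R * R)%type (nbhs w)); [exact: cs|exact: c1].
apply: openI; last first.
  apply: open_gt0_preim => w; apply: (@cvgB R R (R * R)%type (nbhs w)); first exact: c2.
  by apply: (@cvgM R (R * R)%type (nbhs w)); [exact: cs|exact: c1].
exact: open_gt0_preim.
Qed.

Lemma continuous_of_pair : continuous (of_pair : R * R -> C).
Proof.
by move=> w; apply: (@cvg_complex R (R * R)%type (nbhs w)); [exact: cvg_fst|exact: cvg_snd].
Qed.

Lemma cmeas_patch (g : C -> R) (S : set C) : open [set w : R * R | S (of_pair w)] ->
  (forall z, S z -> {for z, continuous g}) -> cmeas ((EFin \o g) \_ S).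
Proof.
move=> oS cg; have mS := open_measurable_prod oS.
suff : measurable_fun [set w : R * R | S (of_pair w)] (fun w => (g (of_pair w))%:E).
  by move/(measurable_restrictT _ mS).
apply/measurable_EFinP; apply: open_cont_measurable_prod => // w Sw.
apply: (@continuous_comp _ _ _ (fun w : R * R => of_pair w) g); last exact: cg.
exact: continuous_of_pair.
Qed.

Lemma patch_ge0 (g : C -> R) (S : set C) z : (forall z, S z -> 0 <= g z) ->
  (0 <= ((EFin \o g) \_ S) z)%E.
Proof.
move=> g0; rewrite patchE; case: ifPn => // zS; rewrite lee_fin.
by apply: g0; move: zS; rewrite inE.
Qed.

(** Polar coordinates on a cone, for a function read in a frame centered at
    [z0] and rotated by [c].  The substitution is made in two steps, [y = x u] on vertical
    lines and then [x = r cos (atan u)] for fixed slope [u]; the angle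
    [atan u] is introduced by a substitution in the outer integral. *)
Lemma aint_cone (g : C -> R) (z0 : C) (c r1 r2 T1 T2 : R) : 0 < r1 -> r1 < r2 -> T1 < T2 ->
  (forall r t, r1 <= r <= r2 -> {for z0 + polar r t, continuous g}) ->
  let g1 := fun z => g (z0 + polar 1 c * z) in
  (forall z, cone r1 r2 T1 T2 z -> {for z, continuous g1}) ->
  (forall z, cone r1 r2 T1 T2 z -> 0 <= g1 z) ->
  aint ((EFin \o g1) \_ (cone r1 r2 T1 T2)) =
  (rint (c + atan T1) (c + atan T2) (fun t => rint r1 r2 (fun r => r * g (z0 + polar r t))))%:E.
Proof.
move=> r10 r12 T12 cg g1 cg1 g10.
pose S := cone r1 r2 T1 T2; rewrite -/S.
pose G := (EFin \o g1) \_ S; rewrite -/G.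
have mG : cmeas G by apply: cmeas_patch => //; exact: open_cone.
have G0 z : (0 <= G z)%E by exact: patch_ge0.
pose K t := rint r1 r2 (fun r => r * g (z0 + polar r t)).
have r12' := ltW r12; have r1' := ltW r10.
have cK t : {for t, continuous K} by exact: cont_rint_polar.
have cr t : cont_on r1 r2 (fun r => r * g (z0 + polar r t)).
  move=> r hr; apply: continuousM; first exact: cvg_id.
  exact: cont_polar_rad (cg r t hr).
pose G' (w : R * R) : \bar R := ((Num.max w.1 0)%:E * G (w.1 +i* (w.1 * w.2)%R))%E.
have G'0 w : (0 <= G' w)%E.
  by rewrite mule_ge0 // lee_fin le_max lexx orbT.
have mG' : measurable_fun [set: R * R] G'.
  apply: emeasurable_funM.
    apply/measurable_EFinP; apply: measurable_maxr; first exact: measurable_fst.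
    exact: measurable_cst.
  apply: (@measurableT_comp _ _ _ _ _ _ (fun w => G (of_pair w)) _
    (fun w : R * R => (w.1, w.1 * w.2))) => //.
  apply: measurable_fun_pair; first exact: measurable_fst.
  by apply: measurable_funM; [exact: measurable_fst|exact: measurable_snd].
rewrite (aint_Fubini mG G0).1.
transitivity (\int[mu]_x \int[mu]_u G' (x, u))%E.
  apply: eq_integral => x _.
  have [x0|x0] := ltP 0 x; last first.
    transitivity (0 : \bar R); [|symmetry]; apply: integral0_eq => y _; last first.
      by rewrite /G' /= max_r // mul0e.
    rewrite /G patchE ifN //; apply/negP; rewrite inE => -[/=].
    by rewrite ltNge x0.
  rewrite (@affine_substitution 0 x (fun y => G (x +i* y)) _ (cmeas_y x mG)) //; last by rewrite gt_eqF.
  rewrite gtr0_norm // -ge0_integralZl //=.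
  - by apply: eq_integral => u _; rewrite /G' /= max_l ?ltW // add0r.
  - have := measurable_fun_pair2 x (cmeas_affine 0 1 0 0 0 x mG).
    rewrite /of_pair /=; congr (measurable_fun _ _); apply/funext => u /=.
    by rewrite !mul0r !add0r mul1r addr0.
  - by rewrite lee_fin ltW.
transitivity (\int[mu]_u \int[mu]_x G' (x, u))%E.
  exact: (fubini_tonelli (m1 := mu) (m2 := mu) G' mG' G'0).
pose kap (u : R) : R := cos (atan u).
transitivity (\int[mu]_(u in `]T1, T2[) (kap u ^+ 2 * K (c + atan u))%:E)%E.
  rewrite [RHS]integral_mkcond; apply: eq_integral => u _.
  have k0 : 0 < kap u by exact: cos_atan_gt0.
  rewrite (@affine_substitution 0 (kap u) (fun x => G' (x, u))) ?gt_eqF //; last first.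
    exact: measurable_fun_pair1 u mG'.
  have E r : G' ((0 + kap u * r)%R, u) =
     ((Num.max (kap u * r) 0)%:E * G (polar r (atan u)))%E.
    rewrite /G' /= add0r; congr (_ * G _)%E; apply: complexP; rewrite !polarE.
      by rewrite mulrC.
    by rewrite sin_atanE -/(kap u); ring.
  under eq_integral do rewrite E.
  have [uT|uT] := boolP (T1 < u < T2); last first.
    rewrite [RHS]patchE ifN; last by apply/negP => /set_mem; rewrite /= in_itv /=; apply/negP.
    rewrite integral0_eq ?mule0 // => r _; rewrite /G patchE ifN ?mule0 //.
    by apply/negP => /set_mem/(cone_polar _ _ _ _ _ r10)[_ h]; move: uT; rewrite h.
  rewrite [RHS]patchE ifT; last by apply: mem_set; rewrite /= in_itv.
  transitivity (`|kap u|%:E * \int[mu]_(r in `]r1, r2[) (kap u * (r * g (z0 + polar r (c + atan u))))%:E)%E.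
    congr (_ * _)%E; rewrite [RHS]integral_mkcond; apply: eq_integral => r _.
    have [rr|rr] := boolP (r1 < r < r2); last first.
      rewrite [RHS]patchE ifN; last by apply/negP => /set_mem; rewrite /= in_itv /=; apply/negP.
      rewrite /G patchE ifN ?mule0 //.
      by apply/negP => /set_mem/(cone_polar _ _ _ _ _ r10)[h _]; move: rr; rewrite h.
    rewrite [RHS]patchE ifT; last by apply: mem_set; rewrite /= in_itv.
    rewrite /G patchE ifT; last by apply: mem_set; apply/cone_polar.
    have r0 : 0 <= r by move: rr => /andP[? _]; lra.
    rewrite max_l ?mulr_ge0 ?(ltW k0) //= -EFinM; congr EFin.
    by rewrite /g1 polarM mul1r mulrA.
  rewrite integral_oo_rint; last first.
    by move=> r hr; apply: continuousM; [exact: cvg_cst|exact: cr].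
  rewrite rintZ; last exact: cr.
  by rewrite -EFinM gtr0_norm // mulrA expr2.
have katE u : kap u ^+ 2 = (1 + u ^+ 2)^-1.
  by rewrite /kap cos_atan exprVn sqr_sqrtr // addr_ge0 ?sqr_ge0.
pose F u := c + atan u.
have dF (u : R) : is_derive u 1 F (1 + u ^+ 2)^-1.
  have D : is_derive u 1 atan (1 + u ^+ 2)^-1.
    by split; [exact: derivable_atan|rewrite -derive1E derive1_atan].
  by rewrite -[X in is_derive _ _ _ X]add0r; exact: is_deriveD.
have FE : F^`()%classic = fun u => (1 + u ^+ 2)^-1.
  by apply/funext => u; rewrite derive1E; have [_ ->] := dF u.
have cF (u : R) : {for u, continuous F} by exact: is_derive_cont (dF u).
have cF' : continuous (F^`()%classic).
  move=> u; rewrite FE.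
  have n0 : 1 + u ^+ 2 != 0 by rewrite gt_eqF // ltr_wpDr ?sqr_ge0.
  have c1 : {for u, continuous (fun u : R => 1 + u ^+ 2)}.
    by apply: (@cvgD R R R (nbhs u)); [exact: cvg_cst|exact: exprn_continuous].
  exact: (@cvgV R R (nbhs u) _ _ _ n0 c1).
have cKF : cont_on T1 T2 (fun u => kap u ^+ 2 * K (c + atan u)).
  move=> u _; have -> : (fun u => kap u ^+ 2 * K (c + atan u)) =
     (fun u => F^`()%classic u * K (F u)).
    by apply/funext => v; rewrite FE katE.
  apply: continuousM; first exact: cF'.
  by apply: continuous_comp; [exact: cF|exact: cK].
rewrite integral_oo_rint //.
have cKon a b : cont_on a b K by move=> t _; exact: cK.
have FK a b : (\int[mu]_(x in `[a, b]) (K x)%:E = (rint a b K)%:E)%E.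
  by rewrite /rint /Rintegral fineK //; apply: integrable_fin_num => //; exact: cont_on_integrable.
rewrite -FK (@integration_by_substitution_increasing _ F K T1 T2).
- rewrite /rint /Rintegral fineK; last first.
    by apply: integrable_fin_num => //; exact: cont_on_integrable.
  by apply: eq_integral => u _; rewrite FE /= katE mulrC.
- exact: ltW.
- by move=> x y _ _ xy; rewrite /F ltrD2l; exact: lt_atan.
- by move=> u _; exact: cF'.
- by apply/cvg_ex; exists (F^`()%classic T1); apply: cvg_at_right_filter; exact: cF'.
- by apply/cvg_ex; exists (F^`()%classic T2); apply: cvg_at_left_filter; exact: cF'.
- split; first by move=> u _; have [] := dF u.
    by apply: cvg_at_right_filter; exact: cF.
  by apply: cvg_at_left_filter; exact: cF.
- exact: cont_on_within.
Qed.

(** An annular sector centered at [z0]. *)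
Definition sector (z0 : C) (r1 r2 t1 t2 : R) : set C := [set z | exists r t : R,
  [/\ r1 < r < r2, t1 < t < t2 & z = z0 + polar r t]].

Lemma right_half_polar (w : C) : 0 < complex.Re w ->
  w = polar (cmod w) (atan (complex.Im w / complex.Re w)).
Proof.
move=> w0; set u := complex.Im w / complex.Re w.
have kE : cos (atan u) = complex.Re w / cmod w.
  rewrite cos_atan cmodE.
  have -> : 1 + u ^+ 2 = (complex.Re w ^+ 2 + complex.Im w ^+ 2) / complex.Re w ^+ 2.
    by rewrite /u; field; rewrite gt_eqF.
  by rewrite sqrtrM ?addr_ge0 ?sqr_ge0 // sqrtrV ?sqr_ge0 // sqrtr_sqr gtr0_norm // invfM invrK mulrC.
have cw : cmod w != 0.
  by rewrite cmod_eq0; apply/negP => /eqP w00; rewrite w00 ltxx in w0.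
apply: complexP; rewrite !polarE ?sin_atanE kE.
  by field.
by rewrite /u; field; rewrite cw gt_eqF.
Qed.

Lemma sector_cone (z0 : C) (c r1 r2 T1 T2 : R) (w : C) : 0 < r1 ->
  sector z0 r1 r2 (c + atan T1) (c + atan T2) (z0 + polar 1 c * w) <-> cone r1 r2 T1 T2 w.
Proof.
move=> r10; have p10 : polar 1 c != 0 :> C by rewrite -cmod_gt0 cmod_polar normr1.
split.
  move=> [r [t [hr /andP[ht1 ht2] /addrI E]]].
  have wE : w = polar r (t - c).
    apply: (mulfI p10); rewrite E polarM mul1r.
    by rewrite [in RHS]addrC subrK.
  have tcI : - (pi / 2) < t - c < pi / 2.
    by have := atan_gtNpi2 T1; have := atan_ltpi2 T2; move=> ? ?; apply/andP; split; lra.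
  rewrite wE -[t - c]tanK ?in_itv //; apply/cone_polar => //; split=> //.
  by apply/andP; split; rewrite ltNge; apply/negP => /le_atan; rewrite tanK ?in_itv //; lra.
move=> wC; have w0 : 0 < complex.Re w by case: wC.
have wE := right_half_polar w0; set u := _ / _ in wE.
move: wC; rewrite {1}wE => /(cone_polar _ _ _ _ _ r10)[hr /andP[h1 h2]].
exists (cmod w), (c + atan u); split=> //.
  by rewrite !ltrD2l !lt_atan.
by rewrite {1}wE polarM mul1r.
Qed.

(** Polar coordinates on a sector of opening less than [pi], obtained by
    rotating the sector into the right half plane. *)
Lemma aint_sector (g : C -> R) (z0 : C) (r1 r2 t1 t2 : R) :
  0 < r1 -> r1 < r2 -> t1 < t2 -> t2 - t1 < pi ->
  (forall r t, r1 <= r <= r2 -> {for z0 + polar r t, continuous g}) ->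
  (forall z, sector z0 r1 r2 t1 t2 z -> 0 <= g z) ->
  cmeas ((EFin \o g) \_ (sector z0 r1 r2 t1 t2)) /\
  aint ((EFin \o g) \_ (sector z0 r1 r2 t1 t2)) =
  (rint t1 t2 (fun t => rint r1 r2 (fun r => r * g (z0 + polar r t))))%:E.
Proof.
move=> r10 r12 t12 tpi cg g0.
pose c := (t1 + t2) / 2; pose T1 := tan (t1 - c); pose T2 := tan (t2 - c).
have c1 : - (pi / 2) < t1 - c < pi / 2.
  by rewrite /c; apply/andP; split; lra.
have c2 : - (pi / 2) < t2 - c < pi / 2.
  by rewrite /c; apply/andP; split; lra.
have a1 : atan T1 = t1 - c by rewrite tanK // in_itv.
have a2 : atan T2 = t2 - c by rewrite tanK // in_itv.
have T12 : T1 < T2.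
  rewrite ltNge; apply/negP => /le_atan; rewrite a1 a2 /c; lra.
have e1 : c + atan T1 = t1 by rewrite a1 addrC subrK.
have e2 : c + atan T2 = t2 by rewrite a2 addrC subrK.
have SC w := @sector_cone z0 c r1 r2 T1 T2 w r10.
rewrite e1 e2 in SC.
pose g1 z := g (z0 + polar 1 c * z).
have cg1 z : cone r1 r2 T1 T2 z -> {for z, continuous g1}.
  move=> /SC[r [t [/andP[/ltW h1 /ltW h2] _ E]]].
  apply: (@continuous_comp _ _ _ (fun z => z0 + polar 1 c * z) g).
    apply: cder_cont (cderD (cder_cst z0 z) (cderM (cder_cst (polar 1 c) z) (cder_id z))).
  by rewrite E; apply: cg; rewrite h1.
have g10 z : cone r1 r2 T1 T2 z -> 0 <= g1 z by move=> /SC/g0.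
have := aint_cone (c := c) r10 r12 T12 cg cg1 g10; rewrite e1 e2 => <-.
rewrite -/g1; set G1 := (EFin \o g1) \_ _.
have mG1 : cmeas G1 by apply: cmeas_patch => //; exact: open_cone.
set G := (EFin \o g) \_ _.
have GE z : G (z0 + polar 1 c * z) = G1 z.
  rewrite /G /G1 !patchE; have [zC|zC] := pselect (cone r1 r2 T1 T2 z).
    by rewrite !ifT //; apply: mem_set => //; exact/SC.
  by rewrite !ifN //; apply/negP => /set_mem // /SC.
have G1E z : G z = G1 (- (polar 1 (- c) * z0) + polar 1 (- c) * z).
  rewrite -GE; congr G; rewrite mulrDr mulrN !mulrA polarM mulr1 subrr polar10 !mul1r.
  by rewrite [z0 + _]addrC addrAC addNr add0r.
have mG : cmeas G.
  by apply: eq_cmeas (cmeas_lin _ _ mG1) => z; rewrite G1E.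
split=> //.
rewrite (@aint_isometry G z0 c mG); last by move=> z; exact: patch_ge0.
by congr aint; apply/funext => z; rewrite GE.
Qed.

Lemma le_aint (G1 G2 : C -> \bar R) : cmeas G1 -> cmeas G2 -> (forall z, 0 <= G1 z)%E ->
  (forall z, G1 z <= G2 z)%E -> (aint G1 <= aint G2)%E.
Proof.
by move=> m1 m2 h1 h12; apply: ge0_le_integral.
Qed.

Lemma boxE (r1 r2 t1 t2 : R) : box r1 r2 t1 t2 = [set w | sector 0 r1 r2 t1 t2 (of_pair w)].
Proof.
apply/seteqP; split => w /= [r [t [h1 h2 h3]]]; exists r, t; split => //.
  by rewrite add0r.
by rewrite h3 add0r.
Qed.

Lemma box_integral (g : C -> R) (r1 r2 t1 t2 : R) :
  0 < r1 -> r1 < r2 -> t1 < t2 -> t2 - t1 < pi ->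
  (forall r t, r1 <= r <= r2 -> {for (polar r t : C), continuous g}) ->
  (forall r t, r1 < r < r2 -> 0 <= g (polar r t)) ->
  \int[area]_(w in box r1 r2 t1 t2) g (of_pair w) =
  rint t1 t2 (fun t => rint r1 r2 (fun r => r * g (polar r t))).
Proof.
move=> r10 r12 t12 tpi cg g0.
have cg' r t : r1 <= r <= r2 -> {for 0 + polar r t, continuous g} by rewrite add0r; exact: cg.
have g0' z : sector 0 r1 r2 t1 t2 z -> 0 <= g z.
  by move=> [r [t [hr _ ->]]]; rewrite add0r; exact: g0.
have [_ E] := aint_sector r10 r12 t12 tpi cg' g0'.
rewrite /Rintegral integral_mkcond boxE.
have -> : rint t1 t2 (fun t => rint r1 r2 (fun r => r * g (polar r t))) =
  fine (rint t1 t2 (fun t => rint r1 r2 (fun r => r * g (0 + polar r t))))%:E.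
  by apply: eq_rint => t _; apply: eq_rint => r _; rewrite add0r.
by rewrite -E.
Qed.

End PlaneMeasure.

(** * Dependence of circle integrals on the radius *)

Section CircleMeans.
Context {R : realType}.
Local Notation C := (Cplx R).
Local Notation mu := (@lebesgue_measure R).

Lemma cont_rint_circle (g : C -> R) (z0 : C) (ra rb t1 t2 r : R) : 0 <= ra -> t1 <= t2 ->
  (forall r t, ra < r < rb -> {for z0 + polar r t, continuous g}) -> ra < r < rb ->
  {for r, continuous (fun r => rint t1 t2 (fun t => g (z0 + polar r t)))}.
Proof.
move=> ra0 t12 cg /andP[h1 h2].
pose d := Num.min (r - ra) (rb - r) / 2.
have m0 : 0 < Num.min (r - ra) (rb - r) by rewrite lt_min !subr_gt0 h1.
have d0 : 0 < d by rewrite /d divr_gt0.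
have [d1 d2] : d < r - ra /\ d < rb - r.
  have : d < Num.min (r - ra) (rb - r) by rewrite /d; lra.
  by rewrite lt_min => /andP.
have [||||B HB] := @polar_bounded_real R g z0 (r - d) (r + d) t1 t2; [lra|lra|exact: t12| |].
  by move=> s t /andP[? ?]; apply: cg; apply/andP; split; lra.
apply: (@cont_rint_param R (fun r t => g (z0 + polar r t)) _ _ r d B) => // x.
- rewrite ltr_distl => /andP[? ?] t _; apply: cont_polar_arg; apply: cg.
  by apply/andP; split; lra.
- move=> y; rewrite ltr_distl => /andP[/ltW ? /ltW ?] hy; apply: HB => //.
  by apply/andP; split; lra.
- move=> y; rewrite ltr_distl => /andP[? ?] _; apply: cont_polar_rad; apply: cg.
  by apply/andP; split; lra.
Qed.

Lemma derive_rint_circle (g dg : C -> R) (ra rb t1 t2 r : R) : 0 <= ra -> t1 <= t2 ->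
  (forall r t, ra < r < rb -> {for (polar r t : C), continuous dg}) ->
  (forall r t, ra < r < rb -> {for (polar r t : C), continuous g}) ->
  (forall r t, ra < r < rb -> is_derive r 1 (fun r => g (polar r t)) (dg (polar r t))) ->
  ra < r < rb ->
  is_derive r 1 (fun r => rint t1 t2 (fun t => g (polar r t)))
    (rint t1 t2 (fun t => dg (polar r t))).
Proof.
move=> ra0 t12 cdg cg gd /andP[h1 h2].
pose d := Num.min (r - ra) (rb - r) / 2.
have m0 : 0 < Num.min (r - ra) (rb - r) by rewrite lt_min !subr_gt0 h1.
have d0 : 0 < d by rewrite /d divr_gt0.
have [d1 d2] : d < r - ra /\ d < rb - r.
  have : d < Num.min (r - ra) (rb - r) by rewrite /d; lra.
  by rewrite lt_min => /andP.
have [||||B HB] := @polar_bounded_real R dg 0 (r - d) (r + d) t1 t2; [lra|lra|exact: t12| |].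
  by move=> s t /andP[? ?]; rewrite add0r; apply: cdg; apply/andP; split; lra.
apply: (@derive_rint_param R (fun r t => g (polar r t)) (fun r t => dg (polar r t)) _ _ r d B) => // x.
- rewrite ltr_distl => /andP[? ?] t _.
  apply: (@continuous_comp _ _ _ (polar x) g); first exact: continuous_polar.
  by apply: cg; apply/andP; split; lra.
- move=> y; rewrite ltr_distl => /andP[/ltW ? /ltW ?] hy; rewrite -[polar x y]add0r; apply: HB => //.
  by apply/andP; split; lra.
- move=> y; rewrite ltr_distl => /andP[? ?] _; apply: gd.
  by apply/andP; split; lra.
Qed.

Lemma continuous_polar2 (z0 : C) : continuous (fun w : R * R => z0 + polar w.1 w.2 : C).
Proof.
move=> w; apply: (@cvgD _ C (R * R)%type (nbhs w)); first exact: cvg_cst.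
apply: (@cvg_complex R (R * R)%type (nbhs w)).
  apply: (@cvgM R (R * R)%type (nbhs w)); first exact: cvg_fst.
  apply: (@cvg_comp _ _ _ snd cos _ (nbhs w.2)); [exact: cvg_snd|exact: continuous_cos].
apply: (@cvgM R (R * R)%type (nbhs w)); first exact: cvg_fst.
apply: (@cvg_comp _ _ _ snd sin _ (nbhs w.2)); [exact: cvg_snd|exact: continuous_sin].
Qed.

Lemma open_rect (a b c d : R) :
  open [set w : R * R | (a < w.1 < b) && (c < w.2 < d)].
Proof.
have -> : [set w : R * R | (a < w.1 < b) && (c < w.2 < d)] =
  fst @^-1` `]a, b[%classic `&` snd @^-1` `]c, d[%classic.
  by apply/seteqP; split => w /=; rewrite !in_itv /=; [move=> /andP[]|move=> [-> ->]].
by apply: openI; apply: open_comp; (try exact: interval_open) => w _; [exact: cvg_fst|exact: cvg_snd].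
Qed.

(** Tonelli's theorem in polar coordinates. *)
Lemma rint_polar_swap (g : C -> R) (z0 : C) (ra rb r1 r2 t1 t2 : R) :
  0 <= ra -> ra < r1 -> r1 <= r2 -> r2 < rb -> t1 <= t2 ->
  (forall r t, ra < r < rb -> {for z0 + polar r t, continuous g}) ->
  (forall r t, r1 <= r <= r2 -> 0 <= g (z0 + polar r t)) ->
  rint t1 t2 (fun t => rint r1 r2 (fun r => r * g (z0 + polar r t))) =
  rint r1 r2 (fun r => r * rint t1 t2 (fun t => g (z0 + polar r t))).
Proof.
move=> ra0 ra1 r12 r2b t12 cg g0.
have cg' r t : r1 <= r <= r2 -> {for z0 + polar r t, continuous g}.
  by move=> /andP[? ?]; apply: cg; apply/andP; split; lra.
have r10 : 0 <= r1 by lra.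
have ct : cont_on t1 t2 (fun t => rint r1 r2 (fun r => r * g (z0 + polar r t))).
  by move=> t _; exact: cont_rint_polar.
have cr : cont_on r1 r2 (fun r => r * rint t1 t2 (fun t => g (z0 + polar r t))).
  move=> r /andP[? ?]; apply: continuousM; first exact: cvg_id.
  by apply: (@cont_rint_circle g z0 ra rb) => //; apply/andP; split; lra.
apply: EFin_inj; rewrite -!integral_oo_rint //.
pose S := [set w : R * R | (r1 < w.1 < r2) && (t1 < w.2 < t2)].
pose f := (EFin \o (fun w : R * R => w.1 * g (z0 + polar w.1 w.2))) \_ S.
have f0 w : (0 <= f w)%E.
  rewrite /f patchE; case: ifPn => //; rewrite inE /S /= => /andP[/andP[h1 h2] _].
  by rewrite lee_fin mulr_ge0 //; [lra|apply: g0; rewrite !ltW].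
have mf : measurable_fun setT f.
  have mS : measurable S by apply: open_measurable_prod; exact: open_rect.
  suff : measurable_fun S (fun w : R * R => (w.1 * g (z0 + polar w.1 w.2))%:E).
    by move/(measurable_restrictT _ mS).
  apply/measurable_EFinP; apply: open_cont_measurable_prod; first exact: open_rect.
  move=> w /andP[/andP[/ltW h1 /ltW h2] _]; apply: (@cvgM R (R * R)%type (nbhs w)); first exact: cvg_fst.
  apply: (@continuous_comp _ _ _ (fun w : R * R => z0 + polar w.1 w.2 : C) g).
    exact: continuous_polar2.
  by apply: cg'; rewrite h1.
have E1 : (\int[mu]_x \int[mu]_y f (x, y) =
  \int[mu]_(r in `]r1, r2[) (r * rint t1 t2 (fun t => g (z0 + polar r t)))%:E)%E.
  rewrite [RHS]integral_mkcond; apply: eq_integral => r _; rewrite patchE.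
  case: ifPn => [|rI].
    rewrite inE /= in_itv /= => /andP[h1 h2].
    rewrite -rintZ; last by move=> t _; apply: cont_polar_arg; apply: cg'; rewrite !ltW.
    rewrite -integral_oo_rint; last first.
      move=> t _; apply: continuousM; first exact: cvg_cst.
      by apply: cont_polar_arg; apply: cg'; rewrite !ltW.
    rewrite [RHS]integral_mkcond; apply: eq_integral => t _.
    rewrite /f !patchE (_ : ((r, t) \in S) = (t \in `]t1, t2[%classic)) //.
    by apply/idP/idP; rewrite !inE /S /= in_itv /= h1 h2.
  transitivity (0%E : \bar R) => //; apply: integral0_eq => t _; rewrite /f patchE ifN //.
  apply: contra rI; rewrite !inE /S /= in_itv /=.
  by move=> /andP[].
have E2 : (\int[mu]_y \int[mu]_x f (x, y) =
  \int[mu]_(t in `]t1, t2[) (rint r1 r2 (fun r => r * g (z0 + polar r t)))%:E)%E.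
  rewrite [RHS]integral_mkcond; apply: eq_integral => t _; rewrite patchE.
  case: ifPn => [|tI].
    rewrite inE /= in_itv /= => /andP[h1 h2].
    rewrite -integral_oo_rint; last first.
      move=> r hr; apply: continuousM; first exact: cvg_id.
      by apply: cont_polar_rad; apply: cg'.
    rewrite [RHS]integral_mkcond; apply: eq_integral => r _.
    rewrite /f !patchE (_ : ((r, t) \in S) = (r \in `]r1, r2[%classic)) //.
    by apply/idP/idP; rewrite !inE /S /= in_itv /= h1 h2 /= ?andbT.
  transitivity (0%E : \bar R) => //; apply: integral0_eq => r _; rewrite /f patchE ifN //.
  apply: contra tI; rewrite !inE /S /= in_itv /=.
  by move=> /andP[].
by rewrite -E1 -E2 -fubini_tonelli.
Qed.

End CircleMeans.

(** * Hardy's identity *)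

Section Hardy.
Context {R : realType}.
Local Notation C := (Cplx R).

Variables (L n dn : C -> C) (p : C).
Hypothesis Ln : forall z, extdisk z -> cder L z (n z).
Hypothesis ndn : forall z, extdisk z -> cder n z (dn z).
Hypothesis cdn : forall z, extdisk z -> {for z, continuous dn}.

(** The weight [|phi' ^ p|], for [L] a logarithm of [phi']. *)
Definition wt (z : C) : R := expR (complex.Re (p * L z)).

(** The radial logarithmic derivative of [exp (p * L)]. *)
Definition nl (z : C) : C := p * (z * n z).

(** The integral mean of order [p] on the circle of radius [r]. *)
Definition mean0 (r : R) : R := rint 0 (2 * pi) (fun t => wt (polar r t)).

(** The integral [mean1] is [r] times the derivative of [mean0]. *)
Definition mean1 (r : R) : R :=
  rint 0 (2 * pi) (fun t => wt (polar r t) * complex.Re (nl (polar r t))).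

(** The integral [mean2] is [r] times the derivative of [mean1]. *)
Definition mean2 (r : R) : R :=
  rint 0 (2 * pi) (fun t => wt (polar r t) * cmod (nl (polar r t)) ^+ 2).

(** The inverse of the hyperbolic density at distance [r] from the origin. *)
Definition sg (r : R) : R := (r ^+ 2 - 1) / 2.

(** A quantity comparable to [mean0] near the unit circle whose variation is
    given by the energy of the non-linearity. *)
Definition flux (r : R) : R := r ^+ 2 * mean0 r - sg r * mean1 r.

Let dnl (z : C) : C := p * (z * (n z + z * dn z)).

Let ext_polar (r t : R) : 1 < r -> extdisk (polar r t : C).
Proof. by move=> r1; rewrite /extdisk /= cmod_polar gtr0_norm //; lra. Qed.

Lemma cder_nl z : extdisk z -> cder nl z (p * (n z + z * dn z)).
Proof.
move=> /ndn zn; have := cderM (cder_cst p z) (cderM (cder_id z) zn).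
by rewrite mul0r add0r mul1r.
Qed.

Lemma continuous_wt z : extdisk z -> {for z, continuous wt}.
Proof.
move=> /Ln zL; have cpL := cder_cont (cderM (cder_cst p z) zL).
apply: (@continuous_comp _ _ _ (fun z => complex.Re (p * L z)) expR); last exact: continuous_expR.
apply: (@continuous_comp _ _ _ (fun z => p * L z) (@complex.Re R)) => //.
exact: continuous_Re.
Qed.

Lemma continuous_nl z : extdisk z -> {for z, continuous nl}.
Proof. by move=> /cder_nl/cder_cont. Qed.

Lemma continuous_Re_nl z : extdisk z -> {for z, continuous (fun z => complex.Re (nl z))}.
Proof.
move=> /continuous_nl cz; apply: (@continuous_comp _ _ _ nl (@complex.Re R)) => //.
exact: continuous_Re.
Qed.

Lemma continuous_Im_nl z : extdisk z -> {for z, continuous (fun z => complex.Im (nl z))}.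
Proof.
move=> /continuous_nl cz; apply: (@continuous_comp _ _ _ nl (@complex.Im R)) => //.
exact: continuous_Im.
Qed.

Let continuous_Re_dnl z : extdisk z -> {for z, continuous (fun z => complex.Re (dnl z))}.
Proof.
move=> ze; apply: (@continuous_comp _ _ _ dnl (@complex.Re R)); last exact: continuous_Re.
have h1 : {for z, continuous (fun z : C => z * dn z)}.
  by apply: continuousM; [exact: cvg_id|exact: cdn].
have h2 : {for z, continuous (fun z : C => n z + z * dn z)}.
  by apply: continuousD; [exact: cder_cont (ndn ze)|exact: h1].
have h3 : {for z, continuous (fun z : C => z * (n z + z * dn z))}.
  by apply: continuousM; [exact: cvg_id|exact: h2].
have h0 := cder_cont (cder_cst p z).
exact: continuousM h0 h3.
Qed.

Lemma cmod_inv_cont (z : C) : extdisk z -> {for z, continuous (fun z : C => (cmod z)^-1)}.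
Proof.
move=> ze; apply: continuousV; last exact: continuous_cmod.
by rewrite gt_eqF // cmod_gt0; apply/eqP => z0; move: ze; rewrite /extdisk /= z0 cmod0; lra.
Qed.

Lemma radial_wt (r t : R) : 1 < r -> is_derive r 1 (fun r => wt (polar r t))
  (wt (polar r t) * complex.Re (nl (polar r t)) / r).
Proof.
move=> r1; have r0 : r != 0 by rewrite gt_eqF //; lra.
have zL := Ln (ext_polar t r1).
have := @rder_comp R (fun z => p * L z) (fun s => polar s t) r _ _
  (cderM (cder_cst p _) zL) (rder_polar_rad r t).
rewrite mul0r add0r => /rder_Re H.
have E : is_derive r 1 (fun s => wt (polar s t)) _ :=
  @is_derive1_comp _ expR (fun s => complex.Re (p * L (polar s t))) r _ _
  (is_derive_expR _) H.
apply: (@is_derive_eq _ _ _ _ _ _ _ _ E).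
rewrite /wt -[RHS]mulrA; congr (_ * _).
have -> : polar 1 t = r^-1%:C * polar r t :> C.
  by apply: complexP; rewrite !polarE; field.
by rewrite /nl !ReImE; ring.
Qed.

Lemma radial_nl (r t : R) : 1 < r -> is_derive r 1 (fun r => complex.Re (nl (polar r t)))
  (complex.Re (dnl (polar r t)) / r).
Proof.
move=> r1; have r0 : r != 0 by rewrite gt_eqF //; lra.
have zL := cder_nl (ext_polar t r1).
have /rder_Re H := @rder_comp R nl (fun s => polar s t) r _ _ zL (rder_polar_rad r t).
apply: (@is_derive_eq _ _ _ _ _ _ _ _ H).
have -> : polar 1 t = r^-1%:C * polar r t :> C.
  by apply: complexP; rewrite !polarE; field.
by rewrite /dnl !ReImE; ring.
Qed.

Lemma angular_wt (r t : R) : 1 < r -> is_derive t 1 (fun t => wt (polar r t))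
  (- (wt (polar r t) * complex.Im (nl (polar r t)))).
Proof.
move=> r1; have zL := Ln (ext_polar t r1).
have := rder_comp (cderM (cder_cst p _) zL) (rder_polar_arg r t).
rewrite mul0r add0r => /rder_Re H.
have E : is_derive t 1 (fun s => wt (polar r s)) _ :=
  @is_derive1_comp _ expR (fun s => complex.Re (p * L (polar r s))) t _ _
  (is_derive_expR _) H.
apply: (@is_derive_eq _ _ _ _ _ _ _ _ E).
by rewrite /wt -[RHS]mulrN; congr (_ * _); rewrite /nl !ReImE; ring.
Qed.

Lemma angular_nl (r t : R) : 1 < r -> is_derive t 1 (fun t => complex.Im (nl (polar r t)))
  (complex.Re (dnl (polar r t))).
Proof.
move=> r1; have zL := cder_nl (ext_polar t r1).
have /rder_Im H := rder_comp zL (rder_polar_arg r t).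
apply: (@is_derive_eq _ _ _ _ _ _ _ _ H).
by rewrite /dnl !ReImE; ring.
Qed.

Let cont_arg (f : C -> R) (r a b : R) : 1 < r ->
  (forall z, extdisk z -> {for z, continuous f}) -> cont_on a b (fun t => f (polar r t)).
Proof.
move=> r1 cf t _; apply: (@continuous_comp _ _ _ (polar r) f); first exact: continuous_polar.
by apply: cf; exact: ext_polar.
Qed.

Let twopi : 0 <= 2 * pi :> R. Proof. by have := @pi2_gt0 R; lra. Qed.

Let gt1_itv (r : R) : 1 < r -> 1 < r < r + 1.
Proof. by move=> r1; apply/andP; split; lra. Qed.

Lemma derive_mean0 (r : R) : 1 < r -> is_derive r 1 mean0 (mean1 r / r).
Proof.
move=> r1.
pose dg z := wt z * complex.Re (nl z) / cmod z.
have cw z : extdisk z -> {for z, continuous (fun z => wt z * complex.Re (nl z))}.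
  by move=> ze; apply: continuousM; [exact: continuous_wt|exact: continuous_Re_nl].
have cdg z : extdisk z -> {for z, continuous dg}.
  by move=> ze; apply: continuousM; [exact: cw|exact: cmod_inv_cont].
have cm (s t : R) : 1 < s -> cmod (polar s t : C) = s.
  by move=> s1; rewrite cmod_polar gtr0_norm //; lra.
have H := @derive_rint_circle R wt dg 1 (r + 1) 0 (2 * pi) r ler01 twopi.
have D : is_derive r 1 mean0 (rint 0 (2 * pi) (fun t => dg (polar r t))).
  apply: H (gt1_itv r1).
  - by move=> s t /andP[s1 _]; apply: cdg; exact: ext_polar.
  - by move=> s t /andP[s1 _]; apply: continuous_wt; exact: ext_polar.
  - by move=> s t /andP[s1 _]; rewrite /dg cm //; exact: radial_wt.
apply: (@is_derive_eq _ _ _ _ _ _ _ _ D).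
rewrite [RHS]mulrC /mean1 -rintZ; last exact: (cont_arg r1 cw).
by apply: eq_rint => t _; rewrite /dg cm // mulrC.
Qed.

(** Hardy's identity.  The integral over the circle of the angular derivative
    of [wt * Im nl] vanishes, and it turns [(Re nl)^2] into [|nl|^2]. *)
Lemma derive_mean1 (r : R) : 1 < r -> is_derive r 1 mean1 (mean2 r / r).
Proof.
move=> r1.
pose f z := wt z * complex.Re (nl z).
pose h z := wt z * complex.Re (nl z) ^+ 2 + wt z * complex.Re (dnl z).
pose dg z := h z / cmod z.
have cf z : extdisk z -> {for z, continuous f}.
  by move=> ze; apply: continuousM; [exact: continuous_wt|exact: continuous_Re_nl].
have c1 z : extdisk z -> {for z, continuous (fun z => wt z * complex.Re (nl z) ^+ 2)}.
  move=> ze; apply: continuousM; first exact: continuous_wt.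
  by apply: continuousM; exact: continuous_Re_nl.
have c2 z : extdisk z -> {for z, continuous (fun z => wt z * complex.Im (nl z) ^+ 2)}.
  move=> ze; apply: continuousM; first exact: continuous_wt.
  by apply: continuousM; exact: continuous_Im_nl.
have c3 z : extdisk z -> {for z, continuous (fun z => wt z * complex.Re (dnl z))}.
  by move=> ze; apply: continuousM; [exact: continuous_wt|exact: continuous_Re_dnl].
have ch z : extdisk z -> {for z, continuous h}.
  by move=> ze; apply: continuousD; [exact: c1|exact: c3].
have cdg z : extdisk z -> {for z, continuous dg}.
  by move=> ze; apply: continuousM; [exact: ch|exact: cmod_inv_cont].
have cm (s t : R) : 1 < s -> cmod (polar s t : C) = s.
  by move=> s1; rewrite cmod_polar gtr0_norm //; lra.
have H := @derive_rint_circle R f dg 1 (r + 1) 0 (2 * pi) r ler01 twopi.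
have D : is_derive r 1 mean1 (rint 0 (2 * pi) (fun t => dg (polar r t))).
  apply: H (gt1_itv r1).
  - by move=> s t /andP[s1 _]; apply: cdg; exact: ext_polar.
  - by move=> s t /andP[s1 _]; apply: cf; exact: ext_polar.
  - move=> s t /andP[s1 _]; rewrite /dg cm //.
    have s0 : s != 0 by rewrite gt_eqF //; lra.
    have D := is_deriveM (radial_wt t s1) (radial_nl t s1).
    apply: (@is_derive_eq _ _ _ _ _ _ _ _ D).
    by rewrite /h /GRing.scale /=; field.
apply: (@is_derive_eq _ _ _ _ _ _ _ _ D).
(* The integrand is the angular derivative of wt * Im nl. *)
have F0 : rint 0 (2 * pi) (fun t => wt (polar r t) * complex.Re (dnl (polar r t)) -
    wt (polar r t) * complex.Im (nl (polar r t)) ^+ 2) = 0.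
  pose F t := wt (polar r t) * complex.Im (nl (polar r t)).
  transitivity (F (2 * pi) - F 0).
    apply: (rint_FTC (F := F) twopi).
    - move=> t _; have DF := is_deriveM (angular_wt t r1) (angular_nl t r1).
      apply: (@is_derive_eq _ _ _ _ _ _ _ _ DF).
      by rewrite /GRing.scale /=; ring.
    - apply: (cont_arg (f := fun z => wt z * complex.Re (dnl z) - wt z * complex.Im (nl z) ^+ 2) r1).
      by move=> z ze; apply: continuousB; [exact: c3|exact: c2].
  have E : polar r (2 * pi) = polar r 0 :> C by rewrite -[RHS]polar_periodic add0r.
  by rewrite /F E subrr.
rewrite [RHS]mulrC -[mean2 r]addr0 -[X in _ + X]F0 /mean2 -rintD; last 2 first.
- apply: (cont_arg (f := fun z => wt z * cmod (nl z) ^+ 2) r1) => z ze.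
  apply: continuousM; first exact: continuous_wt.
  have cc : {for z, continuous (fun z => cmod (nl z))}.
    by apply: (@continuous_comp _ _ _ nl (@cmod R)); [exact: continuous_nl|exact: continuous_cmod].
  exact: (continuousM cc cc).
- apply: (cont_arg (f := fun z => wt z * complex.Re (dnl z) - wt z * complex.Im (nl z) ^+ 2) r1).
  by move=> z ze; apply: continuousB; [exact: c3|exact: c2].
rewrite -rintZ; last first.
  apply: (cont_arg (f := fun z => wt z * cmod (nl z) ^+ 2 +
    (wt z * complex.Re (dnl z) - wt z * complex.Im (nl z) ^+ 2)) r1) => z ze.
  apply: continuousD; last by apply: continuousB; [exact: c3|exact: c2].
  apply: continuousM; first exact: continuous_wt.
  have cc : {for z, continuous (fun z => cmod (nl z))}.
    by apply: (@continuous_comp _ _ _ nl (@cmod R)); [exact: continuous_nl|exact: continuous_cmod].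
  exact: (continuousM cc cc).
apply: eq_rint => t _; rewrite /dg cm // /h sqr_cmod; ring.
Qed.

Lemma derive_flux (r : R) : 1 < r ->
  is_derive r 1 flux (2 * r * mean0 r - sg r / r * mean2 r).
Proof.
move=> r1; have r0 : r != 0 by rewrite gt_eqF //; lra.
have D0 := derive_mean0 r1; have D1 := derive_mean1 r1.
have Ds : is_derive r 1 sg r.
  by apply: is_derive_eq; rewrite /GRing.scale /= /sg; field.
have Dq : is_derive r 1 (fun r : R => r ^+ 2) (2 * r).
  by apply: is_derive_eq; rewrite /GRing.scale /=; ring.
have D := is_deriveB (is_deriveM Dq D0) (is_deriveM Ds D1).
apply: (@is_derive_eq _ _ _ _ _ _ _ _ D).
by rewrite /GRing.scale /=; field.
Qed.

End Hardy.

(** * The energy of a box *)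

Section Boxes.
Context {R : realType}.
Local Notation C := (Cplx R).
Local Notation mu := (@lebesgue_measure R).

Variables (n : C -> C) (m M : R).
Hypothesis cn : forall z, extdisk z -> {for z, continuous n}.
Hypothesis hbox : large_boxes (fun B =>
  m <= haverage B (fun z => cmod (2 * n z / (hdensity z)%:C) ^+ 2) <= M).

(** The density with respect to area of the energy whose averages are bounded
    in [hbox]; the factor [hdensity] of the hyperbolic measure is included. *)
Definition en (z : C) : R := 4 * cmod (n z) ^+ 2 * sg (cmod z).

Lemma sg_gt0 (r : R) : 1 < r -> 0 < sg r.
Proof. by move=> r1; rewrite /sg divr_gt0 // subr_gt0; nra. Qed.

Lemma cmod_polar_ext (r t : R) : 1 < r -> cmod (polar r t : C) = r.
Proof. by move=> r1; rewrite cmod_polar gtr0_norm //; lra. Qed.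

Lemma extdisk_polar (r t : R) : 1 < r -> extdisk (polar r t : C).
Proof. by move=> r1; rewrite /extdisk /= cmod_polar_ext. Qed.

Lemma hdensityE (z : C) : hdensity z = (sg (cmod z))^-1.
Proof. by rewrite /hdensity /sg invf_div. Qed.

Lemma energyE (z : C) : extdisk z ->
  cmod (2 * n z / (hdensity z)%:C) ^+ 2 * hdensity z = en z.
Proof.
move=> ze; have s0 := sg_gt0 ze.
rewrite hdensityE !cmodM cmodV cmod_real gtr0_norm ?invr_gt0 // invrK.
have -> : cmod (2 : C) = 2.
  have -> : (2 : C) = (2 : R)%:C by apply: complexP; rewrite /= ?addr0.
  by rewrite cmod_real ger0_norm.
rewrite /en; set s := sg (cmod z) in s0 *; set c := cmod (n z); field.
by rewrite gt_eqF.
Qed.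

Lemma continuous_en z : extdisk z -> {for z, continuous en}.
Proof.
move=> ze; have cc : {for z, continuous (fun z => cmod (n z))}.
  by apply: (@continuous_comp _ _ _ n (@cmod R)); [exact: cn|exact: continuous_cmod].
have c4 : {for z, continuous (fun _ : C => 4 : R)} by exact: cst_continuous.
have cm := @continuous_cmod R z.
have cs : {for z, continuous (fun z : C => sg (cmod z))}.
  apply: (@continuous_comp _ _ _ (@cmod R) sg) => //.
  have : is_derive (cmod z) 1 (@sg R) (cmod z).
    by apply: is_derive_eq; rewrite /GRing.scale /= /sg; field.
  by move/is_derive_cont.
exact: (continuousM (continuousM c4 (continuousM cc cc)) cs).
Qed.

Lemma en_ge0 z : extdisk z -> 0 <= en z.
Proof. by move=> ze; rewrite mulr_ge0 ?(ltW (sg_gt0 ze)) // mulr_ge0 // sqr_ge0. Qed.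

Lemma continuous_hdensity z : extdisk z -> {for z, continuous (@hdensity R)}.
Proof.
move=> ze; have -> : @hdensity R = fun z => (sg (cmod z))^-1 by apply/funext => w; exact: hdensityE.
apply: continuousV; first by rewrite gt_eqF // sg_gt0.
apply: (@continuous_comp _ _ _ (@cmod R) sg); first exact: continuous_cmod.
have : is_derive (cmod z) 1 (@sg R) (cmod z).
  by apply: is_derive_eq; rewrite /GRing.scale /= /sg; field.
by move/is_derive_cont.
Qed.

Lemma rint_hdensity (r1 r2 t : R) : 1 < r1 -> r1 <= r2 ->
  rint r1 r2 (fun r => r * hdensity (polar r t : C)) = ln (sg r2) - ln (sg r1).
Proof.
move=> r11 r12; apply: (rint_FTC (F := fun r => ln (sg r)) r12) => r /andP[h1 h2].
  have r_gt1 : 1 < r by lra.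
  have Ds : is_derive r 1 (@sg R) r.
    by apply: is_derive_eq; rewrite /GRing.scale /= /sg; field.
  have D : is_derive r 1 (fun r => ln (sg r)) _ :=
    is_derive1_comp (is_derive1_ln (sg_gt0 r_gt1)) Ds.
  apply: (@is_derive_eq _ _ _ _ _ _ _ _ D).
  by rewrite hdensityE cmod_polar_ext // mulrC.
apply: continuousM; first exact: cvg_id.
apply: (@continuous_comp _ _ _ (fun r => polar r t : C) (@hdensity R)).
  exact: rder_cont (rder_polar_rad r t).
by apply: continuous_hdensity; apply: extdisk_polar; lra.
Qed.

(** The hypothesis on boxes, written with iterated integrals in polar
    coordinates.  The hyperbolic measure of a box is its angular width times the
    variation of [ln sg]. *)
Lemma box_bounds : exists n0 r0 : R, [/\ 1 < n0, 1 < r0 & forall r1 r2 t1 t2 : R,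
  1 < r1 -> r2 <= r0 -> n0 * (r1 - 1) <= r2 - 1 -> r2 - 1 <= t2 - t1 -> t2 - t1 < pi ->
  m * ((t2 - t1) * (ln (sg r2) - ln (sg r1))) <=
    rint t1 t2 (fun t => rint r1 r2 (fun r => r * en (polar r t))) <=
    M * ((t2 - t1) * (ln (sg r2) - ln (sg r1)))].
Proof.
have [n0 [r0 [n01 r01 H]]] := hbox; exists n0, r0; split=> // r1 r2 t1 t2 r11 r2r h1 h2 h3.
set W := (t2 - t1) * (ln (sg r2) - ln (sg r1)).
have r12 : r1 < r2 by nra.
have t12 : t1 < t2 by lra.
have p0 := @pi_gt0 R.
have {}H : m <= haverage (box r1 r2 t1 t2)
    (fun z : C => cmod (2 * n z / (hdensity z)%:C) ^+ 2) <= M.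
  apply: H.
  - by rewrite r11.
  - by apply/andP; split; lra.
  - by [].
  - by rewrite ler_pdivlMr // subr_gt0.
  - by [].
have r10 : 0 < r1 by lra.
have ext r t : r1 <= r <= r2 -> extdisk (polar r t : C).
  by move=> /andP[? ?]; apply: extdisk_polar; lra.
have denE : \int[(mu \x mu)%E]_(w in box r1 r2 t1 t2) hdensity (of_pair w) = W.
  rewrite (@box_integral R (@hdensity R)) //.
  - rewrite (@eq_rint _ _ _ _ (fun=> ln (sg r2) - ln (sg r1))).
      by rewrite rint_cst ?(ltW t12) // mulrC.
    by move=> t _; rewrite rint_hdensity // ltW.
  - by move=> r t hr; apply: continuous_hdensity; exact: ext.
  - move=> r t /andP[? ?]; rewrite hdensityE invr_ge0 ltW // sg_gt0 // cmod_polar_ext //; lra.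
have numE : \int[(mu \x mu)%E]_(w in box r1 r2 t1 t2)
    (cmod (2 * n (of_pair w) / (hdensity (of_pair w))%:C) ^+ 2 * hdensity (of_pair w)) =
    rint t1 t2 (fun t => rint r1 r2 (fun r => r * en (polar r t))).
  rewrite -(@box_integral R en) //; last 2 first.
  - by move=> r t hr; apply: continuous_en; exact: ext.
  - by move=> r t /andP[/ltW ? /ltW ?]; apply: en_ge0; apply: ext; apply/andP.
  apply: eq_Rintegral => w; rewrite inE => -[r [t [/andP[? ?] _ ->]]].
  by apply: energyE; apply: extdisk_polar; lra.
have W0 : 0 < W.
  rewrite mulr_gt0 ?subr_gt0 // ltr_ln ?posrE ?sg_gt0 //; last lra.
  by rewrite /sg ltr_pM2r ?invr_gt0 // ltrD2r; nra.
by move: H; rewrite /haverage denE numE ler_pdivlMr // ler_pdivrMr.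
Qed.

End Boxes.

(** * The Bloch bound *)

Section Bloch.
Context {R : realType}.
Local Notation C := (Cplx R).

Lemma atan_le_id (x : R) : 0 <= x -> atan x <= x.
Proof.
move=> x0.
have [c _] := @MVT_segment R (@atan R) (fun u => (1 + u ^+ 2)^-1) 0 x x0
  (fun u _ => is_derive1_atan u) (continuous_subspaceT (@continuous_atan R)).
rewrite atan0 !subr0 => ->; rewrite ler_piMl // invf_le1; last by rewrite ltr_wpDr ?sqr_ge0.
by rewrite lerDl sqr_ge0.
Qed.

Lemma norm_atan_le (x : R) : `|atan x| <= `|x|.
Proof.
have [x0|/ltW x0] := leP 0 x.
  by rewrite !ger0_norm ?atan_le_id // -(@atan0 R) le_atan.
have Nx : 0 <= - x by rewrite oppr_ge0.
have aNx : 0 <= atan (- x) by rewrite -(@atan0 R) le_atan.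
by rewrite -(normrN x) -(normrN (atan x)) -atanN !ger0_norm ?atan_le_id.
Qed.

(** A small disc about a point at distance [s] from the unit circle lies in a box of
    height and width comparable to [s]. *)
Lemma near_sector (r0 th s K : R) (v : C) : 0 < s -> 2 <= K -> r0 = 1 + s ->
  cmod v < s / 4 ->
  sector 0 (1 + s / 2) (1 + K * s) (th - K * s / 2) (th + K * s / 2) (polar r0 th + v).
Proof.
move=> s0 K2 r0E vs.
have r00 : 0 < r0 by lra.
pose w : C := r0%:C + polar 1 (- th) * v.
have v1 : cmod (polar 1 (- th) * v) < s / 4.
  by rewrite cmodM cmod_polar normr1 mul1r.
have zE : polar r0 th + v = polar 1 th * w.
  rewrite /w mulrDr mulrA polarM mulr1 subrr polar10 mul1r; congr (_ + _).
  by apply: complexP; rewrite !polarE; ring.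
have h1 := le_lt_trans (cmod_Re _) v1; have h2 := le_lt_trans (cmod_Im _) v1.
have Rew : 1 <= complex.Re w.
  by move: h1; rewrite /w cReD /= ltr_norml => /andP[? ?]; lra.
have Imw : `|complex.Im w| < s / 4 by rewrite /w cImD /= add0r.
have Re0 : 0 < complex.Re w by lra.
have wE := right_half_polar Re0; set ta := atan _ in wE.
have cw : `|cmod w - r0| < s / 4.
  have -> : r0 = cmod (r0%:C : C) by rewrite cmod_real gtr0_norm.
  by apply: le_lt_trans (cmod_dist _ _) _; rewrite /w addrC addKr.
have tas : `|ta| < s / 4.
  apply: le_lt_trans (norm_atan_le _) _; rewrite normrM normfV (gtr0_norm Re0).
  by apply: le_lt_trans Imw; rewrite ler_pdivrMr // ler_peMr.
have sK : 2 * s <= K * s by rewrite ler_pM2r.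
exists (cmod w), (th + ta); split.
- by move: cw; rewrite ltr_norml => /andP[? ?]; apply/andP; split; lra.
- by move: tas; rewrite ltr_norml => /andP[? ?]; apply/andP; split; lra.
- by rewrite add0r zE {1}wE polarM mul1r.
Qed.

(** Subharmonicity of [|f|^2] with a loss of a factor 2; it follows from the
    mean value property of [f^2]. *)
Lemma sub_mean (f : C -> C) (z0 : C) (s r : R) :
  (forall z, cmod (z - z0) < s -> exists l, cder f z l) -> 0 < r -> r < s ->
  pi * cmod (f z0) ^+ 2 <= rint 0 (2 * pi) (fun t => cmod (f (z0 + polar r t)) ^+ 2).
Proof.
move=> df r0 rs; have s0 : 0 < s by lra.
have cf z : cmod (z - z0) < s -> {for z, continuous f} by move=> /df[l /cder_cont].
have d2 z : cmod (z - z0) < s -> exists l, cder (fun z => f z * f z) z l.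
  by move=> /df[l h]; exists (l * f z + f z * l); exact: cderM.
have zz : cmod (z0 - z0) < s by rewrite subrr cmod0.
have MV := @mean_value R (fun z => f z * f z) z0 s r 0.
have {}MV : cint 0 (0 + 2 * pi) (fun t => f (z0 + polar r t) * f (z0 + polar r t)) =
    (2 * pi)%:C * (f z0 * f z0).
  apply: MV r0 rs; first by move=> z /andP[_ zs]; exact: d2.
  by apply: (continuousM (cf _ zz) (cf _ zz)).
have cc : cont_on 0 (2 * pi) (fun t => f (z0 + polar r t)).
  apply: cont_circle => t; apply: cf.
  by rewrite addrC addKr cmod_polar gtr0_norm.
rewrite add0r in MV.
have := cmod_cint_int (cont_onM cc cc); rewrite MV !cmodM cmod_real.
rewrite (gtr0_norm (@pi2_gt0 R)).
rewrite (@eq_rint _ _ _ (fun t => cmod (f (z0 + polar r t) * f (z0 + polar r t)))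
  (fun t => cmod (f (z0 + polar r t)) ^+ 2)); last by move=> t _; rewrite cmodM expr2.
rewrite expr2; move: (rint _ _ _) (cmod (f z0)) => A B; lra.
Qed.

(** The previous estimate integrated over radii between [s / 8] and [s / 4];
    the constant is the integral of [r] over that range, divided by [s^2]. *)
Lemma area_mean (f : C -> C) (z0 : C) (s c : R) :
  (forall z, cmod (z - z0) < s -> exists l, cder f z l) -> 0 < s -> 0 <= c ->
  c * (pi * cmod (f z0) ^+ 2 * (s ^+ 2 * (3 / 128))) <=
  rint 0 (2 * pi) (fun t => rint (s / 8) (s / 4)
    (fun r => r * (c * cmod (f (z0 + polar r t)) ^+ 2))).
Proof.
move=> df s0 c0.
have s8 : 0 < s / 8 by lra.
have s84 : s / 8 <= s / 4 by lra.
have s4 : s / 4 < s by lra.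
have tp : 0 <= 2 * pi :> R by have := @pi2_gt0 R; lra.
pose g z := c * cmod (f z) ^+ 2.
have cf z : cmod (z - z0) < s -> {for z, continuous f} by move=> /df[l /cder_cont].
have cg0 w : cmod (w - z0) < s -> {for w, continuous g}.
  move=> we; have cc : {for w, continuous (fun z => cmod (f z))}.
    by apply: (@continuous_comp _ _ _ f (@cmod R)); [exact: cf|exact: continuous_cmod].
  have c4 : {for w, continuous (fun _ : C => c)} by exact: cst_continuous.
  exact: (continuousM c4 (continuousM cc cc)).
have cg r t : 0 < r < s -> {for z0 + polar r t, continuous g}.
  by move=> /andP[r0 rs]; apply: cg0; rewrite addrC addKr cmod_polar gtr0_norm.
have g0 z : 0 <= g z by rewrite /g mulr_ge0 // sqr_ge0.
rewrite (@rint_polar_swap R g z0 0 s (s / 8) (s / 4) 0 (2 * pi) (lexx 0) s8 s84 s4 tp cg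
  (fun r t _ => g0 _)).
pose F := c * (pi * cmod (f z0) ^+ 2).
have -> : c * (pi * cmod (f z0) ^+ 2 * (s ^+ 2 * (3 / 128))) =
    rint (s / 8) (s / 4) (fun r => r * F).
  pose G (r : R) := r ^+ 2 / 2 * F.
  have dG r : s / 8 <= r <= s / 4 -> is_derive r 1 G (r * F).
    by move=> _; apply: is_derive_eq; rewrite /GRing.scale /=; field.
  rewrite (rint_FTC s84 dG); first by rewrite /G /F; field.
  by move=> r _; apply: continuousM; [exact: cvg_id|exact: cvg_cst].
apply: le_rint.
- by move=> r _; apply: continuousM; [exact: cvg_id|exact: cvg_cst].
- move=> r /andP[h1 h2]; apply: continuousM; first exact: cvg_id.
  apply: (@cont_rint_circle R g z0 0 s _ _ _ (lexx 0) tp cg).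
  by rewrite (lt_le_trans s8 h1) (le_lt_trans h2 s4).
- move=> r /andP[h1 h2]; have r0 := lt_le_trans s8 h1.
  apply: ler_wpM2l; first exact: ltW.
  rewrite /F /g rintZ; last first.
    move=> t _.
    have cc : {for t, continuous (fun t => cmod (f (z0 + polar r t)))}.
      apply: (@cont_polar_arg R (fun z => cmod (f z)) z0 r t).
      apply: (@continuous_comp _ _ _ f (@cmod R)); last exact: continuous_cmod.
      by apply: cf; rewrite addrC addKr cmod_polar gtr0_norm // (le_lt_trans h2).
    exact: (continuousM cc cc).
  apply: ler_wpM2l => //; apply: (@sub_mean f z0 s r) => //.
  exact: le_lt_trans h2 s4.
Qed.

(** Windows of length less than [pi] suffice, since four of them cover
    [[0, 2 pi]]. *)
Lemma rint_four (h : R -> R) (A : R) : (forall a b, cont_on a b h) ->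
  (forall a b, a < b -> b - a < pi -> rint a b h <= A) -> rint 0 (2 * pi) h <= 4 * A.
Proof.
move=> ch win; have p0 := @pi_gt0 R; have w := win; move: {win} w.
move: p0; move: (pi : R) => P P0 win.
have w1 := win 0 (P / 2); have w2 := win (P / 2) P.
have w3 := win P (P + P / 2); have w4 := win (P + P / 2) (2 * P).
have -> : rint 0 (2 * P) h =
    rint 0 (P / 2) h + (rint (P / 2) P h + (rint P (P + P / 2) h + rint (P + P / 2) (2 * P) h)).
  rewrite -(rint_split _ _ (ch P _)); [|lra|lra].
  rewrite -(rint_split _ _ (ch (P / 2) _)); [|lra|lra].
  by rewrite -(rint_split _ _ (ch 0 _)); [|lra|lra].
move: w1 w2 w3 w4; move: (rint _ _ _) (rint _ _ _) (rint _ _ _) (rint _ _ _) => a4 a3 a2 a1.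
move=> w1 w2 w3 w4; have {}w1 : a1 <= A by apply: w1; lra.
have {}w2 : a2 <= A by apply: w2; lra.
have {}w3 : a3 <= A by apply: w3; lra.
have {}w4 : a4 <= A by apply: w4; lra.
by lra.
Qed.

Variables (n : C -> C) (m M : R).
Hypothesis dn : forall z, extdisk z -> exists l, cder n z l.
Hypothesis m0 : 0 <= m.
Hypothesis mM : m <= M.
Hypothesis hbox : large_boxes (fun B =>
  m <= haverage B (fun z => cmod (2 * n z / (hdensity z)%:C) ^+ 2) <= M).

Let cn z : extdisk z -> {for z, continuous n}.
Proof. by move=> /dn[l /cder_cont]. Qed.

(** The energy bound [M] forces the non-linearity to satisfy a Bloch
    condition near the unit circle. *)
Lemma bloch_bound : exists c s0 : R, [/\ 0 < c, 0 < s0 &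
  forall z, 1 < cmod z < 1 + s0 -> cmod (n z) * (cmod z - 1) <= c].
Proof.
have [n0 [r0 [n01 r01 H]]] := box_bounds cn hbox.
(* The box has radii 1 + s / 2 and 1 + K s and width K s; K is chosen so that
   it is admissible and contains the disc of radius s / 4 about z. *)
pose K := 2 + n0; have K2 : 2 <= K by rewrite /K; lra.
have K0 : 0 < K by lra.
pose B := 43 * (M * K * ln (4 * K)).
have M0 : 0 <= M := le_trans m0 mM.
have l0 : 0 <= ln (4 * K) by apply: ln_ge0; lra.
have B0 : 0 <= B by rewrite /B !mulr_ge0 //; lra.
pose s0 := Num.min 1 (r0 - 1) / K.
have mi0 : 0 < Num.min 1 (r0 - 1) by rewrite lt_min ltr01 subr_gt0.
exists (1 + B), s0; split; [lra|by rewrite divr_gt0|].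
move=> z /andP[z1 z2]; pose s := cmod z - 1.
have sp : 0 < s by rewrite /s; lra.
have /andP[Ks1 Ks2] : (K * s < 1) && (K * s < r0 - 1).
  by rewrite -lt_min mulrC -ltr_pdivlMr // -/s0 /s; lra.
have ps2 := @pi_ge2 R.
have [th _ zE] := exists_polar z.
pose g0 z := 2 * s * cmod (n z) ^+ 2.
pose r1 := 1 + s / 2; pose r2 := 1 + K * s.
have r1E : r1 = 1 + s / 2 by [].
have r2E : r2 = 1 + K * s by [].
pose t1 := th - K * s / 2; pose t2 := th + K * s / 2.
have t12 : t2 - t1 = K * s by rewrite /t1 /t2; field.
have sK : 2 * s <= K * s by rewrite ler_pM2r.
have ext r t : r1 <= r <= r2 -> extdisk (polar r t : C).
  by move=> /andP[? _]; apply: extdisk_polar; lra.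
have extB v : cmod v < s -> extdisk (z + v).
  move=> vs; rewrite /extdisk /=; have := cmodB (z + v) v; rewrite addrK.
  by move: vs; rewrite /s; lra.
have cg0 w : extdisk w -> {for w, continuous g0}.
  move=> we; have cc : {for w, continuous (fun z => cmod (n z))}.
    by apply: (@continuous_comp _ _ _ n (@cmod R)); [exact: cn|exact: continuous_cmod].
  have c4 : {for w, continuous (fun _ : C => 2 * s : R)} by exact: cst_continuous.
  exact: (continuousM c4 (continuousM cc cc)).
have g00 w : 0 <= g0 w by rewrite /g0 mulr_ge0 ?sqr_ge0 // mulr_ge0 // ltW.
have cpol r t : 0 <= r -> cmod (polar r t : C) = r by move=> ?; rewrite cmod_polar ger0_norm.
have cgz r t : 0 < r < s -> {for z + polar r t, continuous g0}.
  by move=> /andP[? ?]; apply: cg0; apply: extB; rewrite cpol ?ltW.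
(* The energy of the big box. *)
pose A := rint t1 t2 (fun t => rint r1 r2 (fun r => r * en n (polar r t))).
have AE : A <= M * (K * s * ln (4 * K)).
  have := H r1 r2 t1 t2; rewrite t12 -/A => {}H.
  have {H} /andP[_] : m * (K * s * (ln (sg r2) - ln (sg r1))) <= A <=
      M * (K * s * (ln (sg r2) - ln (sg r1))).
    have ns : 0 < n0 * s by rewrite mulr_gt0 //; lra.
    apply: H; try lra.
    by rewrite r1E r2E /K; lra.
  move=> /le_trans; apply; apply: ler_wpM2l => //.
  apply: ler_wpM2l; first by rewrite mulr_ge0 // ltW.
  have sg1 : 0 < sg r1 by apply: sg_gt0; rewrite /r1; lra.
  have sg2 : 0 < sg r2 by apply: sg_gt0; rewrite r2E ltrDl mulr_gt0.
  rewrite lerBlDr -lnM ?posrE //; last lra.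
  rewrite ler_ln ?posrE //; last by rewrite mulr_gt0 //; lra.
  have Ksp : 0 < K * s by rewrite mulr_gt0.
  have h1 : (K * s) * (K * s) <= K * s by rewrite ger_pMl //; lra.
  have h2 : 0 <= K * s * s by rewrite mulr_ge0 // ltW.
  by rewrite /sg /r1 /r2; lra.
have bigE := @aint_sector R (en n) 0 r1 r2 t1 t2.
have {bigE} [cbig bigE] : cmeas ((EFin \o en n) \_ (sector 0 r1 r2 t1 t2)) /\
    aint ((EFin \o en n) \_ (sector 0 r1 r2 t1 t2)) = A%:E.
  have -> : A = rint t1 t2 (fun t => rint r1 r2 (fun r => r * en n (0 + polar r t))).
    by apply: eq_rint => t _; apply: eq_rint => r _; rewrite add0r.
  apply: bigE; [lra|lra|lra|lra| |].
  - by move=> r t hr; rewrite add0r; apply: continuous_en => //; exact: ext.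
  - move=> w [r [t [/andP[/ltW ? /ltW ?] _ ->]]]; rewrite add0r; apply: en_ge0.
    by apply: ext; apply/andP.
(* The part of a small annulus about z seen under an angle less than pi. *)
have win a b : a < b -> b - a < pi ->
  rint a b (fun t => rint (s / 8) (s / 4) (fun r => r * g0 (z + polar r t))) <= A.
  move=> ab bpi.
  have [||||||csm smE] := @aint_sector R g0 z (s / 8) (s / 4) a b; [lra|lra|exact: ab|exact: bpi| | |].
  - by move=> r t /andP[? ?]; apply: cgz; apply/andP; split; lra.
  - by move=> v _; exact: g00.
  rewrite -lee_fin -smE -bigE; apply: (le_aint csm cbig).
    by move=> w; apply: patch_ge0 => v _; exact: g00.
  move=> w; rewrite !patchE; case: ifPn => [/set_mem ws|_]; last first.
    by have := @patch_ge0 R (en n) (sector 0 r1 r2 t1 t2) w; rewrite patchE; apply=> v [r [t [/andP[/ltW ? /ltW ?] _ ->]]];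
      rewrite add0r; apply: en_ge0; apply: ext; apply/andP.
  have [r [t [/andP[h1 h2] _ wE]]] := ws.
  have cv : cmod (polar r t : C) < s / 4 by rewrite cpol //; lra.
  have wb : sector 0 r1 r2 t1 t2 w.
    rewrite wE zE; apply: near_sector => //; rewrite /s; lra.
  rewrite ifT; last exact: mem_set.
  rewrite lee_fin /g0 /en.
  have [r' [t' [/andP[/ltW h1' /ltW h2'] _ wE']]] := wb.
  have cw : cmod w = r' by rewrite wE' add0r cpol //; rewrite /r1 in h1'; lra.
  have : s / 2 <= sg (cmod w) by rewrite cw /sg; nra.
  have := sqr_ge0 (cmod (n w)).
  move: (cmod (n w) ^+ 2) (sg (cmod w)) => a2 b2 ? ?; nra.
pose h t := rint (s / 8) (s / 4) (fun r => r * g0 (z + polar r t)).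
have ch a b : cont_on a b h.
  move=> t _; apply: cont_rint_polar; [lra|lra|].
  by move=> r u /andP[? ?]; apply: cgz; apply/andP; split; lra.
have tot : rint 0 (2 * pi) h <= 4 * A := rint_four ch win.
have low : 2 * s * (pi * cmod (n z) ^+ 2 * (s ^+ 2 * (3 / 128))) <= rint 0 (2 * pi) h.
  apply: area_mean => //; last by rewrite mulr_ge0 // ltW.
  by move=> w ws; apply: dn; rewrite -[w](subrK z) addrC; exact: extB.
have fin : (cmod (n z) * s) ^+ 2 <= B.
  have E : 2 * s * (pi * cmod (n z) ^+ 2 * (s ^+ 2 * (3 / 128))) =
    s * (pi * (3 / 64)) * (cmod (n z) * s) ^+ 2 by field.
  rewrite E in low.
  have h1 : s * (pi * (3 / 64)) * (cmod (n z) * s) ^+ 2 <= s * (4 * (M * K * ln (4 * K))).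
    apply: le_trans low _; apply: le_trans tot _.
    apply: le_trans (_ : 4 * (M * (K * s * ln (4 * K))) <= _); first by rewrite ler_pM2l.
    by rewrite le_eqVlt; apply/orP; left; apply/eqP; ring.
  rewrite -mulrA ler_pM2l // in h1.
  have := sqr_ge0 (cmod (n z) * s); rewrite /B.
  move: h1 ps2; move: ((_ * s) ^+ 2) (M * K * ln _) pi => a b P h1 P2 a0.
  have : 2 * (3 / 64) * a <= P * (3 / 64) * a by rewrite ler_wpM2r // ler_pM2r //; lra.
  by lra.
have := mulr_ge0 (cmod_ge0 (n z)) (ltW sp); move: fin; rewrite /s.
move: (_ * _) => x; nra.
Qed.

End Bloch.

(** * Decomposition of an annulus into boxes *)

Section Tiles.
Context {R : realType}.
Local Notation C := (Cplx R).
Local Notation ii := (0 +i* 1 : C).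

Lemma rint_tiles (f g : R -> R) (w : R) (N : nat) : 0 <= w ->
  (forall a b, cont_on a b f) -> (forall a b, cont_on a b g) ->
  (forall a, rint a (a + w) f <= rint a (a + w) g) ->
  rint 0 (N%:R * w) f <= rint 0 (N%:R * w) g.
Proof.
move=> w0 cf cg H; elim: N => [|N IH]; first by rewrite mul0r !rint_point.
have E : N.+1%:R * w = N%:R * w + w by rewrite -natr1 mulrDl mul1r.
have Nw : 0 <= N%:R * w by rewrite mulr_ge0.
have Nw1 : N%:R * w <= N.+1%:R * w by rewrite E lerDl.
rewrite (rint_split Nw Nw1 (cf _ _)) (rint_split Nw Nw1 (cg _ _)) lerD //.
by rewrite E.
Qed.

(** The circle can be cut into [N] equal arcs of length between [s] and
    [2 s]. *)
Lemma tile_width (s : R) : 0 < s -> s <= 1 -> exists (N : nat) (w : R),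
  [/\ N%:R * w = 2 * pi, s <= w & w <= 2 * s].
Proof.
move=> s0 s1; have p2 := @pi_ge2 R.
have tp : 0 < 2 * pi :> R by exact: pi2_gt0.
have q0 : 0 <= 2 * pi / s by rewrite ltW // divr_gt0.
have /andP[h1 h2] := Num.Theory.truncn_itv q0.
set N := Num.truncn _ in h1 h2.
rewrite -natr1 in h2.
have q4 : 2 <= pi / s by rewrite ler_pdivlMr //; lra.
have qq : 2 * pi / s = pi / s + pi / s by ring.
have N0 : 0 < N%:R :> R by move: h1 h2 q4 qq; move: (pi / s) (2 * pi / s) => a b; lra.
exists N, (2 * pi / N%:R); split.
- by field; rewrite gt_eqF.
- by rewrite ler_pdivlMr // mulrC -ler_pdivlMr.
- rewrite ler_pdivrMr // -mulrA ler_pM2l // mulrC -ler_pdivrMr //.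
  by move: h1 h2 q4 qq; move: (pi / s) (2 * pi / s) => a b; lra.
Qed.

(** The elementary part of the comparison of two consecutive generations:
    [F1], [F2] are the values of [flux] at the inner and outer radius, [I] the
    mean at the outer radius, [X] the weighted energy of the annulus, [Z] the
    drift term and [o] the oscillation factor of the weight. *)
Lemma step_arith (F1 F2 I X Z Q e o l lr d m M : R) :
  0 < I -> 0 < o -> 0 <= e -> e < 1 -> 0 <= Q -> 0 <= m -> 0 <= M -> 0 <= l -> 0 <= d ->
  l <= lr -> lr <= l + d -> F1 - F2 = Q * X - Z -> 0 <= Z -> Z <= 4 * o * d * I ->
  X <= M * o ^+ 2 * lr * I -> m * lr * I <= o ^+ 2 * X ->
  (1 - e) * I <= F2 -> F2 <= (1 + 3 * d + e) * I ->
  F2 * (1 + Q * (m * l / (o ^+ 2 * (1 + 3 * d + e))) - 4 * o * d / (1 - e)) <= F1 /\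
  F1 <= F2 * (1 + Q * (M * o ^+ 2 * (l + d) / (1 - e))).
Proof.
move=> I0 o0 e0 e1 Q0 m0 M0 l0 d0 lr1 lr2 FD Z0 Z1 Xu Xl Fl Fu.
have e1' : 0 < 1 - e by lra.
have de : 0 < 1 + 3 * d + e by lra.
have o2 : 0 < o ^+ 2 by rewrite exprn_gt0.
have F2I : I <= F2 / (1 - e) by rewrite ler_pdivlMr // mulrC.
have IF2 : F2 / (1 + 3 * d + e) <= I by rewrite ler_pdivrMr // mulrC.
have X1 : X <= M * o ^+ 2 * (l + d) * (F2 / (1 - e)).
  apply: le_trans Xu _; apply: ler_pM => //.
  - by rewrite !mulr_ge0 //; lra.
  - by lra.
  - by apply: ler_wpM2l => //; rewrite mulr_ge0 // ltW.
have X2 : m * l / o ^+ 2 * (F2 / (1 + 3 * d + e)) <= X.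
  rewrite mulrAC ler_pdivrMr // [X * _]mulrC; apply: le_trans Xl.
  apply: (@le_trans _ _ (m * l * I)).
    by apply: ler_wpM2l => //; rewrite mulr_ge0.
  by apply: ler_wpM2r; [exact: ltW|exact: ler_wpM2l].
have Z2 : Z <= 4 * o * d * (F2 / (1 - e)).
  by apply: le_trans Z1 _; apply: ler_wpM2l => //; rewrite !mulr_ge0 // ltW.
have QX1 := ler_wpM2l Q0 X1; have QX2 := ler_wpM2l Q0 X2.
split.
  have -> : F2 * (1 + Q * (m * l / (o ^+ 2 * (1 + 3 * d + e))) - 4 * o * d / (1 - e)) =
      F2 + Q * (m * l / o ^+ 2 * (F2 / (1 + 3 * d + e))) - 4 * o * d * (F2 / (1 - e)).
    by field; rewrite !gt_eqF.
  by move: QX2 Z2 FD; move: (Q * (_ * _)) (4 * _ * _ * _) (Q * X) => *; lra.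
have -> : F2 * (1 + Q * (M * o ^+ 2 * (l + d) / (1 - e))) =
    F2 + Q * (M * o ^+ 2 * (l + d) * (F2 / (1 - e))).
  by field; rewrite gt_eqF.
by move: QX1 FD Z0; move: (Q * (_ * _ * _ * _)) (Q * X) => *; lra.
Qed.

Variables (L n dn : C -> C) (m M : R).
Hypothesis Ln : forall z, extdisk z -> cder L z (n z).
Hypothesis ndn : forall z, extdisk z -> cder n z (dn z).
Hypothesis cdn : forall z, extdisk z -> {for z, continuous dn}.

Let cn z : extdisk z -> {for z, continuous n}.
Proof. by move=> /ndn/cder_cont. Qed.

Let cwt p z : extdisk z -> {for z, continuous (wt L p)}.
Proof. by move=> ze; exact: (continuous_wt Ln ze). Qed.

(** The energy density weighted by [wt]. *)
Definition wten (p z : C) : R := wt L p z * en n z.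

Lemma continuous_wten p z : extdisk z -> {for z, continuous (wten p)}.
Proof. by move=> ze; apply: continuousM; [exact: cwt|exact: continuous_en]. Qed.

Lemma wt_gt0 p z : 0 < wt L p z. Proof. exact: expR_gt0. Qed.

Lemma wten_ge0 p z : extdisk z -> 0 <= wten p z.
Proof. by move=> ze; rewrite mulr_ge0 ?en_ge0 // ltW // wt_gt0. Qed.

Lemma cont_rint_polar0 (g : C -> R) (r1 r2 t : R) : 0 <= r1 -> r1 <= r2 ->
  (forall r t, r1 <= r <= r2 -> {for (polar r t : C), continuous g}) ->
  {for t, continuous (fun t => rint r1 r2 (fun r => r * g (polar r t)))}.
Proof.
move=> r10 r12 cg.
have -> : (fun t => rint r1 r2 (fun r => r * g (polar r t))) =
    (fun t => rint r1 r2 (fun r => r * g (0 + polar r t))).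
  by apply/funext => u; apply: eq_rint => r _; rewrite add0r.
by apply: cont_rint_polar => // r u; rewrite add0r; exact: cg.
Qed.

Lemma cont_mean (g : C -> R) (r : R) : 1 < r ->
  (forall z, extdisk z -> {for z, continuous g}) ->
  {for r, continuous (fun r => rint 0 (2 * pi) (fun t => g (polar r t)))}.
Proof.
move=> r1 cg.
have -> : (fun r => rint 0 (2 * pi) (fun t => g (polar r t))) =
    (fun r => rint 0 (2 * pi) (fun t => g (0 + polar r t))).
  by apply/funext => u; apply: eq_rint => t _; rewrite add0r.
apply: (@cont_rint_circle R g 0 1 (r + 1)) => //.
- by have := @pi2_gt0 R; lra.
- by move=> s t /andP[? _]; rewrite add0r; apply: cg; exact: extdisk_polar.
- by apply/andP; split; lra.
Qed.

Lemma cont_on_circle (g : C -> R) (r a b : R) : 1 < r ->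
  (forall z, extdisk z -> {for z, continuous g}) -> cont_on a b (fun t => g (polar r t)).
Proof.
move=> r1 cg t _; apply: (@continuous_comp _ _ _ (polar r) g); first exact: continuous_polar.
by apply: cg; exact: extdisk_polar.
Qed.

Lemma mean2E (p : C) (r : R) : 1 < r ->
  sg r / r * mean2 L n p r =
  cmod p ^+ 2 / 4 * (r * rint 0 (2 * pi) (fun t => wten p (polar r t))).
Proof.
move=> r1; have r0 : r != 0 by rewrite gt_eqF //; lra.
have cmn z : extdisk z -> {for z, continuous (fun z => cmod (nl n p z))}.
  move=> ze; apply: (@continuous_comp _ _ _ (nl n p) (@cmod R)); last exact: continuous_cmod.
  exact: cder_cont (cder_nl p ndn ze).
rewrite /mean2 -rintZ; last first.
  apply: (cont_on_circle (g := fun z => wt L p z * cmod (nl n p z) ^+ 2) r1) => z ze.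
  apply: continuousM; first exact: cwt.
  by apply: (continuousM (cmn z ze) (cmn z ze)).
rewrite mulrA -rintZ; last by apply: (cont_on_circle r1); exact: continuous_wten.
apply: eq_rint => t _.
rewrite /wten /en /nl !cmodM cmod_polar_ext //.
by move: (wt L p _) (cmod (n _)) (cmod p) (sg r) => A B D E; field.
Qed.

(** The variation of [flux] between two circles is [|p|^2 / 4] times the weighted
    energy of the annulus, up to a drift term. *)
Lemma flux_diff (p : C) (r1 r2 : R) : 1 < r1 -> r1 <= r2 ->
  flux L n p r1 - flux L n p r2 =
  cmod p ^+ 2 / 4 * rint 0 (2 * pi) (fun t => rint r1 r2 (fun r => r * wten p (polar r t)))
  - rint r1 r2 (fun r => 2 * r * mean0 L p r).
Proof.
move=> r11 r12.
have tp : 0 <= 2 * pi :> R by have := @pi2_gt0 R; lra.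
have r1r r : r1 <= r <= r2 -> 1 < r by move=> /andP[? _]; lra.
pose X r := rint 0 (2 * pi) (fun t => wten p (polar r t)).
have cX r : 1 < r -> {for r, continuous X}.
  by move=> ?; apply: cont_mean => // z; exact: continuous_wten.
have cr r : {for r, continuous (fun r : R => r)} by exact: cvg_id.
have crX : cont_on r1 r2 (fun r => r * X r).
  by move=> r /r1r hr; exact: (continuousM (cr r) (cX r hr)).
have swap : rint 0 (2 * pi) (fun t => rint r1 r2 (fun r => r * wten p (polar r t))) =
    rint r1 r2 (fun r => r * X r).
  have := @rint_polar_swap R (wten p) 0 1 (r2 + 1) r1 r2 0 (2 * pi) ler01 r11 r12 _ tp.
  rewrite ltrDl ltr01 => /(_ isT) H.
  transitivity (rint 0 (2 * pi) (fun t => rint r1 r2 (fun r => r * wten p (0 + polar r t)))).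
    by apply: eq_rint => t _; apply: eq_rint => r _; rewrite add0r.
  rewrite H.
  - by apply: eq_rint => r _; congr (_ * _); apply: eq_rint => t _; rewrite add0r.
  - by move=> r t /andP[? _]; rewrite add0r; apply: continuous_wten; exact: extdisk_polar.
  - by move=> r t hr; rewrite add0r; apply: wten_ge0; apply: extdisk_polar; exact: r1r hr.
have c0 : cont_on r1 r2 (fun r => 2 * r * mean0 L p r).
  move=> r /r1r hr; have ccst : {for r, continuous (fun _ : R => 2 : R)} by exact: cst_continuous.
  have cm : {for r, continuous (mean0 L p)} by apply: cont_mean => // z; exact: cwt.
  exact: (continuousM (continuousM ccst (cr r)) cm).
have cZ : cont_on r1 r2 (fun r => cmod p ^+ 2 / 4 * (r * X r)).
  move=> r hr; have ccst : {for r, continuous (fun _ : R => cmod p ^+ 2 / 4)} by exact: cst_continuous.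
  exact: (continuousM ccst (crX r hr)).
rewrite swap -rintZ // -rintB //.
have D r : r1 <= r <= r2 -> is_derive r 1 (fun r => - flux L n p r)
    (cmod p ^+ 2 / 4 * (r * X r) - 2 * r * mean0 L p r).
  move=> /r1r hr; have D := is_deriveN (derive_flux p Ln ndn cdn hr).
  apply: (@is_derive_eq _ _ _ _ _ _ _ _ D).
  by rewrite mean2E // opprB.
rewrite (rint_FTC r12 D); first by rewrite opprK addrC.
move=> r hr; exact: (continuousB (cZ r hr) (c0 r hr)).
Qed.

Variables (c s0 : R).
Hypothesis c_gt0 : 0 < c.
Hypothesis bloch : forall z, 1 < cmod z < 1 + s0 -> cmod (n z) * (cmod z - 1) <= c.

Lemma bloch_polar (r t s1 : R) : 0 < s1 -> 1 + s1 <= r -> r < 1 + s0 ->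
  cmod (n (polar r t)) <= c / s1.
Proof.
move=> s10 h1 h2; have r1 : 1 < r by lra.
have := bloch (z := polar r t); rewrite cmod_polar_ext // => /(_ _) H.
have {}H : cmod (n (polar r t)) * (r - 1) <= c by apply: H; rewrite r1.
rewrite ler_pdivlMr //; apply: le_trans H.
by apply: ler_wpM2l; [exact: cmod_ge0|lra].
Qed.

Lemma osc_radial (r r' t s1 : R) : 0 < s1 -> 1 + s1 <= r -> r <= r' -> r' < 1 + s0 ->
  cmod (L (polar r' t) - L (polar r t)) <= 2 * (c / s1) * (r' - r).
Proof.
move=> s10 h1 h2 h3.
have D u : r <= u <= r' -> rder (fun u => L (polar u t)) u (n (polar u t) * polar 1 t).
  move=> /andP[u1 u2]; apply: (@rder_comp R L (fun u => polar u t) u) (rder_polar_rad u t).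
  by apply: Ln; apply: extdisk_polar; lra.
apply: (rder_mvt h2 D) => u /andP[u1 u2].
rewrite cmodM cmod_polar normr1 mulr1; apply: bloch_polar => //; lra.
Qed.

Lemma osc_angular (r t t' s1 : R) : 0 < s1 -> 1 + s1 <= r -> r < 1 + s0 -> r <= 2 -> t <= t' ->
  cmod (L (polar r t') - L (polar r t)) <= 4 * (c / s1) * (t' - t).
Proof.
move=> s10 h1 h2 h3 h4.
have D u : t <= u <= t' -> rder (fun u => L (polar r u)) u (n (polar r u) * (ii * polar r u)).
  move=> _; apply: rder_comp (rder_polar_arg r u).
  by apply: Ln; apply: extdisk_polar; lra.
have -> : 4 * (c / s1) * (t' - t) = 2 * (2 * (c / s1)) * (t' - t) by ring.
apply: (rder_mvt h4 D) => u _.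
have ii1 : cmod ii = 1 by rewrite cmodE /= expr0n expr1n add0r sqrtr1.
rewrite !cmodM ii1 mul1r cmod_polar_ext; last lra.
have := bloch_polar u s10 h1 h2; have := cmod_ge0 (n (polar r u)).
move: (cmod _) (c / s1) => A B A0 AB.
rewrite mulrC; apply: ler_pM => //; lra.
Qed.

(** The oscillation of [L] on a box with radii [1 + s1], [1 + n0 * s1] and of
    width comparable to its height is bounded by the Bloch condition. *)
Lemma oscillation (n0 r r' t t' s1 : R) : 1 < n0 -> 0 < s1 ->
  n0 * s1 <= 1 -> n0 * s1 < s0 ->
  1 + s1 <= r <= 1 + n0 * s1 -> 1 + s1 <= r' <= 1 + n0 * s1 -> `|t - t'| <= 2 * (n0 * s1) ->
  cmod (L (polar r t) - L (polar r' t')) <= 10 * c * n0.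
Proof.
move=> n01 s10 a1 a2 /andP[h1 h2] /andP[h3 h4] tt.
have cs : 0 < c / s1 by rewrite divr_gt0.
have rad : cmod (L (polar r t) - L (polar r' t)) <= 2 * (c / s1) * (n0 * s1).
  have [rr|/ltW rr] := leP r' r.
    apply: le_trans (osc_radial t s10 h3 rr _) _; first lra.
    by apply: ler_wpM2l; [rewrite mulr_ge0 // ltW|lra].
  rewrite cmodBC; apply: le_trans (osc_radial t s10 h1 rr _) _; first lra.
  by apply: ler_wpM2l; [rewrite mulr_ge0 // ltW|lra].
have ang : cmod (L (polar r' t) - L (polar r' t')) <= 4 * (c / s1) * (2 * (n0 * s1)).
  have [rr|/ltW rr] := leP t' t.
    apply: le_trans (osc_angular s10 h3 _ _ rr) _; [lra|lra|].
    apply: ler_wpM2l; first by rewrite mulr_ge0 // ltW.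
    by apply: le_trans tt; exact: ler_norm.
  rewrite cmodBC; apply: le_trans (osc_angular s10 h3 _ _ rr) _; [lra|lra|].
  apply: ler_wpM2l; first by rewrite mulr_ge0 // ltW.
  by apply: le_trans tt; rewrite distrC; exact: ler_norm.
have E : 10 * c * n0 = 2 * (c / s1) * (n0 * s1) + 4 * (c / s1) * (2 * (n0 * s1)).
  by field; rewrite gt_eqF.
rewrite E -[L (polar r t)](subrK (L (polar r' t))) -addrA.
by apply: le_trans (cmodD _ _) _; exact: lerD.
Qed.

Lemma wt_oscillation (p : C) (n0 r r' t t' s1 : R) : 1 < n0 -> 0 < s1 ->
  n0 * s1 <= 1 -> n0 * s1 < s0 ->
  1 + s1 <= r <= 1 + n0 * s1 -> 1 + s1 <= r' <= 1 + n0 * s1 -> `|t - t'| <= 2 * (n0 * s1) ->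
  wt L p (polar r t) <= expR (10 * c * n0 * cmod p) * wt L p (polar r' t').
Proof.
move=> n01 s10 a1 a2 h1 h2 tt; have O := oscillation n01 s10 a1 a2 h1 h2 tt.
rewrite /wt -expRD ler_expR -lerBlDr.
have -> : complex.Re (p * L (polar r t)) - complex.Re (p * L (polar r' t')) =
    complex.Re (p * (L (polar r t) - L (polar r' t'))) by rewrite mulrBr cReD cReN.
apply: le_trans (ler_norm _) _; apply: le_trans (cmod_Re _) _.
rewrite cmodM mulrC; apply: ler_wpM2r => //; exact: cmod_ge0.
Qed.

Variables (n0 r0 : R).
Hypothesis n0_gt1 : 1 < n0.
Hypothesis m_ge0 : 0 <= m.
Hypothesis mM : m <= M.
Hypothesis boxes : forall r1 r2 t1 t2 : R,
  1 < r1 -> r2 <= r0 -> n0 * (r1 - 1) <= r2 - 1 -> r2 - 1 <= t2 - t1 -> t2 - t1 < pi ->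
  m * ((t2 - t1) * (ln (sg r2) - ln (sg r1))) <=
    rint t1 t2 (fun t => rint r1 r2 (fun r => r * en n (polar r t))) <=
    M * ((t2 - t1) * (ln (sg r2) - ln (sg r1))).

(** The factor by which the weight may vary on such a box. *)
Definition osc (p : C) : R := expR (10 * c * n0 * cmod p).

Lemma osc_gt0 p : 0 < osc p. Proof. exact: expR_gt0. Qed.

(** One generation of boxes lies between the circles of radii [1 + s] and
    [1 + n0 * s]. *)
Section Generation.
Variables (p : C) (s : R).
Hypothesis s_gt0 : 0 < s.
Hypothesis s_lt1 : n0 * s < 1.
Hypothesis s_s0 : n0 * s < s0.
Hypothesis s_r0 : 1 + n0 * s <= r0.

Let s_le1 : n0 * s <= 1. Proof. exact: ltW. Qed.

Let r1 := 1 + s.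
Let r2 := 1 + n0 * s.
Let lr := ln (sg r2) - ln (sg r1).

Lemma gen_lt : r1 < r2.
Proof. by rewrite /r1 /r2 ltrD2l ltr_pMl. Qed.

Let r1_gt1 : 1 < r1. Proof. by rewrite /r1 ltrDl. Qed.
Let r2_gt1 : 1 < r2. Proof. exact: lt_trans r1_gt1 gen_lt. Qed.

(** The hyperbolic height of a generation is [ln n0] up to [n0 * s]. *)
Lemma log_ratio : ln n0 <= lr <= ln n0 + n0 * s.
Proof.
have s1 : 0 < sg r1 by exact: sg_gt0.
have s2 : 0 < sg r2 by exact: sg_gt0.
have n00 : 0 < n0 by exact: lt_trans ltr01 n0_gt1.
have ss : s <= n0 * s by rewrite ler_peMl // ltW.
have n1 : 0 < n0 * sg r1 by exact: mulr_gt0.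
have e0 := expR_gt0 (n0 * s).
have n2 : 0 < n0 * expR (n0 * s) by exact: mulr_gt0.
have n3 : 0 < n0 * expR (n0 * s) * sg r1 by exact: mulr_gt0.
have ns0 : 0 < n0 * s by exact: mulr_gt0.
apply/andP; split.
  rewrite /lr lerBrDr -lnM ?posrE // ler_ln ?posrE //.
  have -> : n0 * sg r1 = n0 * s * (2 + s) / 2 by rewrite /sg /r1; field.
  have -> : sg r2 = n0 * s * (2 + n0 * s) / 2 by rewrite /sg /r2; field.
  by rewrite ler_pM2r ?invr_gt0 // ler_pM2l // lerD2l.
have e1 : 1 + n0 * s <= expR (n0 * s) by exact: expR_ge1Dx.
rewrite /lr lerBlDr -[n0 * s in leRHS]expRK -!lnM ?posrE //.
rewrite ler_ln ?posrE //.
have -> : sg r2 = n0 * s * (2 + n0 * s) / 2 by rewrite /sg /r2; field.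
have -> : n0 * expR (n0 * s) * sg r1 = n0 * s * (expR (n0 * s) * (2 + s)) / 2.
  by rewrite /sg /r1; field.
rewrite ler_pM2r ?invr_gt0 // ler_pM2l //.
have sp : 0 < s := s_gt0.
move: e1 e0; move: (expR _) => e e1 e0.
have : e * 2 <= e * (2 + s) by apply: ler_wpM2l; lra.
by lra.
Qed.

Let lr_ge0 : 0 <= lr.
Proof. by have /andP[+ _] := log_ratio; apply: le_trans; rewrite ln_ge0 // ltW. Qed.

Let ext (r t : R) : r1 <= r <= r2 -> extdisk (polar r t : C).
Proof. by move=> /andP[h _]; apply: extdisk_polar; exact: lt_le_trans r1_gt1 h. Qed.

Let r1_ge0 : 0 <= r1. Proof. by rewrite ltW // (lt_trans ltr01). Qed.

Let cont_inner (g : C -> R) (t : R) : (forall z, extdisk z -> {for z, continuous g}) ->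
  cont_on r1 r2 (fun r => r * g (polar r t)).
Proof.
move=> cg r hr; have cr : {for r, continuous (fun r : R => r)} by exact: cvg_id.
have cp : {for r, continuous (fun r => g (polar r t))}.
  apply: (@continuous_comp _ _ _ (fun r => polar r t : C) g).
    exact: rder_cont (rder_polar_rad r t).
  by apply: cg; exact: ext.
exact: (continuousM cr cp).
Qed.

Let cont_outer (g : C -> R) a b : (forall z, extdisk z -> {for z, continuous g}) ->
  cont_on a b (fun t => rint r1 r2 (fun r => r * g (polar r t))).
Proof.
move=> cg t _; apply: cont_rint_polar0 => //; first exact: ltW gen_lt.
by move=> r u hr; apply: cg; exact: ext.
Qed.

Section Tile.
Variables (a w : R).
Hypothesis w1 : n0 * s <= w.
Hypothesis w2 : w <= 2 * (n0 * s).

Let w_gt0 : 0 < w.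
Proof. by apply: lt_le_trans w1; rewrite mulr_gt0 // (lt_trans ltr01). Qed.

Let aw : a <= a + w. Proof. by rewrite lerDl ltW. Qed.

Let w_pi : w < pi.
Proof.
apply: le_lt_trans w2 _; apply: lt_le_trans (@pi_ge2 R).
by rewrite gtr_pMr.
Qed.

Let E := rint a (a + w) (fun t => rint r1 r2 (fun r => r * en n (polar r t))).

Let E_bounds : m * (w * lr) <= E <= M * (w * lr).
Proof.
have := @boxes r1 r2 a (a + w); rewrite -/E [a + w - a]addrAC subrr add0r; apply => //.
- by rewrite /r1 /r2 ![1 + _ - 1]addrAC !subrr !add0r.
- by rewrite /r2 [1 + _ - 1]addrAC subrr add0r.
Qed.

Let X := rint a (a + w) (fun t => rint r1 r2 (fun r => r * wten p (polar r t))).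
Let Y := rint a (a + w) (fun t => wt L p (polar r2 t)).

Let scaled (k : R) :
  rint a (a + w) (fun t => rint r1 r2 (fun r => r * (k * en n (polar r t)))) = k * E.
Proof.
have cen : forall z, extdisk z -> {for z, continuous (en n)} by move=> z; exact: continuous_en.
rewrite /E -rintZ; last exact: cont_outer.
apply: eq_rint => t _; rewrite -rintZ; last exact: cont_inner.
by apply: eq_rint => r _; rewrite mulrCA.
Qed.

Let cen k z : extdisk z -> {for z, continuous (fun z => k * en n z)}.
Proof.
move=> ze; have ck : {for z, continuous (fun _ : C => k)} by exact: cst_continuous.
exact: (continuousM ck (continuous_en cn ze)).
Qed.

Let inr (r t : R) : r1 <= r <= r2 -> a <= t <= a + w ->
  wt L p (polar r t) <= osc p * wt L p (polar r2 a) /\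
  wt L p (polar r2 a) <= osc p * wt L p (polar r t).
Proof.
move=> hr /andP[ta tb].
have h2 : r1 <= r2 <= r2 by rewrite lexx ltW // gen_lt.
have d1 : `|t - a| <= 2 * (n0 * s).
  by rewrite ger0_norm ?subr_ge0 //; apply: le_trans w2; rewrite lerBlDl.
have d2 : `|a - t| <= 2 * (n0 * s) by rewrite distrC.
split; first exact: (wt_oscillation p n0_gt1 s_gt0 s_le1 s_s0 hr h2 d1).
exact: (wt_oscillation p n0_gt1 s_gt0 s_le1 s_s0 h2 hr d2).
Qed.

Let inr2 (t : R) : r1 <= r2 <= r2. Proof. by rewrite lexx ltW // gen_lt. Qed.

(** The weight is replaced by its value at the corner [(r2, a)], at the cost
    of one factor [osc p], and then by its values on the outer arc at the cost of
    another one. *)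
Lemma tile_upper : X <= M * osc p ^+ 2 * lr * Y.
Proof.
have /andP[_ Eu] := E_bounds; have M_ge0 := le_trans m_ge0 mM.
have o0 := osc_gt0 p; have v0 := wt_gt0 p (polar r2 a).
pose k := osc p * wt L p (polar r2 a).
have k0 : 0 <= k by rewrite mulr_ge0 // ltW.
have XE : X <= k * E.
  rewrite -scaled; apply: le_rint.
  - by apply: cont_outer => z; exact: continuous_wten.
  - by apply: (cont_outer (@cen k)).
  - move=> t ht; apply: le_rint.
    + by apply: cont_inner => z; exact: continuous_wten.
    + by apply: (cont_inner (@cen k)).
    + move=> r hr; apply: ler_wpM2l.
        by case/andP: hr => h _; exact: le_trans r1_ge0 h.
      apply: ler_wpM2r; first by apply: en_ge0; exact: ext.
      by have [] := inr hr ht.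
have vY : wt L p (polar r2 a) * w <= osc p * Y.
  have -> : wt L p (polar r2 a) * w = rint a (a + w) (fun=> wt L p (polar r2 a)).
    by rewrite rint_cst // [a + w - a]addrAC subrr add0r.
  have cw : cont_on a (a + w) (fun t => wt L p (polar r2 t)) by apply: cont_on_circle => //; exact: cwt.
  rewrite /Y -rintZ //; apply: le_rint.
  - exact: cont_on_cst.
  - move=> t ht; have ck : {for t, continuous (fun _ : R => osc p)} by exact: cst_continuous.
    exact: (continuousM ck (cw t ht)).
  - by move=> t ht; have [] := inr (inr2 t) ht.
apply: le_trans XE _; apply: le_trans (ler_wpM2l k0 Eu) _.
have -> : k * (M * (w * lr)) = M * lr * osc p * (wt L p (polar r2 a) * w) by rewrite /k; ring.
have -> : M * osc p ^+ 2 * lr * Y = M * lr * osc p * (osc p * Y) by ring.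
by apply: ler_wpM2l => //; rewrite !mulr_ge0 // ltW.
Qed.

Lemma tile_lower : m * lr * Y <= osc p ^+ 2 * X.
Proof.
have /andP[El _] := E_bounds.
have o0 := osc_gt0 p; have v0 := wt_gt0 p (polar r2 a).
have XE : wt L p (polar r2 a) * E <= osc p * X.
  have cX z : extdisk z -> {for z, continuous (fun z => osc p * wten p z)}.
    move=> ze; have ck : {for z, continuous (fun _ : C => osc p)} by exact: cst_continuous.
    exact: (continuousM ck (@continuous_wten p z ze)).
  have -> : osc p * X = rint a (a + w) (fun t => rint r1 r2 (fun r => r * (osc p * wten p (polar r t)))).
    have cwe : forall z, extdisk z -> {for z, continuous (wten p)} by move=> z; exact: continuous_wten.
    rewrite /X -rintZ; last exact: cont_outer.
    apply: eq_rint => t _; rewrite -rintZ; last exact: cont_inner.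
    by apply: eq_rint => r _; rewrite mulrCA.
  rewrite -scaled; apply: le_rint.
  - by apply: (cont_outer (@cen _)).
  - by apply: (cont_outer cX).
  - move=> t ht; apply: le_rint.
    + by apply: (cont_inner (@cen _)).
    + by apply: (cont_inner cX).
    + move=> r hr; apply: ler_wpM2l.
        by case/andP: hr => h _; exact: le_trans r1_ge0 h.
      rewrite /wten mulrA; apply: ler_wpM2r; first by apply: en_ge0; exact: ext.
      by have [] := inr hr ht.
have vY : Y <= osc p * wt L p (polar r2 a) * w.
  have -> : osc p * wt L p (polar r2 a) * w = rint a (a + w) (fun=> osc p * wt L p (polar r2 a)).
    by rewrite rint_cst // [a + w - a]addrAC subrr add0r.
  apply: le_rint; [by apply: cont_on_circle => //; exact: cwt|exact: cont_on_cst|].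
  by move=> t ht; have [] := inr (inr2 t) ht.
have h1 : m * lr * Y <= m * lr * (osc p * wt L p (polar r2 a) * w).
  by apply: ler_wpM2l => //; rewrite mulr_ge0.
apply: le_trans h1 _.
have -> : m * lr * (osc p * wt L p (polar r2 a) * w) = osc p * (wt L p (polar r2 a) * (m * (w * lr))).
  by ring.
rewrite expr2 -mulrA; apply: ler_wpM2l; first exact: ltW.
by apply: le_trans XE; apply: ler_wpM2l => //; exact: ltW.
Qed.

End Tile.

(** The weighted energy of a generation, compared with the mean on its outer
    circle. *)
Lemma energy_bounds :
  let X := rint 0 (2 * pi) (fun t => rint r1 r2 (fun r => r * wten p (polar r t))) in
  X <= M * osc p ^+ 2 * lr * mean0 L p r2 /\ m * lr * mean0 L p r2 <= osc p ^+ 2 * X.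
Proof.
have n00 : 0 < n0 by exact: lt_trans ltr01 n0_gt1.
have [N [w [Nw w1 w2]]] := tile_width (mulr_gt0 n00 s_gt0) s_le1.
have w0 : 0 <= w by apply: le_trans w1; rewrite mulr_ge0 ?ltW.
have cw a b : cont_on a b (fun t => wt L p (polar r2 t)) by apply: cont_on_circle => //; exact: cwt.
have cY k a b : cont_on a b (fun t => k * wt L p (polar r2 t)).
  move=> t ht; have ck : {for t, continuous (fun _ : R => k)} by exact: cst_continuous.
  exact: (continuousM ck (cw a b t ht)).
have cX a b : cont_on a b (fun t => rint r1 r2 (fun r => r * wten p (polar r t))).
  by apply: cont_outer => z; exact: continuous_wten.
have cX2 a b : cont_on a b (fun t => osc p ^+ 2 * rint r1 r2 (fun r => r * wten p (polar r t))).
  move=> t ht; have ck : {for t, continuous (fun _ : R => osc p ^+ 2)} by exact: cst_continuous.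
  exact: (continuousM ck (cX a b t ht)).
move=> X; split.
  rewrite /mean0 -rintZ // /X -Nw; apply: rint_tiles => // a.
  by rewrite rintZ //; apply: tile_upper.
rewrite /mean0 -rintZ // /X -rintZ // -Nw; apply: rint_tiles => // a.
by rewrite !rintZ //; apply: tile_lower.
Qed.

Lemma mean0_gen (r : R) : r1 <= r <= r2 -> mean0 L p r <= osc p * mean0 L p r2.
Proof.
move=> hr; have h2 : r1 <= r2 <= r2 by rewrite lexx ltW // gen_lt.
have r_gt1 : 1 < r by case/andP: hr => h _; exact: lt_le_trans r1_gt1 h.
have cw x a b : 1 < x -> cont_on a b (fun t => wt L p (polar x t)).
  by move=> x1; apply: cont_on_circle => //; exact: cwt.
rewrite /mean0 -rintZ; last exact: cw.
apply: le_rint.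
- exact: cw.
- move=> t ht; have ck : {for t, continuous (fun _ : R => osc p)} by exact: cst_continuous.
  exact: (continuousM ck (cw r2 _ _ r2_gt1 t ht)).
- move=> t _; apply: (wt_oscillation p n0_gt1 s_gt0 s_le1 s_s0 hr h2).
  by rewrite subrr normr0 !mulr_ge0 ?ltW // (lt_trans ltr01).
Qed.

(** The drift is of the order of the Euclidean height of the generation. *)
Lemma drift_bound : rint r1 r2 (fun r => 2 * r * mean0 L p r) <=
  4 * osc p * (n0 * s) * mean0 L p r2.
Proof.
have n00 : 0 < n0 by exact: lt_trans ltr01 n0_gt1.
have sp : 0 < s := s_gt0.
have I2 : 0 <= mean0 L p r2 by apply: rint_ge0 => t _; exact: ltW (wt_gt0 _ _).
have o0 := osc_gt0 p.
pose K := 4 * (osc p * mean0 L p r2).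
have K0 : 0 <= K by rewrite /K !mulr_ge0 // ltW.
apply: (@le_trans _ _ (rint r1 r2 (fun=> K))).
  apply: le_rint.
  - move=> r /andP[h _]; have hr : 1 < r by exact: lt_le_trans r1_gt1 h.
    have ccst : {for r, continuous (fun _ : R => 2 : R)} by exact: cst_continuous.
    have cr : {for r, continuous (fun r : R => r)} by exact: cvg_id.
    have cm : {for r, continuous (mean0 L p)} by apply: cont_mean => // z; exact: cwt.
    exact: (continuousM (continuousM ccst cr) cm).
  - exact: cont_on_cst.
  - move=> r hr; have /andP[h1 h2] := hr.
    have r_gt0 : 0 < r by apply: lt_le_trans h1; exact: lt_trans ltr01 r1_gt1.
    have r22 : r <= 2 by apply: le_trans h2 _; rewrite /r2; move: s_le1; lra.
    apply: ler_pM; [by rewrite mulr_ge0 // ltW| |lra|exact: mean0_gen].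
    by apply: rint_ge0 => t _; exact: ltW (wt_gt0 _ _).
rewrite rint_cst ?(ltW gen_lt) //.
have -> : 4 * osc p * (n0 * s) * mean0 L p r2 = K * (n0 * s) by rewrite /K; ring.
apply: ler_wpM2l => //; rewrite /r1 /r2; lra.
Qed.

End Generation.

Lemma flux_mean0 (p : C) (r : R) : 1 < r -> r < 1 + s0 -> r <= 2 ->
  `|flux L n p r - r ^+ 2 * mean0 L p r| <= 3 * c * cmod p * mean0 L p r.
Proof.
move=> r1 r2 r3; rewrite /flux [_ - _ - _]addrAC subrr add0r normrN.
have sg0 := sg_gt0 r1.
have cre z : extdisk z -> {for z, continuous (fun z => wt L p z * complex.Re (nl n p z))}.
  move=> ze; apply: continuousM; first exact: cwt.
  exact: (@continuous_Re_nl R n dn p ndn z ze).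
have c1 := cont_on_circle (a := 0) (b := 2 * pi) r1 cre.
have csg : cont_on 0 (2 * pi)
    (fun t => sg r * (wt L p (polar r t) * complex.Re (nl n p (polar r t)))).
  move=> t ht; have ck : {for t, continuous (fun _ : R => sg r)} by exact: cst_continuous.
  exact: (continuousM ck (c1 t ht)).
have cw : cont_on 0 (2 * pi) (fun t => wt L p (polar r t)).
  by apply: cont_on_circle => //; exact: cwt.
rewrite /mean1 -rintZ // /mean0 -rintZ //.
apply: le_trans (ler_norm_rint csg) _; apply: le_rint.
- exact: cont_on_norm.
- move=> t ht; have ck : {for t, continuous (fun _ : R => 3 * c * cmod p)} by exact: cst_continuous.
  exact: (continuousM ck (cw t ht)).
- move=> t _; rewrite normrM (gtr0_norm sg0) normrM (gtr0_norm (wt_gt0 _ _)) mulrCA mulrC.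
  apply: ler_wpM2r; first exact: ltW (wt_gt0 _ _).
  apply: (@le_trans _ _ (sg r * cmod (nl n p (polar r t)))).
    by apply: ler_wpM2l; [exact: ltW|exact: cmod_Re].
  rewrite /nl !cmodM cmod_polar_ext //.
  have := bloch (z := polar r t); rewrite cmod_polar_ext // => H.
  have {}H : cmod (n (polar r t)) * (r - 1) <= c by apply: H; rewrite r1.
  have -> : sg r * (cmod p * (r * cmod (n (polar r t)))) =
    (r * (r + 1) / 2) * (cmod (n (polar r t)) * (r - 1)) * cmod p by rewrite /sg; field.
  apply: ler_wpM2r; first exact: cmod_ge0.
  have rr : 0 <= r * (r + 1) / 2 by rewrite divr_ge0 // mulr_ge0; lra.
  apply: ler_pM => //; first by rewrite mulr_ge0 ?cmod_ge0 //; lra.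
  have h1 : r * (r + 1) <= 2 * 3 by apply: ler_pM; lra.
  by move: h1; move: (r * (r + 1)) => A; lra.
Qed.

(** The weight is bounded below on the circle, as its inverse is the weight
    for [- p]. *)
Lemma mean0_gt0 (p : C) (r : R) : 1 < r -> 0 < mean0 L p r.
Proof.
move=> r1; have tp := @pi2_gt0 R.
have [||||B HB] := @polar_bounded_real R (wt L (- p)) 0 r r 0 (2 * pi); [lra|lra|lra| |].
  move=> r' t /andP[h1 h2]; rewrite add0r; apply: cwt; apply: extdisk_polar; lra.
have B1 t : 0 <= t <= 2 * pi -> (`|B| + 1)^-1 <= wt L p (polar r t).
  move=> ht; have := HB r t _ ht; rewrite lexx add0r => /(_ isT).
  rewrite /wt mulNr cReN expRN ger0_norm; last by rewrite invr_ge0 expR_ge0.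
  move=> h; have e0 := expR_gt0 (complex.Re (p * L (polar r t))).
  have b0 : 0 < `|B| + 1 by rewrite ltr_wpDl.
  rewrite -[leRHS]invrK lef_pV2 ?posrE ?invr_gt0 //.
  by apply: le_trans h _; apply: le_trans (ler_norm _) _; rewrite lerDl.
apply: (@lt_le_trans _ _ (rint 0 (2 * pi) (fun=> (`|B| + 1)^-1))).
  have b0 : 0 < (`|B| + 1)^-1 by rewrite invr_gt0 ltr_wpDl.
  by rewrite rint_cst ?(ltW tp) // subr0; exact: mulr_gt0 b0 tp.
apply: le_rint => //; first exact: cont_on_cst.
by apply: cont_on_circle => //; exact: cwt.
Qed.

Lemma flux_bounds (p : C) (r : R) : 1 < r -> r < 1 + s0 -> r <= 2 ->
  (1 - 3 * c * cmod p) * mean0 L p r <= flux L n p r /\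
  flux L n p r <= (r ^+ 2 + 3 * c * cmod p) * mean0 L p r.
Proof.
move=> r1 r2 r3; have I0 := mean0_gt0 p r1.
have rr : mean0 L p r <= r ^+ 2 * mean0 L p r.
  by apply: ler_peMl; [exact: ltW|apply: exprn_ege1; exact: ltW].
have := flux_mean0 p r1 r2 r3.
move: rr; move: (3 * c * cmod p) (mean0 L p r) (flux L n p r) => e I F rr.
rewrite ler_norml => /andP[h1 h2].
by split; rewrite mulrDl ?mul1r ?mulNr; lra.
Qed.

(** The effect of one generation on [flux]. *)
Lemma flux_step (p : C) (s d : R) : 0 < s -> n0 * s < 1 -> n0 * s < s0 -> 1 + n0 * s <= r0 ->
  n0 * s <= d -> 3 * c * cmod p < 1 ->
  flux L n p (1 + n0 * s) * (1 + cmod p ^+ 2 / 4 *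
    (m * ln n0 / (osc p ^+ 2 * (1 + 3 * d + 3 * c * cmod p))) -
      4 * osc p * d / (1 - 3 * c * cmod p)) <= flux L n p (1 + s) /\
  flux L n p (1 + s) <= flux L n p (1 + n0 * s) * (1 + cmod p ^+ 2 / 4 *
    (M * osc p ^+ 2 * (ln n0 + d) / (1 - 3 * c * cmod p))).
Proof.
move=> s_gt0 s1 ss0 sr0 sd eta1.
have n00 : 0 < n0 by exact: lt_trans ltr01 n0_gt1.
have r21 : 1 < 1 + n0 * s by rewrite ltrDl mulr_gt0.
have r11 : 1 < 1 + s by rewrite ltrDl.
have r12 := gen_lt s_gt0.
have ns0 : 0 < n0 * s by rewrite mulr_gt0.
have [Xu Xl] := energy_bounds p s_gt0 s1 ss0 sr0.
have /andP[lr1 lr2] := log_ratio s_gt0.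
have Z1 := drift_bound p s_gt0 s1 ss0.
have FD := flux_diff p r11 (ltW r12).
have Z0 : 0 <= rint (1 + s) (1 + n0 * s) (fun r => 2 * r * mean0 L p r).
  apply: rint_ge0 => r /andP[h _]; rewrite mulr_ge0 //; first by rewrite mulr_ge0 //; lra.
  by apply: rint_ge0 => t _; exact: ltW (wt_gt0 _ _).
have r22 : 1 + n0 * s <= 2 by lra.
have r2s : 1 + n0 * s < 1 + s0 by rewrite ltrD2l.
have [Fl Fu] := flux_bounds p r21 r2s r22.
have I0 := mean0_gt0 p r21.
have r2q : (1 + n0 * s) ^+ 2 <= 1 + 3 * d.
  rewrite expr2; move: s1 sd ns0; move: (n0 * s) => x x1 xd x0.
  have : x * x <= x by rewrite ger_pMl // ltW.
  by lra.
apply: (@step_arith _ _ (mean0 L p (1 + n0 * s))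
  (rint 0 (2 * pi) (fun t => rint (1 + s) (1 + n0 * s) (fun r => r * wten p (polar r t))))
  (rint (1 + s) (1 + n0 * s) (fun r => 2 * r * mean0 L p r)) _ _ _ _
  (ln (sg (1 + n0 * s)) - ln (sg (1 + s)))) => //.
- exact: osc_gt0.
- by rewrite !mulr_ge0 ?cmod_ge0 // ltW.
- by rewrite divr_ge0 // sqr_ge0.
- exact: le_trans m_ge0 mM.
- by rewrite ln_ge0 // ltW.
- by rewrite (le_trans _ sd) // ltW.
- by apply: le_trans lr2 _; rewrite lerD2l.
- apply: le_trans Z1 _; apply: ler_wpM2r; first exact: ltW.
  by apply: ler_wpM2l => //; rewrite mulr_ge0 // ltW // osc_gt0.
- by apply: le_trans Fu _; apply: ler_wpM2r; [exact: ltW|rewrite lerD2r].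
Qed.

End Tiles.

(** * Bounds for limits superior and inferior *)

Section LimSup.
Context {R : realType} {T : choiceType} {X : filteredType T}.
Implicit Types (f : X -> \bar R) (F : set_system X).

Lemma limf_esup_le f F (V : set X) (x : \bar R) : F V ->
  (forall t, V t -> (f t <= x)%E) -> (limf_esup f F <= x)%E.
Proof.
move=> FV fx; rewrite limf_esupE; apply: (@le_trans _ _ (ereal_sup (f @` V))).
  by apply: ereal_inf_lbound; exists V.
by apply: ge_ereal_sup => _ [t Vt <-]; exact: fx.
Qed.

Lemma limf_esup_ge f F (V : set X) (x : \bar R) : ProperFilter F -> F V ->
  (forall t, V t -> (x <= f t)%E) -> (x <= limf_esup f F)%E.
Proof.
move=> PF FV fx; rewrite limf_esupE; apply: le_ereal_inf_tmp => _ [W FW <-].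
have [t [Vt Wt]] := filter_ex (filterI FV FW).
by apply: (le_trans (fx t Vt)); apply: ereal_sup_ubound; exists t.
Qed.

Lemma limf_einf_ge f F (V : set X) (x : \bar R) : F V ->
  (forall t, V t -> (x <= f t)%E) -> (x <= limf_einf f F)%E.
Proof.
move=> FV fx; rewrite /limf_einf leeNr; apply: limf_esup_le FV _ => t Vt.
by rewrite leeN2; exact: fx.
Qed.

Lemma limf_einf_le_esup f F : ProperFilter F -> (limf_einf f F <= limf_esup f F)%E.
Proof.
move=> PF; rewrite limf_einfE limf_esupE; apply: ge_ereal_sup => _ [V FV <-].
apply: le_ereal_inf_tmp => _ [W FW <-].
have [t [Vt Wt]] := filter_ex (filterI FV FW).
apply: (@le_trans _ _ (f t)); first by apply: ereal_inf_lbound; exists t.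
by apply: ereal_sup_ubound; exists t.
Qed.

End LimSup.

(** * Growth deduced from a scaling inequality *)

Section Iteration.
Context {R : realType}.

Lemma expr_unbounded (x y : R) : 1 < x -> exists k : nat, y <= x ^+ k.
Proof.
move=> x1; have x0 : 0 < x - 1 by rewrite subr_gt0.
have bern k : 1 + k%:R * (x - 1) <= x ^+ k.
  elim: k => [|k IH]; first by rewrite mul0r addr0 expr0.
  have k0 : 0 <= k%:R * (x - 1) * (x - 1) by rewrite !mulr_ge0 // ltW.
  rewrite exprS -natr1; apply: (@le_trans _ _ (x * (1 + k%:R * (x - 1)))).
    by move: k0; move: (k%:R) => K; lra.
  by apply: ler_wpM2l; lra.
exists (Num.truncn (`|y| / (x - 1))).+1; apply: le_trans (bern _).
have h : `|y| / (x - 1) < (Num.truncn (`|y| / (x - 1))).+1%:R.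
  have q0 : 0 <= `|y| / (x - 1) by rewrite divr_ge0 // ltW.
  by have /andP[] := Num.Theory.truncn_itv q0.
rewrite ltr_pdivrMr // in h; apply: le_trans (ler_norm y) _.
by apply: le_trans (ltW h) _; rewrite lerDr.
Qed.

(** A bound on one fundamental interval of the scaling [s |-> s / n0]
    propagates to all small [s]. *)
Lemma scale_iterate (f : R -> R) (n0 s0 B : R) : 1 < n0 -> 0 < s0 ->
  (forall s, 0 < s <= s0 -> f (s / n0) <= f s) ->
  (forall s, s0 / n0 <= s <= s0 -> f s <= B) ->
  forall s, 0 < s <= s0 -> f s <= B.
Proof.
move=> n01 s00 fs fB.
have n00 : 0 < n0 by lra.
have H k : forall s, s0 <= s * n0 ^+ k.+1 -> s <= s0 -> f s <= B.
  elim: k => [|k IH] s h1 h2.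
    by apply: fB; rewrite h2 andbT ler_pdivrMr // -[n0]expr1.
  have [h|h] := leP (s0 / n0) s; first by apply: fB; rewrite h.
  have ns : s * n0 <= s0 by rewrite ltW // -ltr_pdivlMr.
  have sE : s = s * n0 / n0 by field; rewrite gt_eqF.
  have s_gt0 : 0 < s.
    by rewrite -(pmulr_lgt0 _ (exprn_gt0 k.+2 n00)); exact: lt_le_trans h1.
  rewrite sE; apply: le_trans (fs _ _) _; first by rewrite ns mulr_gt0.
  by apply: IH => //; rewrite -mulrA -exprS.
move=> s /andP[sp ss]; have [k kP] := expr_unbounded (s0 / s) n01.
apply: (H k s) => //; rewrite mulrC -ler_pdivrMr //; apply: le_trans kP _.
by rewrite exprS ler_peMl ?ltW // exprn_gt0.
Qed.

Lemma cont_on_bounded (f : R -> R) (a b : R) : cont_on a b f ->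
  exists B, forall s, a <= s <= b -> f s <= B.
Proof.
move=> cf; have [ab|ba] := leP a b; last first.
  by exists 0 => s /andP[h1 h2]; have := le_lt_trans (le_trans h1 h2) ba; rewrite ltxx.
have [c _ cP] := EVT_max ab (cont_on_within cf).
by exists (f c) => s hs; apply: cP; rewrite in_itv.
Qed.

(** The function [ln (F s) + b * ln s] does not increase under the scaling
    [s |-> s / n0]. *)
Lemma growth_upper (F : R -> R) (n0 s0 b : R) : 1 < n0 -> 0 < s0 ->
  (forall s, 0 < s <= s0 -> 0 < F s) -> (forall s, 0 < s <= s0 -> {for s, continuous F}) ->
  (forall s, 0 < s <= s0 -> F (s / n0) <= F s * expR (b * ln n0)) ->
  exists D, forall s, 0 < s <= s0 -> ln (F s) <= D - b * ln s.
Proof.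
move=> n01 s00 F0 cF FS; have n00 : 0 < n0 by lra.
pose f s := ln (F s) + b * ln s.
have dn s : 0 < s <= s0 -> 0 < s / n0 <= s0.
  move=> /andP[h1 h2]; rewrite divr_gt0 //= ler_pdivrMr //; apply: le_trans h2 _.
  by rewrite ler_peMr // ltW.
have [B HB] : exists B, forall s, s0 / n0 <= s <= s0 -> f s <= B.
  apply: cont_on_bounded => s /andP[h1 h2].
  have s_gt0 : 0 < s by apply: lt_le_trans h1; rewrite divr_gt0.
  have c1 : {for s, continuous (fun s => ln (F s))}.
    apply: (@continuous_comp _ _ _ F (@ln R)); first by apply: cF; rewrite s_gt0.
    by apply: continuous_ln; apply: F0; rewrite s_gt0.
  have c2 : {for s, continuous (@ln R)} by exact: continuous_ln.
  have cb : {for s, continuous (fun _ : R => b)} by exact: cst_continuous.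
  exact: (continuousD c1 (continuousM cb c2)).
exists B => s hs; rewrite lerBrDr.
apply: (@scale_iterate f n0 s0 B) => // x hx; have /andP[x0 _] := hx.
have Fx := F0 x hx; have Fd := F0 _ (dn x hx).
rewrite /f ln_div ?posrE //.
have : ln (F (x / n0)) <= ln (F x * expR (b * ln n0)).
  by rewrite ler_ln ?posrE ?FS // mulr_gt0 // expR_gt0.
rewrite lnM ?posrE ?expR_gt0 // expRK mulrBr; lra.
Qed.

Lemma growth_lower (F : R -> R) (n0 s0 b : R) : 1 < n0 -> 0 < s0 ->
  (forall s, 0 < s <= s0 -> 0 < F s) -> (forall s, 0 < s <= s0 -> {for s, continuous F}) ->
  (forall s, 0 < s <= s0 -> F s * expR (b * ln n0) <= F (s / n0)) ->
  exists D, forall s, 0 < s <= s0 -> D - b * ln s <= ln (F s).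
Proof.
move=> n01 s00 F0 cF FS; have n00 : 0 < n0 by lra.
have F0' s : 0 < s <= s0 -> 0 < (F s)^-1 by move=> hs; rewrite invr_gt0 F0.
have cF' s : 0 < s <= s0 -> {for s, continuous (fun s => (F s)^-1)}.
  by move=> hs; apply: continuousV; [rewrite gt_eqF // F0|exact: cF].
have FS' s : 0 < s <= s0 -> (F (s / n0))^-1 <= (F s)^-1 * expR (- b * ln n0).
  move=> hs; have hd : 0 < s / n0 <= s0.
    have /andP[h1 h2] := hs; rewrite divr_gt0 //= ler_pdivrMr //; apply: le_trans h2 _.
    by rewrite ler_peMr // ltW.
  have Fx := F0 s hs; have Fd := F0 _ hd.
  rewrite mulNr expRN -invfM lef_pV2 ?posrE ?FS //.
  by rewrite mulr_gt0 // expR_gt0.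
have [D HD] := growth_upper n01 s00 F0' cF' FS'.
exists (- D) => s hs; have := HD s hs; rewrite lnV ?posrE ?F0 // mulNr.
by lra.
Qed.

End Iteration.

(** * The growth factors as p tends to 0 *)

Section Rates.
Context {R : realType}.

Lemma near_lt (f : R -> R) (x y : R) : {for x, continuous f} -> f x < y ->
  exists2 d, 0 < d & forall u, `|u - x| < d -> f u < y.
Proof.
move=> cf fy; have H := @cvgr_lt R _ (nbhs x) _ f (f x) cf y fy.
have [d d0 dP] := (nbhs_ballP _ _).1 (H (nbhs_filter x)).
by exists d => // u ux; apply: dP; rewrite /ball /= distrC.
Qed.

Let cstc (k x : R) : {for x, continuous (fun _ : R => k)}. Proof. exact: cst_continuous. Qed.

Let idc (x : R) : {for x, continuous (fun q : R => q)}. Proof. exact: cvg_id. Qed.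

Let expc (k x : R) : {for x, continuous (fun q : R => expR (k * q))}.
Proof.
apply: (@continuous_comp _ _ _ (fun q : R => k * q) expR); last exact: continuous_expR.
exact: (continuousM (@cstc k x) (@idc x)).
Qed.

(** As [q] tends to 0, the factor on the left is
    [1 + q^2 / 4 * (M * l + o(1))].  The number [q] stands for [|p|], and the
    outer radius of a generation is at most [1 + q^3]. *)
Lemma rate_upper (M c k l e : R) : 0 < l -> 0 < e ->
  exists2 q1, 0 < q1 & forall q, 0 < q < q1 ->
  1 + q ^+ 2 / 4 * (M * expR (k * q) ^+ 2 * (l + q ^+ 3) / (1 - 3 * c * q)) <=
  expR (q ^+ 2 / 4 * (M + e) * l).
Proof.
move=> l0 e0.
pose U q := M * (expR (k * q) * expR (k * q)) * (l + q * q * q) / (1 - 3 * c * q).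
have cU : {for 0, continuous U}.
  have i0 := @idc 0; have E0 := @expc k 0.
  have cl : {for 0, continuous (fun q : R => l + q * q * q)} :=
    continuousD (@cstc l 0) (continuousM (continuousM i0 i0) i0).
  have cd : {for 0, continuous (fun q : R => 1 - 3 * c * q)} :=
    continuousB (@cstc 1 0) (continuousM (@cstc (3 * c) 0) i0).
  apply: (continuousM (continuousM (continuousM (@cstc M 0) (continuousM E0 E0)) cl)).
  have nz : 1 - 3 * c * 0 != 0 :> R by rewrite mulr0 subr0 oner_neq0.
  by apply: continuousV; [exact: nz|exact: cd].
have U0 : U 0 < (M + e) * l.
  rewrite /U !mulr0 expR0 !mulr1 addr0 subr0 divr1 mulrDl.
  by rewrite ltrDl mulr_gt0.
have [d d0 dP] := near_lt cU U0; exists d => // q /andP[q0 qd].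
have := dP q; rewrite subr0 gtr0_norm // => /(_ qd) Uq.
apply: le_trans (expR_ge1Dx _); rewrite lerD2l -[leRHS]mulrA.
apply: ler_wpM2l; first by rewrite divr_ge0 // sqr_ge0.
by apply: le_trans (ltW Uq); rewrite /U !exprS !expr0 !mulr1 !mulrA.
Qed.

(** The drift term contributes [O(q^3)], which is negligible with respect to
    [q^2]. *)
Lemma rate_lower (m c k l e : R) : 0 < l -> 0 < e ->
  exists2 q1, 0 < q1 & forall q, 0 < q < q1 ->
  expR (q ^+ 2 / 4 * (m - e) * l) <=
  1 + q ^+ 2 / 4 * (m * l / (expR (k * q) ^+ 2 * (1 + 3 * q ^+ 3 + 3 * c * q))) -
    4 * expR (k * q) * q ^+ 3 / (1 - 3 * c * q).
Proof.
move=> l0 e0.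
pose A q := expR (k * q) * expR (k * q) * (1 + 3 * (q * q * q) + 3 * c * q).
pose B q := m * l / A q - 16 * expR (k * q) * q / (1 - 3 * c * q).
pose D q := 1 + q * q / 4 * B q.
pose H q := B q / D q.
have i0 := @idc 0; have E0 := @expc k 0.
have cA : {for 0, continuous A}.
  have c1 := continuousM (@cstc 3 0) (continuousM (continuousM i0 i0) i0).
  have c2 := continuousM (@cstc (3 * c) 0) i0.
  exact: (continuousM (continuousM E0 E0) (continuousD (continuousD (@cstc 1 0) c1) c2)).
have A0 : A 0 = 1 by rewrite /A !mulr0 expR0 !addr0 !mulr1.
have cB : {for 0, continuous B}.
  have cd : {for 0, continuous (fun q : R => 1 - 3 * c * q)} :=
    continuousB (@cstc 1 0) (continuousM (@cstc (3 * c) 0) i0).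
  have ciA : {for 0, continuous (fun q => (A q)^-1)}.
    have nz : A 0 != 0 by rewrite A0 oner_neq0.
    by apply: continuousV; [exact: nz|exact: cA].
  have cid : {for 0, continuous (fun q : R => (1 - 3 * c * q)^-1)}.
    have nz : 1 - 3 * c * 0 != 0 :> R by rewrite mulr0 subr0 oner_neq0.
    by apply: continuousV; [exact: nz|exact: cd].
  exact: (continuousB (continuousM (@cstc (m * l) 0) ciA)
    (continuousM (continuousM (continuousM (@cstc 16 0) E0) i0) cid)).
have B0 : B 0 = m * l by rewrite /B A0 !mulr0 mul0r subr0 divr1.
have cD : {for 0, continuous D}.
  exact: (continuousD (@cstc 1 0)
    (continuousM (continuousM (continuousM i0 i0) (@cstc 4^-1 0)) cB)).
have D0 : D 0 = 1 by rewrite /D !mul0r addr0.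
have cH : {for 0, continuous (fun q => - H q)}.
  have ciD : {for 0, continuous (fun q => (D q)^-1)}.
    have nz : D 0 != 0 by rewrite D0 oner_neq0.
    by apply: continuousV; [exact: nz|exact: cD].
  exact: (continuousN (continuousM cB ciD)).
have H0 : - H 0 < - ((m - e) * l).
  by rewrite /H B0 D0 divr1 ltrN2 mulrBl ltrBlDr ltrDl mulr_gt0.
have ND0 : - D 0 < 0 by rewrite D0 oppr_lt0.
have [d1 d10 dP1] := near_lt cH H0.
have [d2 d20 dP2] := near_lt (continuousN cD) ND0.
exists (Num.min d1 d2); first by rewrite lt_min d10.
move=> q /andP[q0]; rewrite lt_min => /andP[qd1 qd2].
have := dP1 q; rewrite subr0 gtr0_norm // => /(_ qd1); rewrite ltrN2 => Hq.
have := dP2 q; rewrite subr0 gtr0_norm // => /(_ qd2); rewrite oppr_lt0 => Dq.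
have -> : 1 + q ^+ 2 / 4 * (m * l / (expR (k * q) ^+ 2 * (1 + 3 * q ^+ 3 + 3 * c * q))) -
    4 * expR (k * q) * q ^+ 3 / (1 - 3 * c * q) = D q.
  rewrite /D /B /A !exprS !expr0 !mulr1.
  rewrite [q * (q * q)]mulrA.
  move: (expR _) ((_ * _ * _)^-1) ((1 - _)^-1) => E a b; by field.
(* Here D q = 1 + x with x = q^2 / 4 * B q, and exp (x / (1 + x)) <= 1 + x. *)
apply: (@le_trans _ _ (expR (q * q / 4 * H q))).
  rewrite ler_expR expr2 -[leLHS]mulrA; apply: ler_wpM2l; last exact: ltW.
  by rewrite divr_ge0 // mulr_ge0 // ltW.
have h := expR_ge1Dx (- (q * q / 4 * H q)).
have E : 1 + - (q * q / 4 * H q) = (D q)^-1.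
  have DE : D q = 1 + q * q / 4 * B q by [].
  rewrite /H; move: DE; move: (D q) (B q) Dq => d b dd DE.
  have -> : q * q / 4 * (b / d) = (q * q / 4 * b) / d by rewrite mulrA.
  have -> : q * q / 4 * b = d - 1 by rewrite DE addrC addKr.
  by field; rewrite gt_eqF.
rewrite E expRN lef_pV2 ?posrE ?expR_gt0 // in h.
Qed.

End Rates.

(** * The integral means spectrum near the origin *)

Section Spectrum.
Context {R : realType}.
Local Notation C := (Cplx R).

Let right_itv (s : R) : 0 < s -> 1^'+ [set r : R | 1 < r < 1 + s].
Proof.
move=> s0; have h : 1 < 1 + s by rewrite ltrDl.
have FF : Filter (1 : R)^'+ by exact: at_right_proper_filter.
have H : (1 : R)^'+ [set r | 1 < r /\ r < 1 + s].
  by apply: (@filterI _ _ FF); [exact: nbhs_right_gt|exact: nbhs_right_lt].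
by apply: (@filterS _ _ FF _ _ _ H) => r [h1 h2] /=; rewrite h1.
Qed.

(* Near 1 the logarithm of 1 / (r - 1) exceeds any constant. *)
Let small_log (D e s0 : R) : 0 < e -> 0 < s0 -> exists2 s1, 0 < s1 & forall r, 1 < r < 1 + s1 ->
  [/\ 0 < r - 1 <= s0, 0 < ln (r - 1)^-1, ln (r - 1)^-1 = - ln (r - 1) &
      `|D| <= e * ln (r - 1)^-1].
Proof.
move=> e0 s00; pose s1 := Num.min s0 (Num.min 2^-1 (expR (- (`|D| / e)))).
exists s1; first by rewrite !lt_min s00 expR_gt0 invr_gt0 ltr0n.
move=> r /andP[r1]; rewrite -ltrBlDl !lt_min => /and3P[h1 h2 h3].
have r0 : 0 < r - 1 by rewrite subr_gt0.
have lE : ln (r - 1)^-1 = - ln (r - 1) by rewrite lnV // posrE.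
have l3 : ln (r - 1) < - (`|D| / e) by rewrite -ltr_expR lnK.
have l2 : ln (r - 1) < 0 by apply: ln_lt0; rewrite r0 /=; lra.
split=> //; first by rewrite r0 ltW.
  by rewrite lE oppr_gt0.
by rewrite lE mulrC -ler_pdivrMr // lerNr ltW.
Qed.

Lemma beta_upper (phi : C -> C) (p : C) (b D s0 : R) : 0 < s0 ->
  (forall s, 0 < s <= s0 -> ln (circle_mean phi p (1 + s)) <= D - b * ln s) ->
  (beta phi p <= b%:E)%E.
Proof.
move=> s00 H; apply/lee_addgt0Pr => e e0.
have [s1 s10 s1P] := small_log D e0 s00.
apply: limf_esup_le (right_itv s10) _ => r /s1P[h1 h2 h3 h4].
rewrite -EFinD lee_fin ler_pdivrMr //.
have := H _ h1; rewrite addrC subrK => /le_trans; apply.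
have := le_trans (ler_norm D) h4.
by move: h3; move: (ln _) (ln _) => x y -> h; rewrite mulrDl mulrN; lra.
Qed.

Lemma beta_lower (phi : C -> C) (p : C) (b D s0 : R) : 0 < s0 ->
  (forall s, 0 < s <= s0 -> D - b * ln s <= ln (circle_mean phi p (1 + s))) ->
  (b%:E <= beta phi p)%E.
Proof.
move=> s00 H; apply/lee_addgt0Pr => e e0; rewrite -leeBlDr //.
have [s1 s10 s1P] := small_log D e0 s00.
apply: limf_esup_ge (right_itv s10) _ => r /s1P[h1 h2 h3 h4].
rewrite -EFinB lee_fin ler_pdivlMr //.
have := H _ h1; rewrite [1 + _]addrC subrK; apply: le_trans.
have := le_trans (ler_norm (- D)) _; rewrite normrN => /(_ _ h4).
by move: h3; move: (ln _) (ln _) => x y -> h; rewrite mulrBl mulrN; lra.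
Qed.

Lemma circle_meanE (phi : C -> C) (p : C) (r : R) :
  circle_mean phi p r = mean0 (log_derive phi) p r.
Proof. by apply: eq_Rintegral => t _; rewrite /derive_pow cmod_cexp. Qed.

Variables (k m M : R) (phi : C -> C).
Hypothesis hphi : Sigma_ k phi.
Hypothesis m_ge0 : 0 <= m.
Hypothesis mM : m <= M.
Hypothesis hbox : large_boxes (fun B => m <= haverage B (fun z =>
  cmod (2 * nonlinearity phi z / (hdensity z)%:C) ^+ 2) <= M).

(** For small [p], the value of [beta] lies between [(m - e) |p|^2 / 4] and
    [(M + e) |p|^2 / 4]. *)
Lemma spectrum_bounds (e : R) : 0 < e -> exists2 q1, 0 < q1 &
  forall p : C, 0 < cmod p < q1 ->
  ((cmod p ^+ 2 / 4 * (m - e))%:E <= beta phi p)%E /\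
  (beta phi p <= (cmod p ^+ 2 / 4 * (M + e))%:E)%E.
Proof.
move=> e0.
pose L := log_derive phi; pose n := nonlinearity phi; pose dn := derive1 n.
have Ln z : extdisk z -> cder L z (n z) by move=> /(cder_log_derive hphi)[].
have n1 z : extdisk z -> exists l, cder n z l by move=> /(cder_log_derive hphi)[].
have ndn z : extdisk z -> cder n z (dn z).
  by move=> /n1[l h]; rewrite /dn (cder_derive1 h).
have cdn z : extdisk z -> {for z, continuous dn}.
  move=> ze; have z1 : 0 < cmod z - 1 by rewrite subr_gt0.
  have zz : cmod (z - z) < cmod z - 1 by rewrite subrr cmod0.
  have hf w : cmod (w - z) < cmod z - 1 -> cder n w (dn w).
    by move=> wz; apply: ndn; exact: extdisk_disc wz.
  have [l hl] := disc_deriv hf zz.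
  exact: cder_cont hl.
have cn z : extdisk z -> {for z, continuous n} by move=> /ndn/cder_cont.
have [n0 [r0 [n01 r01 boxes]]] := box_bounds cn hbox.
have [c [s0 [c0 s00 bloch]]] := bloch_bound n1 m_ge0 mM hbox.
have n00 : 0 < n0 by exact: lt_trans ltr01 n01.
have l0 : 0 < ln n0 by rewrite ln_gt0.
have [d1 d10 U] := @rate_upper R M c (10 * c * n0) (ln n0) e l0 e0.
have [d2 d20 Lw] := @rate_lower R m c (10 * c * n0) (ln n0) e l0 e0.
(* The bound (6 c)^-1 on |p| keeps flux within a constant factor of the mean. *)
pose q1 := Num.min (Num.min d1 d2) (6 * c)^-1.
have c6 : 0 < 6 * c by rewrite mulr_gt0.
exists q1; first by rewrite !lt_min d10 d20 invr_gt0.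
move=> p /andP[p0]; rewrite !lt_min => /andP[/andP[pd1 pd2] pc].
set q := cmod p in p0 pd1 pd2 pc *.
have {}U := U q; rewrite p0 pd1 in U; have {}U := U isT.
have {}Lw := Lw q; rewrite p0 pd2 in Lw; have {}Lw := Lw isT.
have eta : 3 * c * q < 2^-1.
  by move: pc; rewrite -[_^-1]mul1r ltr_pdivlMr // => h; lra.
have eta1 : 3 * c * q < 1 by lra.
have eta0 : 0 <= 3 * c * q by rewrite !mulr_ge0 // ltW.
have q3 : 0 < q ^+ 3 by rewrite exprn_gt0.
pose s1 := Num.min (Num.min 2^-1 (s0 / 2)) (Num.min (r0 - 1) (q ^+ 3)).
have s10 : 0 < s1 by rewrite !lt_min divr_gt0 // invr_gt0 ltr0n subr_gt0 r01.
have s1P s : s <= s1 -> [/\ s < 1, s < s0, 1 + s <= r0 & s <= q ^+ 3].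
  rewrite !le_min => /andP[/andP[a1 a2] /andP[a3 a4]]; split=> //; lra.
pose F s := flux L n p (1 + s).
have FI s : 0 < s <= s1 -> 2^-1 * mean0 L p (1 + s) <= F s /\ F s <= 5 * mean0 L p (1 + s).
  move=> /andP[sp /s1P[a1 a2 _ _]].
  have r1 : 1 < 1 + s by rewrite ltrDl.
  have r2 : 1 + s < 1 + s0 by rewrite ltrD2l.
  have r3 : 1 + s <= 2 by lra.
  have [h1 h2] := flux_bounds Ln ndn bloch p r1 r2 r3.
  have I0 := mean0_gt0 Ln p r1.
  split; first by apply: le_trans h1; apply: ler_wpM2r; [exact: ltW|rewrite -/q; lra].
  apply: le_trans h2 _; apply: ler_wpM2r; first exact: ltW.
  by rewrite -/q expr2; nra.
have F0 s : 0 < s <= s1 -> 0 < F s.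
  move=> hs; have [h _] := FI s hs; apply: lt_le_trans h; rewrite mulr_gt0 ?invr_gt0 //.
  by apply: (mean0_gt0 Ln); case/andP: hs => h _; rewrite ltrDl.
have cF s : 0 < s <= s1 -> {for s, continuous F}.
  move=> /andP[h _]; have r1 : 1 < 1 + s by rewrite ltrDl.
  apply: (@continuous_comp _ _ _ (fun s : R => 1 + s) (flux L n p)).
    by apply: continuousD; [exact: cst_continuous|exact: cvg_id].
  exact: is_derive_cont (derive_flux p Ln ndn cdn r1).
have step s : 0 < s <= s1 ->
    F s * expR (q ^+ 2 / 4 * (m - e) * ln n0) <= F (s / n0) /\
    F (s / n0) <= F s * expR (q ^+ 2 / 4 * (M + e) * ln n0).
  move=> hs; have Fs := F0 s hs; case/andP: hs => sp /s1P[a1 a2 a3 a4].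
  have sE : n0 * (s / n0) = s by field; rewrite gt_eqF.
  have sn0 : 0 < s / n0 by rewrite divr_gt0.
  have := @flux_step R L n dn m M Ln ndn cdn c s0 c0 bloch n0 r0 n01 m_ge0 mM boxes
    p (s / n0) (q ^+ 3) sn0; rewrite sE -/q => /(_ a1 a2 a3 a4 eta1) [h1 h2].
  have oE : osc c n0 p = expR (10 * c * n0 * q) by [].
  have FE x : flux L n p (1 + x) = F x by [].
  rewrite oE !FE in h1 h2.
  have h3 := ler_wpM2l (ltW Fs) U; have h4 := ler_wpM2l (ltW Fs) Lw.
  by split; [exact: le_trans h4 h1|exact: le_trans h2 h3].
have [Du HDu] := growth_upper n01 s10 F0 cF (fun s hs => (step s hs).2).
have [Dl HDl] := growth_lower n01 s10 F0 cF (fun s hs => (step s hs).1).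
split.
  apply: (@beta_lower phi p _ (Dl - ln 5) s1) => // s hs; rewrite circle_meanE -/L.
  have s_gt0 : 1 < 1 + s by case/andP: hs => h _; rewrite ltrDl.
  have I0 := mean0_gt0 Ln p s_gt0.
  have : ln (F s) <= ln (5 * mean0 L p (1 + s)).
    by rewrite ler_ln ?posrE ?F0 ?mulr_gt0 //; have [] := FI s hs.
  by rewrite lnM ?posrE //; have := HDl s hs; lra.
apply: (@beta_upper phi p _ (Du - ln 2^-1) s1) => // s hs; rewrite circle_meanE -/L.
have s_gt0 : 1 < 1 + s by case/andP: hs => h _; rewrite ltrDl.
have I0 := mean0_gt0 Ln p s_gt0.
have i2 : 0 < 2^-1 :> R by rewrite invr_gt0.
have : ln (2^-1 * mean0 L p (1 + s)) <= ln (F s).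
  by rewrite ler_ln ?posrE ?F0 ?mulr_gt0 //; have [] := FI s hs.
by rewrite lnM ?posrE //; have := HDu s hs; lra.
Qed.

End Spectrum.

(** Small punctured discs belong to the filter of punctured neighbourhoods of 0. *)
Lemma dnbhsC (R : realType) (d : R) : 0 < d -> (0 : Cplx R)^' [set p | 0 < cmod p < d].
Proof.
move=> d0; have H : nbhs (0 : Cplx R) (fun p => p != 0 -> 0 < cmod p < d).
  by apply/nbhs_cmod; exists d => // h hd; rewrite add0r -cmod_gt0 => ->.
exact: H.
Qed.

Lemma proper_dnbhsC (R : realType) : ProperFilter ((0 : Cplx R)^').
Proof.
apply: Build_ProperFilter_ex => V V0.
have [d d0 dA] := (nbhs_cmod (0 : Cplx R) (fun p => p != 0 -> V p)).1 V0.
have h : cmod ((d / 2)%:C : Cplx R) = d / 2 by rewrite cmod_real gtr0_norm // divr_gt0.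
exists ((d / 2)%:C); rewrite -[X in V X]add0r; apply: dA; first by rewrite h; lra.
by rewrite add0r -cmod_gt0 h divr_gt0.
Qed.

Theorem theorem1p6 (R : realType) (k m M : R) (phi : Cplx R -> Cplx R)
  (hk : 0 <= k < 1) (hphi : Sigma_ k phi) (hm : 0 <= m) (hmM : m <= M)
  (hbox : large_boxes (fun B =>
     m <= haverage B (fun z =>
            cmod (2 * nonlinearity phi z / (hdensity z)%:C) ^+ 2) <= M)) :
  let q : Cplx R -> \bar R :=
    fun p => (beta phi p * ((cmod p ^+ 2 / 4)^-1)%:E)%E in
  [/\ (m%:E <= limf_einf q (0%R : Cplx R)^')%E,
      (limf_einf q (0%R : Cplx R)^' <= limf_esup q (0%R : Cplx R)^')%E
    & (limf_esup q (0%R : Cplx R)^' <= M%:E)%E].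
Proof.
move=> q.
have Q e : 0 < e -> exists2 q1, 0 < q1 & forall p : Cplx R, 0 < cmod p < q1 ->
    ((m - e)%:E <= q p)%E /\ (q p <= (M + e)%:E)%E.
  move=> e0; have [q1 q10 H] := spectrum_bounds hphi hm hmM hbox e0.
  exists q1 => // p hp; have [h1 h2] := H p hp; have /andP[p0 _] := hp.
  have x0 : 0 < cmod p ^+ 2 / 4 by rewrite divr_gt0 // exprn_gt0.
  have y0 : (0 <= ((cmod p ^+ 2 / 4)^-1)%:E)%E by rewrite lee_fin invr_ge0 ltW.
  have E (b : R) : b%:E = ((cmod p ^+ 2 / 4 * b)%:E * ((cmod p ^+ 2 / 4)^-1)%:E)%E.
    by rewrite -EFinM; congr (_%:E); move: x0; move: (cmod p ^+ 2 / 4) => x x0; field; rewrite gt_eqF.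
  by split; rewrite /q ?(E (m - e)) ?(E (M + e)); exact: (lee_wpmul2r y0).
split.
- apply/lee_addgt0Pr => e e0; rewrite -leeBlDr // -EFinB.
  have [q1 q10 H] := Q e e0.
  by apply: limf_einf_ge (dnbhsC q10) _ => p /H[].
- by apply: limf_einf_le_esup; exact: proper_dnbhsC.
- apply/lee_addgt0Pr => e e0; rewrite -EFinD.
  have [q1 q10 H] := Q e e0.
  by apply: limf_esup_le (dnbhsC q10) _ => p /H[].
Qed.
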